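(* Let $\sigma\in(0,1)$ and consider the dependent mixture model described in the context, driven by a GM-dependent normalized $\sigma$-stable completely random measure $(\tilde p_1,\tilde p_2)$, i.e. a GM-dependent normalized completely random measure with parameters $(c,z,\rho,P_0)$ on $\Theta$ with $\rho(s)=\sigma s^{-1-\sigma}/\Gamma(1-\sigma)$, where $P_0$ has density $g_0=dP_0/dH$. A density of the joint distribution $\mathcal{L}^*$ of the data, the partition, the distinct latent values and the labels is $$\begin{aligned}&\frac{z^{\tilde k_1+\tilde k_2}(1-z)^{k_1+k_2-\tilde k_1-\tilde k_2}}{\Gamma(n_1)\Gamma(n_2)}\,\sigma^{k-1}\,\Gamma(k)\;f(\mathbf x,\mathbf y\mid\boldsymbol\theta^*,\pi)\;\prod_{i=1}^kg_0(\theta_i^* )\\&\qquad\times\xi_\sigma(\mathbf n^{(1)},\mathbf n^{(2)},\mathbf q^* )\int_0^1\frac{w^{n_1-\bar n_1+\tilde k_1\sigma-1}(1-w)^{n_2-\bar n_2+\tilde k_2\sigma-1}}{\{1-z+zw^\sigma+z(1-w)^\sigma\}^k}\,dw,\end{aligned}$$ where $\theta^*_1,\dots,\theta^*_k$ in the product enumerate all $k=k_1+k_2+k_0$ distinct latent values, $\bar n_1=\sum_{i=1}^{n_1}\zeta_{i,1}$, $\bar n_2=\tfrac12\sum_{j=1}^{n_2}\zeta_{j,2}$, and $\tilde k_1=\sum_{j=1}^{k_1}\zeta_{j,1}^*$, $\tilde k_2=\tfrac12\sum_{j=1}^{k_2}\zeta_{j,2}^*$ are the numbers of clusters with label $1$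 and label $2$.
   Context: $\Theta$ is a complete separable metric space with its Borel $\sigma$-algebra; $P_0$ is a nonatomic probability measure on $\Theta$ with density $g_0=dP_0/dH$ with respect to a $\sigma$-finite measure $H$; $c>0$; $z\in(0,1)$ is fixed. Notation: $(a)_n=\Gamma(a+n)/\Gamma(a)$; $\mathbf q^*=(q_{1,1}+q_{1,2},\dots,q_{k_0,1}+q_{k_0,2})$; and $\xi_\sigma(\mathbf n^{(1)},\mathbf n^{(2)},\mathbf q^* )=\prod_{j=1}^{k_1}(1-\sigma)_{n_{j,1}-1}\prod_{j=1}^{k_2}(1-\sigma)_{n_{j,2}-1}\prod_{r=1}^{k_0}(1-\sigma)_{q_{r,1}+q_{r,2}-1}$. GM-dependent normalized CRM with parameters $(c,z,\rho,P_0)$: a completely random measure (CRM) is a random measure whose values on pairwise disjoint measurable sets are mutually independent. Let $\mu_0,\mu_1,\mu_2$ be independent CRMs on $\Theta$, each of the form $\mu(B)=\int_{(0,\infty)\times B}s\,N(ds,d\theta)$ with $N$ a Poisson random measure, the intensity of $N$ being $cz\,\rho(s)\,ds\,P_0(d\theta)$ for $\mu_1$ and for $\mu_2$, and $c(1-z)\,\rho(s)\,ds\,P_0(d\theta)$ for $\mu_0$. Set $\tilde\mu_i=\mu_i+\mu_0$ and $\tilde p_i=\tilde\mu_i/\tilde\mu_i(\Theta)$ for $i=1,2$. With $p_i=\mu_i/\mu_i(\Theta)$ for $i=0,1,2$ and $w_i=\mu_i(\Theta)/(\mu_i(\Theta)+\mu_0(\Theta))$ for $i=1,2$, one has $\tilde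 p_i=w_ip_i+(1-w_i)p_0$. Dependent mixture model (with labels): conditionally on $(\mu_0,\mu_1,\mu_2)$, the labels $\zeta_{i,1}$ ($1\le i\le n_1$) and $\zeta_{j,2}$ ($1\le j\le n_2$) are independent, with $P[\zeta_{i,1}=1]=w_1=1-P[\zeta_{i,1}=0]$ and $P[\zeta_{j,2}=2]=w_2=1-P[\zeta_{j,2}=0]$; conditionally on the labels and $(\mu_0,\mu_1,\mu_2)$, the latent variables $\theta_{i,1}$, $\theta_{j,2}$ are independent with $\theta_{i,1}\sim p_{\zeta_{i,1}}$ and $\theta_{j,2}\sim p_{\zeta_{j,2}}$ (so that, given $(\tilde p_1,\tilde p_2)$ alone, the $\theta_{i,1}$ are i.i.d. $\tilde p_1$ and, independently, the $\theta_{j,2}$ are i.i.d. $\tilde p_2$). Given all of these, the data $X_1,\dots,X_{n_1},Y_1,\dots,Y_{n_2}$ are independent, $X_i$ with density $h(\cdot;\theta_{i,1})$ and $Y_j$ with density $h(\cdot;\theta_{j,2})$, where $h(\cdot;\theta)$ is a kernel of probability densities (jointly measurable) with respect to a fixed $\sigma$-finite measure $\lambda$ on the complete separable metric sample space $\mathbb{X}$. Ties among the latent variables partition the $n_1+n_2$ indices into $k=k_1+k_2+k_0$ clusters; denote the partition by $\pi$. There are $k_1$ clusters $C_{j,1}$ containing only first-sample indices, with sizes $n_{j,1}$ and common values $\theta_{j,1}^*$; $k_2$ clusters $C_{j,2}$ containing only second-sample indices, with sizes $n_{j,2}$ and common values $\theta_{j,2}^*$; and $k_0$ shared clusters, the $r$-th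 consisting of first-sample indices $C_{r,1,0}$ (of cardinality $q_{r,1}\ge1$) and second-sample indices $C_{r,2,0}$ (of cardinality $q_{r,2}\ge1$), with common value $\theta_r^*$. Put $\mathbf n^{(i)}=(n_{1,i},\dots,n_{k_i,i})$, and let $\boldsymbol\theta^*$ be the collection of the $k$ distinct values. Almost surely labels are constant on clusters and equal to $0$ on shared clusters, so the label configuration is encoded by $\boldsymbol\zeta^*$, consisting of the common labels $\zeta_{j,1}^*\in\{0,1\}$ of $C_{j,1}$ ($1\le j\le k_1$) and $\zeta_{j,2}^*\in\{0,2\}$ of $C_{j,2}$ ($1\le j\le k_2$). Finally $$f(\mathbf x,\mathbf y\mid\boldsymbol\theta^*,\pi)=\prod_{j=1}^{k_1}\prod_{i\in C_{j,1}}h(x_i;\theta_{j,1}^* )\prod_{l=1}^{k_2}\prod_{i\in C_{l,2}}h(y_i;\theta_{l,2}^* )\prod_{r=1}^{k_0}\prod_{i\in C_{r,1,0}}h(x_i;\theta_r^* )\prod_{l\in C_{r,2,0}}h(y_l;\theta_r^* ).$$ $\mathcal{L}^*$ is the joint law of (data, partition, distinct latent values, labels). ''Density'' means: for each partition $\pi$ into $k$ clusters and each label configuration encoded by $\boldsymbol\zeta^*$, the restriction of $\mathcal{L}^*$ to the event that the partition is $\pi$ and the labels are given by $\boldsymbol\zeta^*$ has the stated density, as a function of $(\mathbf x,\mathbf y,\boldsymbol\theta^* )$, with respect to $\lambda^{n_1+n_2}\otimes H^k$.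
   Formalization: The exponent of 1−z is corrected to k_1+k_2+k_0−k̃_1−k̃_2: the printed density lacks the factor (1−z)^{k_0} and fails when there are shared clusters (n_1=n_2=1, one tie: its mass stays positive as z→1 although the tie probability tends to 0). *)

(* Defs.v *)
From HB Require Import structures.
From mathcomp Require Import all_boot all_order all_algebra.
From mathcomp Require Import all_classical all_reals all_analysis.
From mathcomp Require Import measurable_realfun.

Set Implicit Arguments.
Unset Strict Implicit.
Unset Printing Implicit Defensive.

Import Order.TTheory GRing.Theory Num.Theory.
Import numFieldNormedType.Exports.

(* The observations of the two samples are indexed by a disjoint sum, and a
   partition into clusters is a {set {set _}} over it, as in finset. *)
Section clusters.
Variables n1 n2 : nat.

Definition sample_index := ('I_n1 + 'I_n2)%type.

Definition in_first (i : sample_index) : bool :=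
  if i is inl _ then true else false.

Implicit Types (C : {set sample_index}) (pi : {set {set sample_index}}).

Definition clusters1 pi := [set C in pi | [forall i in C, in_first i]].
Definition clusters2 pi := [set C in pi | [forall i in C, ~~ in_first i]].
Definition clusters0 pi :=
  [set C in pi | [exists i in C, in_first i] && [exists i in C, ~~ in_first i]].

Definition size1 C := #|[set i in C | in_first i]|.
Definition size2 C := #|[set i in C | ~~ in_first i]|.

(* A label configuration is given by the common label of each cluster; the
   values of [lab] outside [pi] are irrelevant. *)
Definition label_config pi (lab : {set sample_index} -> 'I_3) :=
  [/\ forall C, C \in clusters1 pi -> nat_of_ord (lab C) \in [:: 0; 1],
      forall C, C \in clusters2 pi -> nat_of_ord (lab C) \in [:: 0; 2] &
      forall C, C \in clusters0 pi -> nat_of_ord (lab C) = 0].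

Variables (pi : {set {set sample_index}}) (lab : {set sample_index} -> 'I_3).

Definition nbar1 : nat := \sum_(i < n1) lab (finset.pblock pi (inl i)).
Definition nbar2 : nat := (\sum_(j < n2) lab (finset.pblock pi (inr j)))./2.
Definition ktilde1 : nat := \sum_(C in clusters1 pi) lab C.
Definition ktilde2 : nat := (\sum_(C in clusters2 pi) lab C)./2.

End clusters.
Arguments clusters1 {n1 n2} pi.
Arguments clusters2 {n1 n2} pi.
Arguments clusters0 {n1 n2} pi.
Arguments label_config {n1 n2} pi lab.

Local Open Scope classical_set_scope.
Local Open Scope ring_scope.

#[short(type="completeMetricType")]
HB.structure Definition CompleteMetric (R : numDomainType) :=
  {T of Complete T & Metric R T}.

Definition separable (T : topologicalType) :=
  exists2 D : set T, countable D & dense D.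

Definition borel (T : ptopologicalType) := g_sigma_algebraType (@open T).

HB.instance Definition _ (T : ptopologicalType) := Measurable.on (borel T).

HB.instance Definition _ (n : nat) := isPointed.Build 'I_n.+1 ord0.
HB.instance Definition _ (n : nat) :=
  @isMeasurable.Build default_measure_display 'I_n.+1
    (@discrete_measurable 'I_n.+1)
    (@discrete_measurable0 _) (@discrete_measurableC _)
    (@discrete_measurableU _).

Definition nonatomic d (T : measurableType d) (R : realType)
    (mu : set T -> \bar R) : Prop :=
  forall A, measurable A -> (0 < mu A)%E ->
    exists2 B, measurable B /\ B `<=` A & (0 < mu B < mu A)%E.

Lemma product_sigma_finite d1 d2 (T1 : measurableType d1)
    (T2 : measurableType d2) (R : realType)
    (m1 : {sigma_finite_measure set T1 -> \bar R})
    (m2 : {sigma_finite_measure set T2 -> \bar R}) :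
  sigma_finite setT (m1 \x m2)%E.
Proof.
have /sigma_finiteP[F [TF ndF Foo]] := sigma_finiteT m1.
have /sigma_finiteP[G [TG ndG Goo]] := sigma_finiteT m2.
exists (fun n => F n `*` G n).
  rewrite -setXTT TF TG predeqE => -[x y]; split.
    move=> [/= [n _ Fnx] [k _ Gky]]; exists (maxn n k) => //; split.
    - by move: x Fnx; exact/subsetPset/ndF/leq_maxl.
    - by move: y Gky; exact/subsetPset/ndG/leq_maxr.
  by move=> [n _ []/= ? ?]; split; exists n.
move=> k; have [? ?] := Foo k; have [? ?] := Goo k.
split; first exact: measurableX.
by rewrite product_measure1E// lte_mul_pinfty// ge0_fin_numE.
Qed.

(* n-fold product of a sigma-finite measure, on the tuple sigma-algebra *)
Section power_measure.
Context d (T : measurableType d) (R : realType).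
Local Open Scope ereal_scope.

Definition tuple_cons n (u : T * n.-tuple T) : n.+1.-tuple T :=
  [the n.+1.-tuple T of u.1 :: u.2].

Lemma measurable_tuple_cons n : measurable_fun [set: T * n.-tuple T] (@tuple_cons n).
Proof. exact: measurable_cons. Qed.

Lemma measurable_tuple_uncons n :
  measurable_fun [set: n.+1.-tuple T] (fun t => (thead t, [tuple of behead t])).
Proof.
apply/measurable_fun_pair; last exact: measurable_behead.
exact: measurable_tnth.
Qed.

Section step.
Variables (mu : {sigma_finite_measure set T -> \bar R}) (n : nat).
Variable nu : {sigma_finite_measure set (n.-tuple T) -> \bar R}.

Definition power_step (A : set (n.+1.-tuple T)) : \bar R :=
  (mu \x nu) (@tuple_cons n @^-1` A).

Let mpre A : measurable A -> measurable (@tuple_cons n @^-1` A).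
Proof. by move=> mA; rewrite -[X in measurable X]setTI; exact: measurable_tuple_cons. Qed.

Let power_step0 : power_step set0 = 0.
Proof. by rewrite /power_step preimage_set0 measure0. Qed.

Let power_step_ge0 A : 0 <= power_step A.
Proof. exact: measure_ge0. Qed.

Let power_step_sigma_additive : semi_sigma_additive power_step.
Proof.
move=> F mF tF mUF; rewrite /power_step preimage_bigcup.
apply: measure_semi_sigma_additive.
- by move=> k; exact: mpre.
- apply/trivIsetP => /= i j _ _ ij; rewrite -preimage_setI.
  by move/trivIsetP : tF => /(_ _ _ _ _ ij) ->//; rewrite preimage_set0.
- by rewrite -preimage_bigcup; exact: mpre.
Qed.

HB.instance Definition _ := isMeasure.Build _ _ _ power_step
  power_step0 power_step_ge0 power_step_sigma_additive.

Let power_step_sigma_finite : sigma_finite setT power_step.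
Proof.
have [F FT Foo] := product_sigma_finite mu nu.
pose u (t : n.+1.-tuple T) : T * n.-tuple T := (thead t, [tuple of behead t]).
exists (fun k => u @^-1` F k).
  by rewrite -preimage_bigcup -FT preimage_setT.
move=> k; have [mF Fk] := Foo k; split.
  by rewrite -[X in measurable X]setTI; exact: measurable_tuple_uncons.
rewrite /power_step (_ : _ @^-1` _ = F k)//.
rewrite -comp_preimage (_ : u \o _ = id)//; apply/funext => -[x t].
by rewrite /u /= theadE; congr pair; exact: val_inj.
Qed.

HB.instance Definition _ := Measure_isSigmaFinite.Build _ _ _ power_step
  power_step_sigma_finite.

End step.

Fixpoint power_measure (mu : {sigma_finite_measure set T -> \bar R}) n :
    {sigma_finite_measure set (n.-tuple T) -> \bar R} :=
  match n with
  | 0 => \d_([tuple] : 0.-tuple T)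
  | m.+1 => power_step mu (power_measure mu m)
  end.

Lemma power_measure_box (mu : {sigma_finite_measure set T -> \bar R}) n
    (A : 'I_n -> set T) : (forall i, measurable (A i)) ->
  power_measure mu n [set t | forall i, A i (tnth t i)] = \prod_(i < n) mu (A i).
Proof.
elim: n A => [|n IHn] A mA /=.
  by rewrite big_ord0 diracE mem_set//= => -[].
rewrite big_ord_recl -IHn//.
have mB : measurable [set t : n.-tuple T | forall i, A (lift ord0 i) (tnth t i)].
  rewrite (_ : [set _ | _] =
      \bigcap_(i in [set: 'I_n]) (@tnth _ T ^~ i @^-1` A (lift ord0 i))).
    apply: fin_bigcap_measurable; first exact: finite_finset.
    by move=> i _; rewrite -[X in measurable X]setTI; exact: measurable_tnth.
  by apply/seteqP; split => [t At i _|t At i]; [exact: At|exact: (At i)].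
rewrite -product_measure1E// /power_step; congr (product_measure1 _ _ _).
apply/seteqP; split=> -[x t] /=.
  move=> H; split; first exact: (H ord0).
  by move=> i; have := H (lift ord0 i); rewrite tnthS.
move=> [Ax At] i; have [j ->|->] := unliftP ord0 i; last by [].
by rewrite tnthS.
Qed.

End power_measure.

Section special_functions.
Context {R : realType}.
Local Notation leb := (@lebesgue_measure R).

Definition Gamma (a : R) : R :=
  \int[leb]_(t in `]0, +oo[) (t `^ (a - 1) * expR (- t)).

Definition rising (a : R) (n : nat) : R := Gamma (a + n%:R) / Gamma a.

(* sigma-stable jump intensity *)
Definition rho_stable (sigma s : R) : R :=
  sigma * s `^ (- 1 - sigma) / Gamma (1 - sigma).

End special_functions.

Section independence.
Context d (Omega : measurableType d) (R : realType) (P : probability Omega R).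
Local Open Scope ereal_scope.

Definition rv_events d' (T : measurableType d') (Z : Omega -> T) :
    set (set Omega) :=
  preimage_set_system setT Z measurable.

(* As each [F i] is meant to contain the whole space, the product rule over all
   of [I] contains the one over every subfamily. *)
Definition independent (I : finType) (F : I -> set (set Omega)) : Prop :=
  forall A : I -> set Omega, (forall i, F i (A i)) ->
    P (\bigcap_(i in [set: I]) A i) = \prod_(i : I) P (A i).

(* Conditionally on the sigma-algebra [G], the variables [Z i] are independent,
   and [K i] is the conditional law of [Z i]. *)
Definition cond_independent_laws (G : set (set Omega)) (I : finType)
    d' (T : measurableType d') (Z : I -> Omega -> T)
    (K : I -> Omega -> set T -> \bar R) : Prop :=
  (forall i B (U : set (\bar R)), measurable B -> measurable U -> G ((K i ^~ B) @^-1` U)) /\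
  (forall A, G A -> forall B : I -> set T, (forall i, measurable (B i)) ->
    P (A `&` \bigcap_(i in [set: I]) (Z i @^-1` B i)) =
    \int[P]_(w in A) \prod_(i : I) K i w (B i)).

End independence.

(* [poisson_pmf] is identically 1 at rate 0, where the Poisson law must be the
   Dirac mass at 0. *)
Definition poisson_mass {R : realType} (rate : R) (k : nat) : R :=
  rate ^+ k / k`!%:R * expR (- rate).

(* Random measures are kernels from the probability space. *)
Section random_measures.
Context d (Omega : measurableType d) (R : realType) (P : probability Omega R).
Local Open Scope ereal_scope.

Definition poisson_random_measure d' (E : measurableType d')
    (N : R.-ker Omega ~> E) (nu : set E -> \bar R) : Prop :=
  [/\ forall A, measurable A -> nu A < +oo -> forall k : nat,
        P [set w | N w A = k%:R%:E] = (poisson_mass (fine (nu A)) k)%:E,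
      forall A, measurable A -> nu A = +oo -> P [set w | N w A = +oo] = 1 &
      forall n (A : 'I_n -> set E), (forall i, measurable (A i)) ->
        trivIset setT A ->
        independent P (fun i => rv_events (fun w => N w (A i)))].

Definition rm_events d' (E : measurableType d')
    (mu : Omega -> set E -> \bar R) : set (set Omega) :=
  [set F | exists2 B, measurable B & rv_events (mu ^~ B) F].

Context d' (Theta : measurableType d').

(* the measure a rho(s) ds P0(dtheta) on (0,oo) x Theta *)
Definition levy_intensity (a : R) (rho : R -> R) (P0 : set Theta -> \bar R)
    (A : set (R * Theta)) : \bar R :=
  \int[lebesgue_measure]_(s in `]0%R, +oo[) ((a * rho s)%:E * P0 (xsection A s)).

Definition crm (N : R.-ker Omega ~> (R * Theta)%type) (w : Omega)
    (B : set Theta) : \bar R :=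
  \int[N w]_(u in `]0%R, +oo[ `*` B) (u.1)%:E.

Definition gm_rate (c z : R) (l : 'I_3) : R :=
  if l == ord0 then (c * (1 - z))%R else (c * z)%R.

(* [crm (N l)], for l = 0, 1, 2, are the independent components mu_0, mu_1,
   mu_2 of a GM-dependent vector with parameters (c, z, rho, P0). *)
Definition gm_dependent (c z : R) (rho : R -> R) (P0 : set Theta -> \bar R)
    (N : 'I_3 -> R.-ker Omega ~> (R * Theta)%type) : Prop :=
  (forall l, poisson_random_measure (N l)
     (levy_intensity (gm_rate c z l) rho P0)) /\
  independent P (fun l => <<s rm_events (crm (N l)) >>).

End random_measures.

Section mixture_model.
Context d (Omega : measurableType d) (R : realType) (P : probability Omega R).
Context d1 (X : measurableType d1) d2 (Theta : measurableType d2).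
Variables n1 n2 : nat.
Local Notation I := (sample_index n1 n2).
Local Open Scope ereal_scope.

Variables (N : 'I_3 -> R.-ker Omega ~> (R * Theta)%type).

(* label of the component specific to the sample of i *)
Definition own (i : I) : 'I_3 := if in_first i then inord 1 else inord 2.

Definition mass (l : 'I_3) (w : Omega) : R := fine (crm (N l) w setT).

Definition weight (i : I) (w : Omega) : R :=
  (mass (own i) w / (mass (own i) w + mass ord0 w))%R.

Definition label_law (i : I) (w : Omega) (B : set 'I_3) : \bar R :=
  (weight i w)%:E * \d_(own i) B + (1 - weight i w)%:E * \d_(ord0 : 'I_3) B.

Definition normalized_crm (l : 'I_3) (w : Omega) (B : set Theta) : \bar R :=
  (fine (crm (N l) w B) / mass l w)%:E.

Variables (lam : {sigma_finite_measure set X -> \bar R}) (h : X -> Theta -> R).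
Variables (zeta : I -> {RV P >-> 'I_3}) (theta : I -> {RV P >-> Theta})
  (data : I -> {RV P >-> X}).

Let crm_events := \bigcup_(l in [set: 'I_3]) rm_events (crm (N l)).
Let label_events := \bigcup_(i in [set: I]) rv_events (zeta i).
Let latent_events := \bigcup_(i in [set: I]) rv_events (theta i).

Definition mixture_model : Prop :=
  [/\ cond_independent_laws P <<s crm_events >> zeta label_law,
      cond_independent_laws P <<s crm_events `|` label_events >>
        theta (fun i w B => normalized_crm (zeta i w) w B) &
      cond_independent_laws P
        <<s crm_events `|` label_events `|` latent_events >>
        data (fun i w B => \int[lam]_(x in B) (h x (theta i w))%:E)].

(* Clusters of [pi] are numbered by [enum_val : 'I_#|pi| -> {set I}], and a
   #|pi|-tuple lists the distinct latent values in that order. [joint_law pi lab]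
   is the restriction of the joint law of (data, partition, distinct latent
   values, labels) to the partition [pi] and the labels [lab], as a measure in
   (x, y, t); since the clusters are nonempty, the tuple [t] below is
   unique. *)
Definition joint_law (pi : {set {set I}}) (lab : {set I} -> 'I_3)
    (D : set (n1.-tuple X * n2.-tuple X * #|pi|.-tuple Theta)) : \bar R :=
  P [set w | [/\ preim_partition (fun i => theta i w) [set: I]%SET = pi,
      forall i, zeta i w = lab (finset.pblock pi i) &
      exists2 t : #|pi|.-tuple Theta,
        forall r (i : I), i \in (enum_val r : {set I}) -> theta i w = tnth t r &
        D ([tuple data (inl i) w | i < n1], [tuple data (inr j) w | j < n2], t)]].

End mixture_model.

Section density.
Context (R : realType) d1 (X : measurableType d1) d2 (Theta : measurableType d2).
Variables n1 n2 : nat.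
Local Notation I := (sample_index n1 n2).
Variables (pi : {set {set I}}) (lab : {set I} -> 'I_3).

Local Notation k := #|pi|.
Local Notation k1 := #|clusters1 pi|.
Local Notation k2 := #|clusters2 pi|.
Local Notation k0 := #|clusters0 pi|.
Local Notation kt1 := (ktilde1 pi lab).
Local Notation kt2 := (ktilde2 pi lab).
Local Notation cluster r := (enum_val r : {set I}).

Definition obs (x : n1.-tuple X) (y : n2.-tuple X) (i : I) : X :=
  match i with inl a => tnth x a | inr b => tnth y b end.

Definition likelihood (h : X -> Theta -> R) (x : n1.-tuple X)
    (y : n2.-tuple X) (t : k.-tuple Theta) : R :=
  (\prod_(r < k | cluster r \in clusters1 pi)
     \prod_(i in cluster r) h (obs x y i) (tnth t r)) *
  (\prod_(r < k | cluster r \in clusters2 pi)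
     \prod_(i in cluster r) h (obs x y i) (tnth t r)) *
  (\prod_(r < k | cluster r \in clusters0 pi)
     ((\prod_(i in cluster r | in_first i) h (obs x y i) (tnth t r)) *
      (\prod_(i in cluster r | ~~ in_first i) h (obs x y i) (tnth t r)))).

Definition xi (sigma : R) : R :=
  (\prod_(C in clusters1 pi) rising (1 - sigma) (#|C| - 1)) *
  (\prod_(C in clusters2 pi) rising (1 - sigma) (#|C| - 1)) *
  (\prod_(C in clusters0 pi) rising (1 - sigma) (size1 C + size2 C - 1)).

Definition gm_stable_integral (sigma z : R) : \bar R :=
  (\int[lebesgue_measure]_(w in `]0%R, 1%R[)
    (w `^ (n1%:R - (nbar1 pi lab)%:R + kt1%:R * sigma - 1) *
     (1 - w) `^ (n2%:R - (nbar2 pi lab)%:R + kt2%:R * sigma - 1) /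
     (1 - z + z * w `^ sigma + z * (1 - w) `^ sigma) ^+ k)%:E)%E.

(* All the clusters with label 0, including the k0 shared ones, come from the
   common component, whence the exponent of 1 - z. *)
Definition gm_stable_density (sigma z : R) (h : X -> Theta -> R)
    (g0 : Theta -> R)
    (v : n1.-tuple X * n2.-tuple X * k.-tuple Theta) : \bar R :=
  ((z ^+ (kt1 + kt2) * (1 - z) ^+ (k1 + k2 + k0 - kt1 - kt2) /
     (Gamma n1%:R * Gamma n2%:R) *
   sigma ^+ (k - 1) * Gamma k%:R *
   likelihood h v.1.1 v.1.2 v.2 * (\prod_(r < k) g0 (tnth v.2 r)) *
   xi sigma)%:E * gm_stable_integral sigma z)%E.

End density.

(* Main.v *)
Require Import Defs.
From HB Require Import structures.
From mathcomp Require Import all_boot all_order all_algebra.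
From mathcomp Require Import all_classical all_reals all_analysis.
From mathcomp Require Import measurable_realfun.
From mathcomp Require Import finmap ring lra.
Import Order.TTheory GRing.Theory Num.Theory.
Import numFieldNormedType.Exports.

(* The labels and latent values are drawn from ratios of values of the three
   random measures, and 1 / T ^ n = 1 / Gamma n * int_0^oo u ^ (n - 1) e ^ (- u T)
   turns the expectation of such a product into a double integral over (u, v) of
   derivatives of Laplace transforms, which are explicit for stable random
   measures: the derivative of order n of exp (- q x ^ sigma) is, up to sign,
   exp (- q x ^ sigma) times a polynomial in q without constant term.

   Atoms are never used. The event "the ties are given by pi" is approximated by
   "the values lie in the same cell of a finite partition exactly when they lie in
   the same cluster". When the partition is refined the sum of the squared
   P0-masses of the cells tends to 0, because P0 is nonatomic; only the linear
   terms of the polynomials survive, and they give the factors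
   sigma (1 - sigma)_(n - 1). Polar-type coordinates (u, v) = r (w, 1 - w) reduce
   the double integral to the integral over w. The joint law is then identified
   through its values on boxes. *)

Set Implicit Arguments.
Unset Strict Implicit.
Unset Printing Implicit Defensive.

Local Open Scope ring_scope.

(** * Clusters of a partition *)

(** The limit requires a finite error bound. The refinement error is [concentration] times the
    double integral of [levelfun] with all masses equal to 1, whose integrand is awkward to control
    near the axes. Its finiteness is read off a probability instead: [P0] being nonatomic, there are
    [k] disjoint sets of positive mass, and for their masses the integral is a constant times a
    probability; the masses are then pulled out because the polynomials have degree at most the
    cluster size. The integral over [w] is finite for the same reason. The concentration is the
    probability that two independent draws from [P0] share a cell. As the cells are refined these
    events decrease to the diagonal, which is null because points are. This takes a countable family
    of measurable sets separating the points, provided by separability. The same family makes the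
    diagonal measurable, so that ties are events of the sigma-algebra generated by the latent
    values, on which the conditional law of the data may be used. Independence and conditional laws
    are given on events only; the layer cake formula extends them to functions. *)

Section cluster_combinatorics.
Variables n1 n2 : nat.
Hypothesis n1_gt0 : (0 < n1)%N.
Local Notation I := (sample_index n1 n2).
Variable pi : {set {set I}}.
Hypothesis pi_partition : finset.partition pi [set: I]%SET.

Let cover_pi i : i \in finset.cover pi.
Proof. by case/and3P: pi_partition => /eqP -> _ _; rewrite finset.in_setT. Qed.

Let triv_pi : finset.trivIset pi. Proof. by case/and3P: pi_partition. Qed.

Let pblock_pi i : finset.pblock pi i \in pi. Proof. by rewrite pblock_mem. Qed.

(** [enum_rank_in] asks for a witness that [pi] is inhabited; the block of the first observation of
    the first sample is one, hence the dependence on [n1_gt0]. *)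
Definition cluster_index (i : I) : 'I_#|pi| :=
  enum_rank_in (pblock_pi (inl (Ordinal n1_gt0))) (finset.pblock pi i).

Lemma enum_val_cluster i : enum_val (cluster_index i) = finset.pblock pi i.
Proof. by rewrite /cluster_index enum_rankK_in. Qed.

Lemma cluster_indexP i r : (cluster_index i == r) = (i \in (enum_val r : {set I})).
Proof.
rewrite -(inj_eq enum_val_inj) enum_val_cluster; apply/eqP/idP => [<-|ir].
  by rewrite mem_pblock.
by apply: def_pblock => //; exact: enum_valP.
Qed.

Lemma cluster_nonempty C : C \in pi -> exists i, i \in C.
Proof.
move=> Cpi; apply/set0Pn; apply/eqP => C0.
by case/and3P: pi_partition => _ _; rewrite -C0 Cpi.
Qed.

Definition cluster_rep (r : 'I_#|pi|) : I :=
  odflt (inl (Ordinal n1_gt0)) [pick i in (enum_val r : {set I})].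

Lemma cluster_repK : cancel cluster_rep cluster_index.
Proof.
move=> r; apply/eqP; rewrite cluster_indexP /cluster_rep; case: pickP => //= h.
by have [i] := cluster_nonempty (enum_valP r); rewrite h.
Qed.

Lemma card_cluster r : #|[pred i | cluster_index i == r]| = #|(enum_val r : {set I})|.
Proof. by apply: eq_card => i; rewrite inE /= cluster_indexP. Qed.

Lemma sum_card_cluster : (\sum_r #|[pred i | cluster_index i == r]| = n1 + n2)%N.
Proof.
transitivity (\sum_(i : I) 1)%N; last by rewrite sum1_card card_sum !card_ord.
rewrite (partition_big cluster_index xpredT)//=.
by apply: eq_bigr => r _; rewrite sum1_card.
Qed.

Lemma card_pi_gt0 : (0 < #|pi|)%N.
Proof. by apply/card_gt0P; exists (finset.pblock pi (inl (Ordinal n1_gt0))). Qed.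

Let b1 (C : {set I}) := [exists i in C, in_first i].
Let b2 (C : {set I}) := [exists i in C, ~~ in_first i].

Let in_clusters1 C : (C \in clusters1 pi) = (C \in pi) && ~~ b2 C.
Proof. by rewrite finset.inE negb_exists_in; under [in RHS]eq_forallb_in do rewrite negbK. Qed.

Let in_clusters2 C : (C \in clusters2 pi) = (C \in pi) && ~~ b1 C.
Proof. by rewrite finset.inE negb_exists_in. Qed.

Let in_clusters0 C : (C \in clusters0 pi) = (C \in pi) && (b1 C && b2 C).
Proof. by rewrite finset.inE. Qed.

Let b12 C : C \in pi -> b1 C || b2 C.
Proof.
move=> /cluster_nonempty[i iC]; case: (boolP (in_first i)) => fi.
  by apply/orP; left; apply/existsP; exists i; rewrite iC.
by apply/orP; right; apply/existsP; exists i; rewrite iC.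
Qed.

(** A cluster is nonempty, so [b1] or [b2] holds for it: splitting on [b2] and then on [b1] leaves
    exactly the three families. *)
Lemma big_clusters (T : Type) (idx : T) (op : Monoid.com_law idx) (F : {set I} -> T) :
  \big[op/idx]_(C in pi) F C =
  op (op (\big[op/idx]_(C in clusters1 pi) F C) (\big[op/idx]_(C in clusters2 pi) F C))
     (\big[op/idx]_(C in clusters0 pi) F C).
Proof.
rewrite (bigID (fun C => ~~ b2 C))/= [X in op _ X](bigID (fun C => ~~ b1 C))/=.
rewrite Monoid.mulmA; congr (op (op _ _) _); apply: eq_bigl => C.
- by rewrite in_clusters1.
- rewrite in_clusters2 negbK; case: (boolP (C \in pi)) => //= /b12.
  by case: (b1 C); case: (b2 C).
- by rewrite in_clusters0 !negbK -andbA (andbC (b2 C)).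
Qed.

Lemma card_clusters : (#|clusters1 pi| + #|clusters2 pi| + #|clusters0 pi| = #|pi|)%N.
Proof. by rewrite -!sum1_card big_clusters. Qed.

Lemma size12 (C : {set I}) : (size1 C + size2 C = #|C|)%N.
Proof.
rewrite /size1 /size2 -!sum1_card [RHS](bigID (@in_first n1 n2))/=.
by congr addn; apply: eq_bigl => i; rewrite finset.inE.
Qed.

(** The probabilistic computation treats all clusters alike: a shared cluster contributes through
    its total size only, by [size12]. *)
Lemma xiE (R : realType) (sigma : R) :
  xi pi sigma = \prod_r rising (1 - sigma) (#|[pred i | cluster_index i == r]| - 1).
Proof.
under [RHS]eq_bigr do rewrite card_cluster.
rewrite -(big_enum_val (fun C : {set I} => rising (1 - sigma) (#|C| - 1)))/=.
rewrite big_clusters /xi /=; congr (_ * _ * _).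
by apply: eq_bigr => C _; rewrite size12.
Qed.

(** One kernel factor per observation is the form in which the conditional law of the data produces
    the likelihood. *)
Lemma likelihoodE (R : realType) d1 (X : measurableType d1) d2 (Theta : measurableType d2)
    (h : X -> Theta -> R) (x : n1.-tuple X) (y : n2.-tuple X) (t : #|pi|.-tuple Theta) :
  likelihood h x y t = \prod_(i : I) h (obs x y i) (tnth t (cluster_index i)).
Proof.
rewrite (partition_big cluster_index xpredT)//=.
pose G (C : {set I}) := \prod_(i in C) h (obs x y i) (tnth t (cluster_index i)).
transitivity (\prod_(r < #|pi|) G (enum_val r)); last first.
  by apply: eq_bigr => r _; apply: eq_bigl => i; rewrite cluster_indexP.
have eG r : G (enum_val r) = \prod_(i in (enum_val r : {set I})) h (obs x y i) (tnth t r).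
  by apply: eq_bigr => i; rewrite -cluster_indexP => /eqP ->.
rewrite [RHS](bigID (fun r => ~~ b2 (enum_val r)))/=.
rewrite [X in _ = _ * X](bigID (fun r => ~~ b1 (enum_val r)))/= mulrA.
rewrite /likelihood; congr (_ * _ * _).
- apply: eq_big => [r|r _]; last by rewrite eG.
  by rewrite in_clusters1 enum_valP.
- apply: eq_big => [r|r _]; last by rewrite eG.
  rewrite in_clusters2 enum_valP negbK/=; have := b12 (enum_valP r).
  by case: (b1 _); case: (b2 _).
- apply: eq_big => [r|r _].
    by rewrite in_clusters0 enum_valP !negbK/= andbC.
  by rewrite eG [RHS](bigID (@in_first n1 n2)).
Qed.

Variable lab : {set I} -> 'I_3.
Hypothesis labP : label_config pi lab.
Local Notation lb := (fun r : 'I_#|pi| => lab (enum_val r)).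

Let one3 : nat_of_ord (inord 1 : 'I_3) = 1%N. Proof. by rewrite inordK. Qed.
Let two3 : nat_of_ord (inord 2 : 'I_3) = 2%N. Proof. by rewrite inordK. Qed.

Lemma lab_cases C : C \in pi ->
  [\/ lab C = 0%N :> nat, lab C = 1%N :> nat /\ ~~ b2 C | lab C = 2%N :> nat /\ ~~ b1 C].
Proof.
move=> Cpi; case: labP => h1 h2 h0; have := b12 Cpi.
have := h1 C; have := h2 C; have := h0 C.
rewrite in_clusters1 in_clusters2 in_clusters0 Cpi/=.
case: (b1 C); case: (b2 C) => //= k0 k2 k1 _.
- by constructor 1; apply: k0.
- by have := k1 isT; rewrite !inE => /orP[] /eqP ->; [constructor 1|constructor 2].
- by have := k2 isT; rewrite !inE => /orP[] /eqP ->; [constructor 1|constructor 3].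
Qed.

(** These two labels are the ones that [label_law] can charge for observation [i]; this is how the
    label configuration enters the probability computations. *)
Lemma lb_cases i : lab (enum_val (cluster_index i)) = ord0 \/
  lab (enum_val (cluster_index i)) = own i.
Proof.
rewrite enum_val_cluster; have ipi : i \in finset.pblock pi i by rewrite mem_pblock.
have [e|[e nb]|[e nb]] := lab_cases (pblock_pi i).
- by left; apply: val_inj.
- right; rewrite /own; have -> : in_first i.
    by apply: contraNT nb => ni; apply/existsP; exists i; rewrite ipi.
  by apply: val_inj; rewrite /= one3.
- right; rewrite /own ifF; first by apply: val_inj; rewrite /= two3.
  by apply: contraNF nb => ni; apply/existsP; exists i; rewrite ipi.
Qed.

Let count_lab j : #|[pred r | lb r == j]| = (\sum_(C in pi) (lab C == j))%N.
Proof.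
rewrite -[LHS]sum1_card big_mkcond/= (big_enum_val (fun C : {set I} => lab C == j : nat))/=.
by apply: eq_bigr => r _; rewrite inE; case: ifP.
Qed.

Lemma ktilde1E : #|[pred r | lb r == inord 1]| = ktilde1 pi lab.
Proof.
rewrite count_lab /ktilde1 (bigID (fun C => C \in clusters1 pi))/= [X in (_ + X)%N]big1 ?addn0; last first.
  move=> C /andP[Cpi]; rewrite in_clusters1 Cpi/= negbK => bb.
  rewrite -(inj_eq val_inj)/= one3.
  by have [->|[->]|[->]] := lab_cases Cpi; rewrite ?bb.
apply: eq_big => [C|C /andP[Cpi]].
  by rewrite in_clusters1 andbA andbb.
rewrite in_clusters1 -(inj_eq val_inj)/= one3 Cpi/= => nb.
have [->|[->]|[->]] // := lab_cases Cpi.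
by have := b12 Cpi; rewrite (negbTE nb) orbF => ->.
Qed.

Lemma ktilde2E : #|[pred r | lb r == inord 2]| = ktilde2 pi lab.
Proof.
rewrite count_lab /ktilde2 (bigID (fun C => C \in clusters2 pi))/= [X in (_ + X)%N]big1 ?addn0; last first.
  move=> C /andP[Cpi]; rewrite in_clusters2 Cpi/= negbK => bb.
  rewrite -(inj_eq val_inj)/= two3.
  by have [->|[->]|[->]] := lab_cases Cpi; rewrite ?bb.
(* [ktilde2] is half of a sum of labels that are 0 or 2; once the count is doubled the two sums
   agree term by term. *)
rewrite -[LHS](doubleK) -mul2n big_distrr/=; congr half.
apply: eq_big => [C|C /andP[Cpi]].
  by rewrite in_clusters2 andbA andbb.
rewrite in_clusters2 -(inj_eq val_inj)/= two3 Cpi/= => nb.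
have [->|[->]|[->]] // := lab_cases Cpi.
by have := b12 Cpi; rewrite (negbTE nb)/= => ->.
Qed.

Let sum_lab j : (\sum_(r | lb r == j) #|[pred i | cluster_index i == r]| =
  \sum_(i < n1) (lab (finset.pblock pi (inl i)) == j) +
  \sum_(i < n2) (lab (finset.pblock pi (inr i)) == j))%N.
Proof.
rewrite -(big_sumType _ xpredT (fun i : I => nat_of_bool (lab (finset.pblock pi i) == j)))/=.
under [RHS]eq_bigr do rewrite -enum_val_cluster.
rewrite [RHS](partition_big cluster_index xpredT)//= big_mkcond/=.
apply: eq_bigr => r _; case: ifPn => h.
  by rewrite -sum1_card; apply: eq_bigr => i /eqP ->; rewrite h.
by rewrite big1// => i /eqP ->; rewrite (negbTE h).
Qed.

Lemma nbar1E : (\sum_(r | lb r == inord 1) #|[pred i | cluster_index i == r]|)%N = nbar1 pi lab.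
Proof.
rewrite sum_lab [X in (_ + X)%N]big1 ?addn0; last first.
  move=> i _; have := lb_cases (inr i); rewrite enum_val_cluster /own/=.
  by case=> ->; rewrite -(inj_eq val_inj)/= ?two3 one3.
apply: eq_bigr => i _; have := lb_cases (inl i); rewrite enum_val_cluster /own/=.
by case=> ->; rewrite -(inj_eq val_inj)/= ?one3.
Qed.

Lemma nbar2E : (\sum_(r | lb r == inord 2) #|[pred i | cluster_index i == r]|)%N = nbar2 pi lab.
Proof.
rewrite sum_lab [X in (X + _)%N]big1 ?add0n; last first.
  move=> i _; have := lb_cases (inl i); rewrite enum_val_cluster /own/=.
  by case=> ->; rewrite -(inj_eq val_inj)/= ?one3 two3.
(* The same doubling as for [ktilde2]: the summands of [nbar2] are 0 or 2. *)
rewrite /nbar2 -[LHS]doubleK -mul2n big_distrr/=; congr half.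
apply: eq_bigr => i _; have := lb_cases (inr i); rewrite enum_val_cluster /own/=.
by case=> ->; rewrite -(inj_eq val_inj)/= ?two3.
Qed.

End cluster_combinatorics.

(** * Integration *)

Local Open Scope classical_set_scope.
Local Open Scope ring_scope.

Lemma indic_bool (T : Type) (R : pzRingType) (p : T -> bool) (x : T) :
  \1_[set y | p y] x = (p x)%:R :> R.
Proof.
rewrite indicE; suff -> : (x \in [set y | p y]) = p x by [].
by apply/idP/idP => [/set_mem|px]; last exact/mem_set.
Qed.

Section tonelli.
Context d1 d2 (T1 : measurableType d1) (T2 : measurableType d2) (R : realType).
Variables (m1 : {sigma_finite_measure set T1 -> \bar R})
  (m2 : {sigma_finite_measure set T2 -> \bar R}).
Local Open Scope ereal_scope.

Lemma integral_indicM d (T : measurableType d) (mu : {measure set T -> \bar R})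
    (D : set T) (f : T -> \bar R) :
  \int[mu]_(x in D) f x = \int[mu]_x (f x * (\1_D x)%:E).
Proof. by rewrite integral_mkcond epatch_indic. Qed.

Lemma measurable_integral_snd (D2 : set T2) (f : T1 -> T2 -> \bar R) :
  measurable D2 -> measurable_fun setT (fun u => f u.1 u.2) ->
  (forall x y, 0 <= f x y) ->
  measurable_fun setT (fun x => \int[m2]_(y in D2) f x y).
Proof.
move=> mD2 mf f0; under eq_fun do rewrite integral_indicM.
apply: (@measurable_fun_fubini_tonelli_F _ _ _ _ _ m2
  (fun u => f u.1 u.2 * (\1_D2 u.2)%:E)) => //=; last first.
  by move=> u; rewrite mule_ge0// lee_fin.
apply: emeasurable_funM => //; apply/measurable_EFinP.
exact: (measurableT_comp (measurable_indic mD2) measurable_snd).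
Qed.

Lemma tonelli_in (D1 : set T1) (D2 : set T2) (f : T1 -> T2 -> \bar R) :
  measurable D1 -> measurable D2 -> measurable_fun setT (fun u => f u.1 u.2) ->
  (forall x y, 0 <= f x y) ->
  \int[m1]_(x in D1) \int[m2]_(y in D2) f x y =
  \int[m2]_(y in D2) \int[m1]_(x in D1) f x y.
Proof.
move=> mD1 mD2 mf f0.
have m1D : measurable_fun setT (fun u : T1 * T2 => (\1_D1 u.1)%:E : \bar R).
  apply/measurable_EFinP.
  exact: (measurableT_comp (measurable_indic mD1) measurable_fst).
have m2D : measurable_fun setT (fun u : T1 * T2 => (\1_D2 u.2)%:E : \bar R).
  apply/measurable_EFinP.
  exact: (measurableT_comp (measurable_indic mD2) measurable_snd).
have i0 d (T : measurableType d) (D : set T) x : 0 <= (\1_D x)%:E :> \bar R.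
  by rewrite lee_fin.
have mf1 x : measurable_fun setT (f x).
  exact: (measurableT_comp mf (pair1_measurable _)).
have mf2 y : measurable_fun setT (f ^~ y).
  exact: (measurableT_comp mf (pair2_measurable _)).
transitivity (\int[m1]_x \int[m2]_y (f x y * (\1_D1 x)%:E * (\1_D2 y)%:E)).
  rewrite integral_indicM; apply: eq_integral => x _.
  rewrite integral_indicM -ge0_integralZr//.
  - by apply: eq_integral => y _; rewrite muleAC.
  - apply: emeasurable_funM => //; apply/measurable_EFinP.
    exact: measurable_indic.
  - by move=> y _; rewrite mule_ge0.
rewrite (@fubini_tonelli _ _ _ _ _ m1 m2
  (fun u => f u.1 u.2 * (\1_D1 u.1)%:E * (\1_D2 u.2)%:E)); last 2 first.
- by apply: emeasurable_funM => //; exact: emeasurable_funM.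
- by move=> u; rewrite !mule_ge0.
rewrite [RHS]integral_indicM; apply: eq_integral => y _ /=.
rewrite [X in _ = X * _]integral_indicM -ge0_integralZr//.
- apply: emeasurable_funM => //; apply/measurable_EFinP.
  exact: measurable_indic.
- by move=> x _; rewrite mule_ge0.
Qed.

End tonelli.

Notation pushforward_measure m mf :=
  (measure_function_pushforward__canonical__measure_function_Measure m mf)
  (only parsing).

Section density_measure.
Context d (T : measurableType d) (R : realType).
Variable mu : {measure set T -> \bar R}.
Local Open Scope ereal_scope.

(** The proofs [mf] and [f0] are arguments so that the canonical measure structure can be attached
    to the term [dens mf f0]. *)
Definition dens (f : T -> R) (mf : measurable_fun setT f)
  (f0 : forall x, (0 <= f x)%R) (A : set T) := \int[mu]_(x in A) (f x)%:E.

Variables (f : T -> R) (mf : measurable_fun setT f)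
  (f0 : forall x, (0 <= f x)%R).

Let mfE : measurable_fun setT (EFin \o f).
Proof. exact/measurable_EFinP. Qed.

Let dens0 : dens mf f0 set0 = 0.
Proof. exact: integral_set0. Qed.

Let dens_ge0 A : 0 <= dens mf f0 A.
Proof. by apply: integral_ge0 => x _; rewrite lee_fin. Qed.

Let dens_sigma_additive : semi_sigma_additive (dens mf f0).
Proof.
move=> F mF tF mUF; rewrite /dens ge0_integral_bigcup//.
- apply: is_cvg_ereal_nneg_natsum_cond => n _ _.
  by apply: integral_ge0 => x _; rewrite lee_fin.
- exact: measurable_funTS.
- by move=> x _; rewrite lee_fin.
Qed.

HB.instance Definition _ := isMeasure.Build _ _ _ (dens mf f0)
  dens0 dens_ge0 dens_sigma_additive.

Import HBNNSimple.

(** Monotone convergence reduces to simple [g], linearity to the indicator of a level set, and there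
    both sides are the definition of [dens]. *)
Lemma integral_dens (g : T -> \bar R) : measurable_fun setT g ->
  (forall x, 0 <= g x) ->
  \int[dens mf f0]_x g x = \int[mu]_x (g x * (f x)%:E).
Proof.
move=> mg g0.
pose h := nnsfun_approx measurableT mg.
have cvgh x : (h n x)%:E @[n --> \oo] --> g x.
  by apply: cvg_nnsfun_approx.
have ndh x a b : (a <= b)%N -> (h a x <= h b x)%R.
  by move=> ab; exact/lefP/nd_nnsfun_approx.
have mh n : measurable_fun setT (fun x => (h n x)%:E).
  exact/measurable_EFinP.
have -> : \int[dens mf f0]_x g x = limn (fun n => \int[dens mf f0]_x (h n x)%:E).
  rewrite -monotone_convergence//.
  - by apply: eq_integral => x _; apply/esym/cvg_lim => //; exact: cvgh.
  - by move=> n x _; rewrite lee_fin.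
  - by move=> x _ a b ab; rewrite lee_fin; exact: ndh.
have -> : \int[mu]_x (g x * (f x)%:E) =
    limn (fun n => \int[mu]_x ((h n x)%:E * (f x)%:E)).
  rewrite -monotone_convergence//.
  - apply: eq_integral => x _; apply/esym/cvg_lim => //.
    by apply: cvgeZr.
  - by move=> n; exact: emeasurable_funM.
  - by move=> n x _; rewrite mule_ge0// lee_fin.
  - by move=> x _ a b ab; rewrite lee_wpmul2r// lee_fin//; exact: ndh.
apply/congr_lim/funext => n.
pose s := fset_set (range (h n)).
have s0 (i : 'I_#|`s|) : (0 <= s`_i)%R.
  have : s`_i \in s by exact: mem_nth.
  by rewrite in_fset_set// => /set_mem[x _ <-]; exact: fun_ge0.
have mi (i : 'I_#|`s|) : measurable (h n @^-1` [set s`_i]) by [].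
have mind (i : 'I_#|`s|) : measurable_fun setT (\1_(h n @^-1` [set s`_i]) : T -> R).
  exact: measurable_indic.
have hg x : (h n x)%:E = \sum_(i < #|`s|)
    (s`_i * \1_(h n @^-1` [set s`_i]) x)%:E.
  by rewrite fimfunEord -sumEFin.
have hf x : (h n x)%:E * (f x)%:E = \sum_(i < #|`s|)
    (f x * (s`_i * \1_(h n @^-1` [set s`_i]) x))%:E.
  by rewrite -EFinM fimfunEord mulrC mulr_sumr -sumEFin.
under [LHS]eq_integral do rewrite hg.
under [RHS]eq_integral do rewrite hf.
rewrite !ge0_integral_sum//; last 4 first.
- move=> i; apply/measurable_EFinP; apply: measurable_funM => //.
  exact: measurable_funM.
- by move=> i x _; rewrite lee_fin !mulr_ge0// indicE.
- by move=> i; apply/measurable_EFinP; exact: measurable_funM.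
- by move=> i x _; rewrite lee_fin !mulr_ge0// indicE.
apply: eq_bigr => i _.
under eq_integral do rewrite EFinM.
rewrite ge0_integralZl_EFin//; last exact/measurable_EFinP.
rewrite integral_indic// setIT.
under [RHS]eq_integral do rewrite mulrCA EFinM.
rewrite ge0_integralZl_EFin//; last 2 first.
- by move=> x _; rewrite lee_fin mulr_ge0.
- by apply/measurable_EFinP; exact: measurable_funM.
congr (_ * _).
rewrite [LHS]integral_indicM.
by apply: eq_integral => x _; rewrite EFinM.
Qed.
End density_measure.

(** * Change of variables onto the positive half line *)

Section substitution.
Context {R : realType}.
Local Notation leb := (@lebesgue_measure R).
Local Notation pos := `]0%R, +oo[%classic.
Variables (I : interval R) (phi dphi psi : R -> R).
Let D := [set` I].
Hypothesis mphi : measurable_fun setT phi.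
Hypothesis mdphi : measurable_fun setT dphi.
Hypothesis dphi_ge0 : forall x, 0 <= dphi x.
Hypothesis dphi_cont : forall x, D x -> {for x, continuous dphi}.
Hypothesis phi_derive : forall x, D x -> is_derive x (1 : R) phi (dphi x).
Hypothesis phi_pos : forall x, D x -> 0 < phi x.
Hypothesis phi_homo : forall x y, D x -> D y -> x < y -> phi x < phi y.
Hypothesis psi_in : forall y, 0 < y -> D (psi y).
Hypothesis psiK : forall y, 0 < y -> phi (psi y) = y.

Let g x := dphi x * \1_D x.
Let mg : measurable_fun setT g.
Proof.
by apply: measurable_funM => //; apply: measurable_indic; exact: measurable_itv.
Qed.
Let g0 x : 0 <= g x.
Proof. by rewrite mulr_ge0. Qed.

Local Open Scope ereal_scope.

(** The image under [phi] of the measure with density [dphi] on [D]. The substitution formula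
    amounts to the identity of [m2] with Lebesgue measure on the half line. *)
Let m2 : {measure set (measurableTypeR R) -> \bar R} :=
  @measure_function_pushforward__canonical__measure_function_Measure
    _ _ _ (measurableTypeR R) _ (dens leb mg g0) phi mphi.

Let m2E A : measurable A ->
  m2 A = \int[leb]_(x in D `&` phi @^-1` A) (dphi x)%:E.
Proof.
move=> mA; rewrite /m2 /= /pushforward /dens.
rewrite [RHS]integral_mkcondl; apply: eq_integral => x _.
by rewrite epatch_indic /g EFinM.
Qed.

Let phi_mono x y : D x -> D y -> (phi x <= phi y)%R = (x <= y)%R.
Proof.
move=> Dx Dy; case: (leP x y) => xy.
  move: xy; rewrite le_eqVlt => /predU1P[->|xy]; first by rewrite lexx.
  by rewrite ltW// phi_homo.
by apply/negbTE; rewrite -ltNge phi_homo.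
Qed.

Let phi_mono_lt x y : D x -> D y -> (phi x < phi y)%R = (x < y)%R.
Proof. by move=> Dx Dy; rewrite !ltNge phi_mono. Qed.

(** The preimage is the interval from [psi a] to [psi b], and the fundamental theorem of calculus
    integrates [dphi] over it. *)
Let m2_oc a b : (0 < a)%R -> (a <= b)%R -> m2 `]a, b]%classic = (b - a)%:E.
Proof.
move=> a0; rewrite le_eqVlt => /predU1P[<-|ab].
  by rewrite set_itvoc0 measure0 subrr.
have b0 : (0 < b)%R by exact: lt_trans ab.
have pab : (psi a < psi b)%R by rewrite -phi_mono_lt ?psiK//; exact: psi_in.
have ID x : (psi a <= x <= psi b)%R -> D x.
  exact: (@interval_is_interval _ I _ _ (psi_in a0) (psi_in b0)).
rewrite m2E; last exact: measurable_itv.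
have -> : D `&` phi @^-1` `]a, b]%classic = `]psi a, psi b]%classic.
  apply/seteqP; split => x /=; rewrite !in_itv/=.
    move=> [Dx]; rewrite -{1}(psiK a0) -{1}(psiK b0).
    by rewrite phi_mono ?phi_mono_lt//; exact: psi_in.
  move=> xab; have Dx : D x by apply: ID; case/andP: xab => /ltW -> ->.
  split => //; rewrite -{1}(psiK a0) -{1}(psiK b0).
  by rewrite phi_mono ?phi_mono_lt//; exact: psi_in.
rewrite integral_itv_obnd_cbnd; last exact/measurable_EFinP/measurable_funTS.
rewrite (@continuous_FTC2 _ _ phi)//.
- by rewrite !psiK// EFinB.
- apply/subspace_continuousP => x; rewrite /= in_itv/= => /ID Dx.
  by apply: cvg_within_filter; exact: dphi_cont.
- have cphi x : D x -> {for x, continuous phi}.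
    move=> Dx; apply: differentiable_continuous; apply/derivable1_diffP.
    by have [] := phi_derive Dx.
  split.
  + move=> x; rewrite in_itv/= => /andP[/ltW h1 /ltW h2].
    have Dx : D x by apply: ID; rewrite h1 h2.
    by have [] := phi_derive Dx.
  + by apply: cvg_at_right_filter; apply: cphi; exact: psi_in.
  + by apply: cvg_at_left_filter; apply: cphi; exact: psi_in.
- move=> x; rewrite in_itv/= => /andP[/ltW h1 /ltW h2].
  rewrite derive1E; apply: derive_val.
  by apply: phi_derive; apply: ID; rewrite h1 h2.
Qed.

(** [psi] is only controlled at positive points, so the interval is exhausted by the [](b / n.+1),
    b]], on which both measures agree by [m2_oc]. *)
Let m2_0c b : (0 < b)%R -> m2 `]0%R, b]%classic = b%:E.
Proof.
move=> b0; pose F n := `](b / n.+1%:R)%R, b]%classic.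
have F0b : \bigcup_n F n = `]0%R, b]%classic.
  apply/seteqP; split => x /=; rewrite ?in_itv/=.
    move=> [n _]; rewrite /F /= in_itv/= => /andP[+ ->]; rewrite andbT.
    by apply: le_lt_trans; rewrite divr_ge0// ltW.
  move=> /andP[x0 xb]; exists (Num.truncn (b / x)) => //; rewrite /F /= in_itv/= xb andbT.
  by rewrite ltr_pdivrMr// mulrC -ltr_pdivrMr// truncnS_gt.
have ndF : nondecreasing_seq F.
  move=> n m nm; apply/subsetPset => x; rewrite /F/= !in_itv/= => /andP[+ ->].
  rewrite andbT; apply: le_lt_trans.
  by rewrite ler_pM2l// lef_pV2 ?posrE// ler_nat.
have mF n : measurable (F n) by exact: measurable_itv.
have cF (m : {measure set (measurableTypeR R) -> \bar R}) :
    m (F n) @[n --> \oo] --> m `]0%R, b]%classic.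
  by rewrite -F0b; apply: nondecreasing_cvg_mu => //; exact: bigcupT_measurable.
have h1 := cF m2; have h2 := cF leb.
have e : m2 \o F = leb \o F.
  apply/funext => n /=; rewrite m2_oc ?divr_gt0//; last first.
    by rewrite ler_pdivrMr// ler_peMr ?ler1n// ltW.
  rewrite /F lebesgue_measure_itv/= lte_fin ltr_pdivrMr// ltr_pMr// ltr1n.
  by case: n => //=; rewrite divr1 subrr.
have /cvg_lim <- // : (leb \o F) n @[n --> \oo] --> m2 `]0%R, b]%classic.
  by rewrite -e.
rewrite (cvg_lim _ h2)//.
rewrite [LHS](lebesgue_measure_itv `]0%R, b])/= lte_fin b0.
by rewrite oppr0 adde0.
Qed.

Let m2_pos A : measurable A -> m2 A = m2 (A `&` pos).
Proof.
move=> mA; rewrite !m2E//; last exact: measurableI.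
congr (integral _ _ _); apply/seteqP; split => x /=; last by case => ? [].
by case=> Dx Ax; split => //; split => //; rewrite in_itv/= phi_pos.
Qed.

(** [lebesgue_measure_unique] concerns measures on the whole line, so [m2] is completed by Lebesgue
    measure on the nonpositive half line before the comparison on half-open intervals. *)
Let m2_unique A : measurable A -> m2 A = leb (A `&` pos).
Proof.
move=> mA.
pose Neg := `]-oo, 0%R]%classic : set (measurableTypeR R).
have mN : measurable Neg by exact: measurable_itv.
have mP : measurable (pos : set (measurableTypeR R)) by exact: measurable_itv.
have NP : Neg `|` pos = setT.
  by apply/seteqP; split => x //= _; rewrite !in_itv/= andbT; case: leP; [left|right].
have NIP B : B `&` pos `&` Neg = set0.
  apply/seteqP; split => x //= [[_]]; rewrite !in_itv/= andbT => x0.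
  by rewrite /Neg /= in_itv/= leNgt x0.
have leb_add B : measurable B -> leb B = measure_add m2 (mrestr leb mN) B.
  apply: lebesgue_measure_unique => // _ [[a b] _ <-].
  rewrite [RHS]measure_addE /= /mrestr.
  have mab : measurable (`]a, b]%classic : set (measurableTypeR R)).
    exact: measurable_itv.
  have -> : leb `]a, b]%classic =
      leb (`]a, b]%classic `&` pos) + leb (`]a, b]%classic `&` Neg).
    rewrite -measureU//; [|exact: measurableI|exact: measurableI|].
      by rewrite -setIUr setUC NP setIT.
    by rewrite setIACA setIid setIA NIP.
  congr (_ + _).
  rewrite m2_pos//.
  have [b0|b0] := leP b 0%R.
    have -> : `]a, b] `&` pos = set0 :> set R.
      apply/seteqP; split => x //= []; rewrite !in_itv/= andbT => /andP[_ xb] x0.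
      by move: (lt_le_trans x0 xb); rewrite ltNge b0.
    by rewrite !measure0.
  have [a0|a0] := ltP 0%R a.
    have -> : `]a, b] `&` pos = `]a, b]%classic :> set R.
      apply/seteqP; split => x //=; first by case.
      rewrite !in_itv/= andbT => /andP[ax xb]; rewrite ax xb; split => //.
      exact: lt_trans ax.
    have [ab|ab] := leP a b.
      rewrite m2_oc// lebesgue_measure_itv/= lte_fin.
      move: ab; rewrite le_eqVlt => /predU1P[->|->]; last by rewrite EFinB.
      by rewrite ltxx subrr.
    by rewrite set_itv_ge ?measure0// bnd_simp -leNgt ltW.
  have -> : `]a, b] `&` pos = `]0%R, b]%classic :> set R.
    apply/seteqP; split => x //=; rewrite !in_itv/= ?andbT.
      by case => /andP[_ ->] ->.
    by case/andP=> x0 ->; rewrite x0 (le_lt_trans a0).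
  by rewrite m2_0c// lebesgue_measure_itv/= lte_fin b0 oppr0 adde0.
have mAP : measurable (A `&` pos) by exact: measurableI.
by rewrite m2_pos// leb_add// [RHS]measure_addE /= /mrestr NIP measure0 adde0.
Qed.

Lemma ge0_integral_substitution (f : R -> \bar R) :
  measurable_fun setT f -> (forall x, 0 <= f x) ->
  \int[leb]_(y in pos) f y = \int[leb]_(x in D) (f (phi x) * (dphi x)%:E).
Proof.
move=> mf f0.
have mP : measurable (pos : set (measurableTypeR R)) by exact: measurable_itv.
have -> : \int[leb]_(x in pos) f x = \int[m2]_(x in pos) f x.
  apply: eq_measure_integral => A mA AP.
  by rewrite m2_unique// setIidl.
rewrite ge0_integral_pushforward//=; last first.
  exact: measurable_funTS.
have mphi_pos : measurable (phi @^-1` pos).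
  by rewrite -[X in measurable X]setTI; apply: mphi => //; exact: measurable_itv.
rewrite [LHS]integral_indicM integral_dens//; last 2 first.
- apply: emeasurable_funM; first exact: measurableT_comp.
  by apply/measurable_EFinP; exact: measurable_indic.
- by move=> x; rewrite mule_ge0// lee_fin.
rewrite [RHS]integral_indicM; apply: eq_integral => x _ /=.
rewrite /g !indicE; case: (boolP (x \in D)) => xD; last by rewrite mulr0 !mule0.
by rewrite mem_set ?mule1 ?mulr1//= in_itv/= phi_pos//; exact: set_mem.
Qed.
End substitution.

(** * Gamma integrals and the stable Laplace exponent *)

Section gamma.
Context {R : realType}.
Local Notation leb := (@lebesgue_measure R).
Local Notation pos := `]0%R, +oo[%classic.
Implicit Types (a b s t x y : R).

Lemma continuous_powR a x : 0 < x -> {for x, continuous (@powR R ^~ a)}.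
Proof.
move=> x0; apply: differentiable_continuous; apply/derivable1_diffP.
by have [] := is_derive1_powR a x0.
Qed.

Lemma measurable_powR_comp d (T : measurableType d) (f : T -> R) a :
  measurable_fun setT f -> measurable_fun setT (fun w => f w `^ a).
Proof. by move=> mf; exact: (measurableT_comp (measurable_powR a) mf). Qed.

Lemma measurable_expRN d (T : measurableType d) (f : T -> R) :
  measurable_fun setT f -> measurable_fun setT (fun w => expR (- f w)).
Proof. by move=> mf; do 2 apply: measurableT_comp => //. Qed.

Lemma measurable_lt_set t : measurable [set s : R | s < t].
Proof.
have -> : [set s : R | s < t] = `]-oo, t[%classic.
  by apply/seteqP; split => s /=; rewrite in_itv.
exact: measurable_itv.
Qed.

Lemma ltr_powR2 a x y : 0 < a -> 0 <= x -> 0 <= y -> (x `^ a < y `^ a) = (x < y).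
Proof.
move=> a0 x0 y0; apply/idP/idP => [|xy]; last by apply: gt0_ltr_powR.
rewrite !ltNge; apply: contra => h.
by apply: ge0_ler_powR; rewrite ?nnegrE // ltW.
Qed.

Lemma powRrV a x : a != 0 -> 0 <= x -> (x `^ a) `^ a^-1 = x.
Proof. by move=> a0 x0; rewrite -powRrM divff// powRr1. Qed.

Local Open Scope ereal_scope.

Lemma substitution_powR a (f : R -> \bar R) : (0 < a)%R ->
  measurable_fun setT f -> (forall x, 0 <= f x) ->
  \int[leb]_(y in pos) f y =
  \int[leb]_(x in pos) (f (x `^ a)%R * (a * x `^ (a - 1))%:E).
Proof.
move=> a0 mf f0.
apply: (@ge0_integral_substitution R `]0%R, +oo[ (@powR R ^~ a)
  (fun x => a * x `^ (a - 1))%R (@powR R ^~ a^-1)%R) => //.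
- by apply: measurable_funM => //; exact: measurable_powR.
- by move=> x; rewrite mulr_ge0// ?powR_ge0// ltW.
- move=> x; rewrite /= in_itv/= andbT => x0.
  by apply: cvgM; [exact: cvg_cst|exact: continuous_powR].
- by move=> x; rewrite /= in_itv/= andbT => x0; exact: is_derive1_powR.
- by move=> x; rewrite /= in_itv/= andbT; exact: powR_gt0.
- move=> x y; rewrite /= !in_itv/= !andbT => x0 y0 xy.
  by apply: gt0_ltr_powR => //; rewrite nnegrE ltW.
- by move=> y y0; rewrite /= in_itv/= andbT powR_gt0.
- move=> y y0; rewrite -{2}(@powRrV a^-1 y) ?invrK ?ltW//.
  by rewrite invr_eq0 gt_eqF.
Qed.

Lemma substitution_scale a (f : R -> \bar R) : (0 < a)%R ->
  measurable_fun setT f -> (forall x, 0 <= f x) ->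
  \int[leb]_(y in pos) f y = \int[leb]_(x in pos) (f (a * x)%R * a%:E).
Proof.
move=> a0 mf f0.
apply: (@ge0_integral_substitution R `]0%R, +oo[ ( *%R a)
  (cst a) ( *%R a^-1)) => //.
- by move=> x; rewrite /= ltW.
- by move=> x _; exact: cvg_cst.
- move=> x _; have := is_deriveZ a (@is_derive_id R R x 1%R).
  by rewrite /GRing.scale/= mulr1.
- by move=> x; rewrite /= in_itv/= andbT; exact: mulr_gt0.
- by move=> x y _ _; rewrite ltr_pM2l.
- by move=> y y0; rewrite /= in_itv/= andbT mulr_gt0// invr_gt0.
- by move=> y y0; rewrite mulVKf// gt_eqF.
Qed.

(** The substitution [y = s ^ a] turns the integral into the length of []0, t ^ a[]. *)
Lemma integral_lt_powR a t : (0 < a)%R -> (0 < t)%R ->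
  \int[leb]_(s in pos) (a * s `^ (a - 1) * \1_[set s | (s < t)%R] s)%:E
  = (t `^ a)%:E.
Proof.
move=> a0 t0.
have mlt (r : R) := measurable_lt_set r.
transitivity (\int[leb]_(y in pos) (\1_[set s | (s < t `^ a)%R] y)%:E).
  rewrite [RHS](@substitution_powR a)//; last first.
    by apply/measurable_EFinP; exact: measurable_indic.
  apply: eq_integral => s /set_mem; rewrite /= in_itv/= andbT => s0.
  rewrite -EFinM mulrC !indic_bool; congr (_%:R * _)%:E.
  by rewrite ltr_powR2 ?ltW.
rewrite integral_indic//; last exact: mlt.
have -> : [set s | (s < t `^ a)%R] `&` pos = `]0%R, (t `^ a)%R[%classic.
  by apply/seteqP; split => s /=; rewrite !in_itv/= andbT;
    [case=> -> ->|case/andP=> -> ->].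
by rewrite [LHS]lebesgue_measure_itv/= lte_fin powR_gt0// oppr0 adde0.
Qed.

Lemma integral_gt_expR s : \int[leb]_(t in `]s, +oo[) (expR (- t))%:E
  = (expR (- s))%:E.
Proof.
rewrite integral_itv_obnd_cbnd; last first.
  apply/measurable_EFinP/measurable_funTS.
  exact: measurableT_comp.
have dF (x : R) : is_derive x (1%R : R) (fun t => - expR (- t))%R (expR (- x)).
  have := is_deriveN (is_derive1_comp (is_derive_expR (- x)%R) (is_deriveNid x 1%R)).
  by rewrite /= mulrN1 opprK.
have cF (x : R) : {for x, continuous (fun t : R => expR (- t))}.
  apply: continuous_comp; [exact: opp_continuous|exact: continuous_expR].
rewrite (@ge0_continuous_FTC2y _ _ (fun t => - expR (- t))%R _ 0%R).
- by rewrite -EFinB sub0r opprK.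
- by move=> x _; exact: expR_ge0.
- by apply: continuous_subspaceT => x; exact: cF.
- by rewrite -oppr0; apply: cvgN; exact: cvgr_expR.
- by move=> x _; have [] := dF x.
- by apply: cvg_at_right_filter; apply: cvgN; exact: cF.
- by move=> x _; rewrite derive1E; apply: derive_val.
Qed.

Lemma integral_gt_powRN a t : (0 < a)%R -> (0 < t)%R ->
  \int[leb]_(s in `]t, +oo[) (a * s `^ (- 1 - a))%:E = (t `^ (- a))%:E.
Proof.
move=> a0 t0.
rewrite integral_itv_obnd_cbnd; last first.
  apply/measurable_EFinP/measurable_funTS.
  by apply: measurable_funM => //; exact: measurable_powR.
have dF (x : R) : (0 < x)%R ->
    is_derive x (1%R : R) (fun t => - t `^ (- a))%R (a * x `^ (-1 - a))%R.
  move=> x0; have := is_deriveN (is_derive1_powR (- a) x0).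
  by rewrite mulNr opprK addrC.
have cF b (x : R) : (0 < x)%R -> {for x, continuous (fun t : R => t `^ b)%R}.
  exact: continuous_powR.
rewrite (@ge0_continuous_FTC2y _ _ (fun t => - t `^ (- a))%R _ 0%R).
- by rewrite -EFinB sub0r opprK.
- by move=> x _; rewrite mulr_ge0 ?powR_ge0// ltW.
- apply/subspace_continuousP => x; rewrite /= in_itv/= andbT => tx.
  apply: cvg_within_filter; apply: cvgM; first exact: cvg_cst.
  by apply: cF; exact: lt_le_trans tx.
- rewrite -oppr0; apply: cvgN; apply/cvgrPdist_lt => e e0.
  exists (e^-1 `^ a^-1)%R; split; first exact: num_real.
  move=> x hx; rewrite sub0r normrN ger0_norm ?powR_ge0// powRN.
  have x0 : (0 < x)%R by apply: le_lt_trans hx; exact: powR_ge0.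
  rewrite -[ltRHS]invrK ltf_pV2 ?posrE ?powR_gt0 ?invr_gt0//.
  rewrite -[ltLHS](@powRrV a^-1) ?invrK ?invr_eq0 ?gt_eqF ?invr_ge0 ?(ltW e0)//.
  by apply: gt0_ltr_powR => //; rewrite nnegrE ?powR_ge0 ?(ltW x0).
- by move=> x tx; have [] := dF x (lt_trans t0 tx).
- by apply: cvg_at_right_filter; apply: cvgN; exact: cF.
- move=> x; rewrite in_itv/= andbT => tx; rewrite derive1E.
  by apply: derive_val; apply: dF; exact: lt_trans tx.
Qed.

(** The Gamma integral with values in the extended reals: it can be manipulated before it is known
    to be finite, and [GammaE] identifies it with [Gamma] afterwards. *)
Definition egam a := \int[leb]_(t in pos) (t `^ (a - 1) * expR (- t))%:E.

Lemma measurable_gamma_fun a :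
  measurable_fun setT (fun t : R => t `^ (a - 1) * expR (- t))%R.
Proof.
apply: measurable_funM; first exact: measurable_powR.
exact: measurableT_comp.
Qed.

Lemma measurable_itv_pos : measurable (pos : set R).
Proof. exact: measurable_itv. Qed.

Lemma measurable_ltr_pair (f : R * R -> \bar R) :
  measurable_fun setT f ->
  measurable_fun setT (fun u => f u * (\1_[set v : R * R | (v.1 < v.2)%R] u)%:E).
Proof.
move=> mf; apply: emeasurable_funM => //; apply/measurable_EFinP.
apply: measurable_indic.
have := @measurable_fun_ltr _ _ R setT _ _ (@measurable_fst _ _ R R)
  (@measurable_snd _ _ R R).
by move=> /(_ measurableT [set true]); rewrite setTI; exact.
Qed.

Lemma integral_pos_gt s (f : R -> \bar R) : (0 <= s)%R ->
  \int[leb]_(t in pos) (f t * (\1_[set t | (s < t)%R] t)%:E) =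
  \int[leb]_(t in `]s, +oo[) f t.
Proof.
move=> s0; rewrite [LHS]integral_indicM [RHS]integral_indicM.
apply: eq_integral => t _; rewrite -muleA -EFinM.
congr (_ * (_)%:E); rewrite indic_bool !indicE.
have -> : (t \in pos) = (0 < t)%R.
  by apply/idP/idP => [/set_mem|h]; [|apply/mem_set]; rewrite /= in_itv/= andbT.
have -> : (t \in `]s, +oo[%classic) = (s < t)%R.
  by apply/idP/idP => [/set_mem|h]; [|apply/mem_set]; rewrite /= in_itv/= andbT.
case: (ltP s t) => st; last by rewrite mul0r.
by rewrite (le_lt_trans s0 st) mulr1.
Qed.

(** Integration by parts in Tonelli form: integrate [a s ^ (a - 1) e ^ (- t)] over [s < t].
    Integrating in [s] first gives [t ^ a e ^ (- t)], in [t] first [a s ^ (a - 1) e ^ (- s)]. *)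
Lemma egamS a : (0 < a)%R -> egam (a + 1) = a%:E * egam a.
Proof.
move=> a0.
pose f (s t : R) := (a * s `^ (a - 1) * expR (- t))%:E *
  (\1_[set v : R * R | (v.1 < v.2)%R] (s, t))%:E.
have mf : measurable_fun setT (fun u : R * R => f u.1 u.2).
  have := @measurable_ltr_pair
    (fun u => (a * u.1 `^ (a - 1) * expR (- u.2))%:E).
  rewrite /f; under [in X in _ -> X]eq_fun do rewrite -surjective_pairing.
  apply; apply/measurable_EFinP; apply: measurable_funM.
    apply: measurable_funM => //.
    exact: (measurableT_comp (measurable_powR (a - 1)) measurable_fst).
  by do 2 apply: measurableT_comp => //.
have f0 s t : 0 <= f s t.
  by rewrite mule_ge0// lee_fin// mulr_ge0 ?expR_ge0// mulr_ge0 ?powR_ge0// ltW.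
have := @tonelli_in _ _ _ _ R leb leb pos pos f measurable_itv_pos
   measurable_itv_pos mf f0.
transitivity (\int[leb]_(t in pos) \int[leb]_(s in pos) f s t).
  apply: eq_integral => t /set_mem; rewrite /= in_itv/= andbT => t0.
  rewrite /f; under [RHS]eq_integral.
    move=> s _; rewrite indic_bool /= -(@indic_bool _ _ (fun s => s < t)%R).
    rewrite -EFinM mulrAC EFinM; over.
  rewrite ge0_integralZr; [|exact: measurable_itv_pos| | |]; last 3 first.
  - apply/measurable_EFinP; apply: measurable_funTS; apply: measurable_funM.
      by apply: measurable_funM => //; exact: measurable_powR.
    apply: measurable_indic; exact: measurable_lt_set.
  - move=> s _; rewrite lee_fin; apply: mulr_ge0; last by rewrite indicE.
    by apply: mulr_ge0; [exact: ltW|exact: powR_ge0].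
  - by rewrite lee_fin expR_ge0.
  by rewrite (integral_lt_powR a0 t0) EFinM addrK.
rewrite -H /egam -ge0_integralZl; last 4 first.
- exact: measurable_itv_pos.
- by apply/measurable_EFinP; apply: measurable_funTS; exact: measurable_gamma_fun.
- by move=> x _; rewrite lee_fin mulr_ge0 ?powR_ge0 ?expR_ge0.
- by rewrite lee_fin ltW.
apply: eq_integral => s /set_mem; rewrite /= in_itv/= andbT => s0.
rewrite /f; under eq_integral.
  move=> t _; rewrite indic_bool /= -(@indic_bool _ _ (fun t => s < t)%R); over.
rewrite (integral_pos_gt _ (ltW s0)).
under eq_integral do rewrite EFinM.
rewrite ge0_integralZl; last 4 first.
- exact: measurable_itv.
- apply/measurable_EFinP; apply: measurable_funTS; exact: measurableT_comp.
- by move=> x _; rewrite lee_fin expR_ge0.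
- by rewrite lee_fin; apply: mulr_ge0; [exact: ltW|exact: powR_ge0].
by rewrite integral_gt_expR -!EFinM mulrA.
Qed.

Lemma egam_ge0 a : 0 <= egam a.
Proof.
by apply: integral_ge0 => t _; rewrite lee_fin mulr_ge0 ?powR_ge0 ?expR_ge0.
Qed.

Lemma integral_pos_expR : \int[leb]_(t in pos) (expR (- t))%:E = 1.
Proof. by rewrite integral_gt_expR oppr0 expR0. Qed.

Lemma integral_lt1_powR a : (0 < a)%R ->
  \int[leb]_(s in pos) (s `^ (a - 1) * \1_[set s | (s < 1)%R] s)%:E
  = (a^-1)%:E.
Proof.
move=> a0; have := integral_lt_powR a0 ltr01.
rewrite powR1 => /esym h; rewrite -[RHS]mule1 h -ge0_integralZl.
- by apply: eq_integral => s _; rewrite -EFinM !mulrA mulVf ?mul1r// gt_eqF.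
- exact: measurable_itv_pos.
- apply/measurable_EFinP/measurable_funTS; apply: measurable_funM.
    by apply: measurable_funM => //; exact: measurable_powR.
  apply: measurable_indic; exact: measurable_lt_set.
- move=> s _; rewrite lee_fin indicE; apply: mulr_ge0 => //.
  by apply: mulr_ge0; [exact: ltW|exact: powR_ge0].
- by rewrite lee_fin invr_ge0 ltW.
Qed.

Lemma measurable_powR_lt1 a :
  measurable_fun setT (fun s : R => (s `^ a * \1_[set s | s < 1] s)%R).
Proof.
apply: measurable_funM; first exact: measurable_powR.
apply: measurable_indic; exact: measurable_lt_set.
Qed.

(** [egamS] lowers [a] until it is at most 1, where the integrand is below [t ^ (a - 1)] on []0, 1[]
    and below [e ^ (- t)] from 1 on. *)
Lemma egam_lty a : (0 < a)%R -> egam a < +oo.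
Proof.
move=> a0; have [n an] : exists n, (a <= n.+1%:R)%R.
  by exists (Num.truncn a); rewrite ltW// truncnS_gt.
elim: n => [|n IHn] in a a0 an *; last first.
  have [a1|a1] := leP a 1%R.
    by apply: IHn => //; rewrite (le_trans a1)// ler1n.
  rewrite -(subrK 1%R a) egamS ?subr_gt0//.
  apply: lte_mul_pinfty; rewrite ?lee_fin ?subr_ge0 ?(ltW a1)//.
  apply: IHn; first by rewrite subr_gt0.
  by rewrite lerBlDr natr1.
apply: (@le_lt_trans _ _ (\int[leb]_(t in pos)
  ((t `^ (a - 1) * \1_[set s | (s < 1)%R] t)%:E + (expR (- t))%:E))).
  apply: ge0_le_integral.
  - exact: measurable_itv_pos.
  - by move=> t _; rewrite lee_fin mulr_ge0 ?powR_ge0 ?expR_ge0.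
  - by apply/measurable_EFinP/measurable_funTS; exact: measurable_gamma_fun.
  - apply/measurable_EFinP/measurable_funTS; apply: measurable_funD.
      exact: measurable_powR_lt1.
    exact: measurableT_comp.
  - move=> t; rewrite /= in_itv/= andbT => t0; rewrite -EFinD lee_fin indic_bool.
    have e1 : (expR (- t) <= 1)%R by rewrite expR_le1 oppr_le0 ltW.
    case: ltP => t1.
      rewrite mulr1 (le_trans (ler_piMr (powR_ge0 _ _) e1))// lerDl.
      exact: expR_ge0.
    rewrite mulr0 add0r ler_piMl ?expR_ge0//.
    by rewrite -[leRHS](powRr0 t) ler_powR// subr_le0.
rewrite ge0_integralD.
- by rewrite integral_lt1_powR// integral_pos_expR -EFinD ltry.
- exact: measurable_itv_pos.
- by move=> t _; rewrite lee_fin mulr_ge0 ?powR_ge0// indicE.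
- by apply/measurable_EFinP/measurable_funTS; exact: measurable_powR_lt1.
- by move=> t _; rewrite lee_fin expR_ge0.
- apply/measurable_EFinP/measurable_funTS.
  exact: measurableT_comp.
Qed.

(** On []0, 1[] the exponential is at least [e ^ (- 1)]. *)
Lemma egam_gt0 a : (0 < a)%R -> 0 < egam a.
Proof.
move=> a0; apply: (@lt_le_trans _ _ ((expR (- 1))%:E * (a^-1)%:E)).
  by rewrite lte_fin mulr_gt0 ?invr_gt0// expR_gt0.
rewrite -integral_lt1_powR// -ge0_integralZl.
- apply: ge0_le_integral.
  + exact: measurable_itv_pos.
  + move=> t _; rewrite lee_fin mulr_ge0 ?expR_ge0//.
    by rewrite mulr_ge0 ?powR_ge0// indicE.
  + apply/measurable_EFinP/measurable_funTS; apply: measurable_funM => //.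
    exact: measurable_powR_lt1.
  + by apply/measurable_EFinP/measurable_funTS; exact: measurable_gamma_fun.
  + move=> t; rewrite /= in_itv/= andbT => t0; rewrite lee_fin indic_bool.
    case: ltP => t1; last by rewrite !mulr0 mulr_ge0 ?powR_ge0 ?expR_ge0.
    by rewrite mulr1 mulrC ler_wpM2l ?powR_ge0// ler_expR lerN2 ltW.
- exact: measurable_itv_pos.
- by apply/measurable_EFinP/measurable_funTS; exact: measurable_powR_lt1.
- by move=> t _; rewrite lee_fin mulr_ge0 ?powR_ge0// indicE.
- by rewrite lee_fin expR_ge0.
Qed.

Lemma GammaE a : (0 < a)%R -> (Gamma a)%:E = egam a.
Proof.
move=> a0; rewrite /Gamma /Rintegral fineK// ge0_fin_numE ?egam_lty//.
exact: egam_ge0.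
Qed.

Lemma Gamma_gt0 a : (0 < a)%R -> (0 < Gamma a)%R.
Proof. by move=> a0; rewrite -lte_fin GammaE ?egam_gt0. Qed.

Lemma GammaS a : (0 < a)%R -> (Gamma (a + 1) = a * Gamma a)%R.
Proof.
move=> a0; apply: EFin_inj; rewrite EFinM !GammaE ?egamS//.
by rewrite addr_gt0.
Qed.

Lemma rising0 a : (0 < a)%R -> rising a 0 = 1%R.
Proof. by move=> a0; rewrite /rising addr0 divff// gt_eqF// Gamma_gt0. Qed.

Lemma risingS a n : (0 < a)%R -> (rising a n.+1 = (a + n%:R) * rising a n)%R.
Proof.
by move=> a0; rewrite /rising -natr1 addrA GammaS ?mulrA// ltr_wpDr.
Qed.

Lemma integral_gamma a l : (0 < a)%R -> (0 < l)%R ->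
  \int[leb]_(t in pos) (t `^ (a - 1) * expR (- (l * t)))%:E =
  (Gamma a * l `^ (- a))%:E.
Proof.
move=> a0 l0; have l00 : l != 0%R by rewrite gt_eqF.
rewrite EFinM GammaE// /egam.
rewrite [in RHS](substitution_scale l0); last 2 first.
- by apply/measurable_EFinP; exact: measurable_gamma_fun.
- by move=> t; rewrite lee_fin mulr_ge0 ?powR_ge0 ?expR_ge0.
rewrite muleC -ge0_integralZl.
- apply: eq_integral => t /set_mem; rewrite /= in_itv/= andbT => t0.
  rewrite -!EFinM; congr EFin.
  have el : (l `^ (- a) * l `^ (a - 1) * l = 1)%R.
    rewrite -[X in (_ * X)%R](powRr1 (ltW l0)) -!powRD ?l00 ?implybT//.
    by have -> : (- a + (a - 1) + 1 = 0)%R; [ring|rewrite powRr0].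
  rewrite (powRM _ (ltW l0) (ltW t0)) -[LHS]mul1r -[X in (X * _)%R = _]el; ring.
- exact: measurable_itv_pos.
- apply/measurable_EFinP/measurable_funTS; apply: measurable_funM => //.
  apply: (measurableT_comp (measurable_gamma_fun a) (g := fun x => l * x)%R).
  exact: measurable_funM.
- by move=> t _; rewrite lee_fin !mulr_ge0 ?powR_ge0 ?expR_ge0// ltW.
- by rewrite lee_fin powR_ge0.
Qed.

(** [integral_gamma] after the substitution [t = r ^ s]; it serves as the integral over the
    radius. *)
Lemma integral_gamma_powR s k (C : R) : (0 < s)%R -> (0 < k)%R -> (0 < C)%R ->
  \int[leb]_(r in pos) (r `^ (k * s - 1) * expR (- (C * r `^ s)))%:E =
  (Gamma k / s * C `^ (- k))%:E.
Proof.
move=> s0 k0 C0; have s00 : s != 0%R by rewrite gt_eqF.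
rewrite mulrAC EFinM -integral_gamma//.
rewrite [in RHS](substitution_powR s0); last 2 first.
- apply/measurable_EFinP; apply: measurable_funM; first exact: measurable_powR.
  by do 2 apply: measurableT_comp => //; exact: measurable_funM.
- by move=> t; rewrite lee_fin mulr_ge0 ?powR_ge0 ?expR_ge0.
rewrite muleC -ge0_integralZl.
- apply: eq_integral => t /set_mem; rewrite /= in_itv/= andbT => t0.
  have t00 : t != 0%R by rewrite gt_eqF.
  rewrite -!EFinM; congr EFin.
  have -> : (t `^ (k * s - 1) = (t `^ s) `^ (k - 1) * t `^ (s - 1))%R.
    rewrite -powRrM -powRD ?t00 ?implybT//; congr (_ `^ _)%R; ring.
  by field.
- exact: measurable_itv_pos.
- apply/measurable_EFinP/measurable_funTS; apply: measurable_funM.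
    apply: measurable_funM.
      by apply: measurable_powR_comp; exact: measurable_powR.
    by apply: measurable_expRN; apply: measurable_funM.
  by apply: measurable_funM => //; exact: measurable_powR.
- by move=> t _; rewrite lee_fin !mulr_ge0 ?powR_ge0 ?expR_ge0// ltW.
- by rewrite lee_fin invr_ge0 ltW.
Qed.

Lemma integral_lt_expR l s : (0 < l)%R -> (0 < s)%R ->
  \int[leb]_(t in pos) (l * expR (- (l * t)) * \1_[set t | (t < s)%R] t)%:E =
  (1 - expR (- (l * s)))%:E.
Proof.
move=> l0 s0.
have dF (x : R) : is_derive x (1%R : R) (fun t => - expR (- (l * t)))%R
    (l * expR (- (l * x)))%R.
  have h : is_derive x (1%R : R) (fun t : R => - (l * t))%R (- l)%R.
    have := is_deriveN (is_deriveZ l (@is_derive_id R R x 1%R)).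
    by rewrite /GRing.scale/= mulr1.
  have := is_deriveN (@is_derive1_comp _ expR (fun t : R => - (l * t))%R _ _ _
    (is_derive_expR (- (l * x))%R) h).
  by rewrite /= mulrN opprK mulrC.
have cE (x : R) : {for x, continuous (fun t : R => - expR (- (l * t)))%R}.
  apply: differentiable_continuous; apply/derivable1_diffP.
  by have [] := dF x.
have cF (x : R) : {for x, continuous (fun t : R => l * expR (- (l * t)))%R}.
  apply: cvgM; first exact: cvg_cst.
  have -> : (fun t : R => expR (- (l * t))) = (fun t => - - expR (- (l * t)))%R.
    by apply/funext => t; rewrite opprK.
  by rewrite -[X in _ --> X]opprK; exact: cvgN (cE x).
transitivity (\int[leb]_(t in `[0%R, s]) (l * expR (- (l * t)))%:E).
  rewrite -integral_itv_bndo_bndc; last first.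
    apply/measurable_EFinP/measurable_funTS.
    by apply: measurable_funM => //; apply: measurable_expRN; exact: measurable_funM.
  rewrite -integral_itv_obnd_cbnd; last first.
    apply/measurable_EFinP/measurable_funTS.
    by apply: measurable_funM => //; apply: measurable_expRN; exact: measurable_funM.
  rewrite [LHS]integral_indicM [RHS]integral_indicM.
  apply: eq_integral => t _; rewrite -!EFinM -(mulrA (l * expR (- (l * t)))%R).
  congr (_ * _)%:E.
  rewrite indic_bool !indicE.
  have -> : (t \in pos) = (0 < t)%R.
    by apply/idP/idP => [/set_mem|h]; [|apply/mem_set]; rewrite /= in_itv/= andbT.
  have -> : (t \in `]0%R, s[%classic) = (0 < t < s)%R.
    by apply/idP/idP => [/set_mem|h]; [|apply/mem_set]; rewrite /= in_itv/=.
  by case: (0 < t)%R => /=; rewrite ?mulr1 ?mulr0.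
rewrite (@continuous_FTC2 _ _ (fun t => - expR (- (l * t)))%R)//.
- by rewrite -EFinB mulr0 oppr0 expR0 opprK addrC.
- by apply: continuous_subspaceT => x; exact: cF.
- split.
  + by move=> x _; have [] := dF x.
  + by apply: cvg_at_right_filter; exact: cE.
  + by apply: cvg_at_left_filter; exact: cE.
- by move=> x _; rewrite derive1E; apply: derive_val.
Qed.

Lemma measurable_rho_stable (sigma : R) : measurable_fun setT (rho_stable sigma).
Proof.
by apply: measurable_funM => //; apply: measurable_funM => //.
Qed.

(** Write [1 - e ^ (- l s)] as the integral of [l e ^ (- l t)] over [t < s] and exchange. The inner
    integral is then the tail of [sigma s ^ (-1 - sigma)] beyond [t], that is [t ^ (- sigma)], and
    the remaining Gamma integral cancels the normalization of [rho_stable]. *)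
Lemma laplace_stable (sigma l : R) : (0 < sigma < 1)%R -> (0 <= l)%R ->
  \int[leb]_(s in pos) ((1 - expR (- (l * s))) * rho_stable sigma s)%:E =
  (l `^ sigma)%:E.
Proof.
move=> /andP[s0 s1]; rewrite le_eqVlt => /predU1P[<-|l0].
  rewrite powR0 ?gt_eqF//; apply: integral0_eq => s _.
  by rewrite mul0r oppr0 expR0 subrr mul0r.
have G0 : (0 < Gamma (1 - sigma))%R by rewrite Gamma_gt0// subr_gt0.
pose f (t s : R) := (sigma * s `^ (-1 - sigma) * (l * expR (- (l * t))))%:E *
  (\1_[set v : R * R | (v.1 < v.2)%R] (t, s))%:E.
have mf : measurable_fun setT (fun u : R * R => f u.1 u.2).
  have := @measurable_ltr_pair
    (fun u => (sigma * u.2 `^ (-1 - sigma) * (l * expR (- (l * u.1))))%:E).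
  rewrite /f; under [in X in _ -> X]eq_fun do rewrite -surjective_pairing.
  apply; apply/measurable_EFinP; apply: measurable_funM.
    by apply: measurable_funM => //; exact: measurable_powR_comp.
  apply: measurable_funM => //; apply: measurable_expRN.
  exact: measurable_funM.
have c0 s : (0 <= sigma * s `^ (-1 - sigma))%R.
  by apply: mulr_ge0; [exact: ltW|exact: powR_ge0].
have d0 t : (0 <= l * expR (- (l * t)))%R.
  by apply: mulr_ge0; [exact: ltW|exact: expR_ge0].
have f0 t s : 0 <= f t s.
  by apply: mule_ge0; rewrite lee_fin ?indicE//; exact: mulr_ge0.
have H1 : \int[leb]_(s in pos) \int[leb]_(t in pos) f t s =
   (Gamma (1 - sigma))%:E *
   \int[leb]_(s in pos) ((1 - expR (- (l * s))) * rho_stable sigma s)%:E.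
  rewrite -ge0_integralZl; last 4 first.
  - exact: measurable_itv_pos.
  - apply/measurable_EFinP/measurable_funTS; apply: measurable_funM.
      apply: measurable_funB => //; apply: measurable_expRN.
      exact: measurable_funM.
    exact: measurable_rho_stable.
  - move=> s; rewrite /= in_itv/= andbT => s00; rewrite lee_fin.
    apply: mulr_ge0; last by apply: mulr_ge0; [exact: c0|rewrite invr_ge0 ltW].
    by rewrite subr_ge0 expR_le1 oppr_le0 mulr_ge0 ?(ltW l0) ?(ltW s00).
  - by rewrite lee_fin ltW.
  apply: eq_integral => s /set_mem; rewrite /= in_itv/= andbT => s00.
  have fE t : f t s = (sigma * s `^ (-1 - sigma))%:E *
      (l * expR (- (l * t)) * \1_[set t | (t < s)%R] t)%:E.
    by rewrite /f !indic_bool /= -!EFinM !mulrA.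
  under eq_integral do rewrite fE.
  rewrite ge0_integralZl; last 4 first.
  - exact: measurable_itv_pos.
  - apply/measurable_EFinP/measurable_funTS; apply: measurable_funM.
      apply: measurable_funM => //; apply: measurable_expRN.
      exact: measurable_funM.
    by apply: measurable_indic; exact: measurable_lt_set.
  - by move=> t _; rewrite lee_fin indicE; exact: mulr_ge0.
  - by rewrite lee_fin.
  rewrite (integral_lt_expR l0 s00) -!EFinM; congr EFin.
  by rewrite /rho_stable; field; rewrite gt_eqF.
have H2 : \int[leb]_(t in pos) \int[leb]_(s in pos) f t s =
   (Gamma (1 - sigma))%:E * (l `^ sigma)%:E.
  transitivity (\int[leb]_(t in pos)
     (l%:E * (t `^ (1 - sigma - 1) * expR (- (l * t)))%:E)).
    apply: eq_integral => t /set_mem; rewrite /= in_itv/= andbT => t0.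
    have fE s : f t s = (l * expR (- (l * t)) * (sigma * s `^ (-1 - sigma)))%:E *
        (\1_[set s | (t < s)%R] s)%:E.
      by rewrite /f !indic_bool /= -!EFinM [X in (X * _)%:E]mulrC.
    under eq_integral do rewrite fE.
    rewrite (integral_pos_gt _ (ltW t0)).
    under eq_integral do rewrite EFinM.
    rewrite ge0_integralZl; last 4 first.
    - exact: measurable_itv.
    - by apply/measurable_EFinP/measurable_funTS; apply: measurable_funM.
    - by move=> s _; rewrite lee_fin.
    - by rewrite lee_fin.
    rewrite (integral_gt_powRN s0 t0) -!EFinM; congr EFin.
    by rewrite (_ : 1 - sigma - 1 = - sigma)%R; [ring|ring].
  rewrite ge0_integralZl; last 4 first.
  - exact: measurable_itv_pos.
  - apply/measurable_EFinP/measurable_funTS; apply: measurable_funM.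
      exact: measurable_powR.
    by apply: measurable_expRN; exact: measurable_funM.
  - by move=> t _; rewrite lee_fin mulr_ge0 ?powR_ge0 ?expR_ge0.
  - by rewrite lee_fin ltW.
  rewrite integral_gamma ?subr_gt0// -!EFinM; congr EFin.
  rewrite mulrCA; congr (_ * _)%R.
  rewrite -[X in (X * _)%R](powRr1 (ltW l0)) -powRD; last first.
    by rewrite (gt_eqF l0) implybT.
  by congr (_ `^ _)%R; ring.
have := @tonelli_in _ _ _ _ R leb leb pos pos f measurable_itv_pos
   measurable_itv_pos mf f0.
rewrite H1 H2 => /(congr1 (fun e : \bar R => ((Gamma (1 - sigma))^-1)%:E * e)).
by rewrite /= !muleA -!EFinM mulVf ?gt_eqF// !mul1r !mul1e => <-.
Qed.

Lemma rho_stable_ge0 (sigma s : R) : (0 < sigma < 1)%R -> (0 <= rho_stable sigma s)%R.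
Proof.
move=> /andP[s0 s1]; rewrite /rho_stable mulr_ge0 ?invr_ge0//.
  by rewrite mulr_ge0 ?powR_ge0// ltW.
by rewrite ltW// Gamma_gt0// subr_gt0.
Qed.

End gamma.

(** * Integration in polar-type coordinates *)

Section radial.
Context {R : realType}.
Local Notation leb := (@lebesgue_measure R).
Local Notation pos := `]0%R, +oo[%classic.

Lemma powR_expR (x a : R) : 0 < x -> x `^ a = expR (a * ln x).
Proof. by move=> x0; rewrite /powR gt_eqF. Qed.

Local Open Scope ereal_scope.

(** This is [y = w / (1 - w)], with inverse [y / (1 + y)] and derivative [(1 - w) ^ (- 2)]. Inverses
    are written with [powR] so that its derivative rule applies. *)
Lemma substitution_ratio (f : R -> \bar R) :
  measurable_fun setT f -> (forall x, 0 <= f x) ->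
  \int[leb]_(y in pos) f y =
  \int[leb]_(w in `]0%R, 1%R[)
    (f (w * (1 - w) `^ (- 1))%R * ((1 - w) `^ (- 2))%:E).
Proof.
move=> mf f0.
have V (w : R) : (w < 1)%R -> ((1 - w) `^ (- 1) = (1 - w)^-1)%R.
  by move=> w1; rewrite powR_inv1// subr_ge0 ltW.
have m1 (p : R) : measurable_fun setT (fun w : R => (1 - w) `^ p)%R.
  by apply: measurable_powR_comp; apply: measurable_funB.
have hd (p w : R) : (w < 1)%R -> is_derive w (1%R : R)
    (fun w : R => (1 - w) `^ p)%R (p * (1 - w) `^ (p - 1) * - 1)%R.
  move=> w1; have w10 : (0 < 1 - w)%R by rewrite subr_gt0.
  have h1 : is_derive w (1%R : R) (fun w : R => 1 - w)%R (- 1)%R.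
    have := is_deriveB (is_derive_cst (1%R : R) w 1%R) (@is_derive_id R R w 1%R).
    by rewrite sub0r.
  exact: (@is_derive1_comp _ (@powR R ^~ p) (fun w : R => 1 - w)%R _ _ _
    (is_derive1_powR p w10) h1).
apply: (@ge0_integral_substitution R `]0%R, 1%R[ (fun w => w * (1 - w) `^ (- 1))%R
  (fun w => (1 - w) `^ (- 2))%R (fun y => y / (1 + y))%R) => //.
- by apply: measurable_funM => //; exact: m1.
- by move=> w; exact: powR_ge0.
- move=> w; rewrite /= in_itv/= => /andP[w0 w1].
  apply: differentiable_continuous; apply/derivable1_diffP.
  by have [] := hd (- 2)%R _ w1.
- move=> w; rewrite /= in_itv/= => /andP[w0 w1].
  have w10 : (0 < 1 - w)%R by rewrite subr_gt0.
  have := is_deriveM (@is_derive_id R R w 1%R) (hd (-1)%R _ w1).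
  rewrite /GRing.scale/= => h3; apply: is_derive_eq h3 _.
  rewrite (_ : -1 - 1 = - 2)%R; last by ring.
  rewrite mulr1 mulrN1 mulN1r opprK.
  rewrite !(powR_expR _ w10).
  have -> : (-1 * ln (1 - w) = ln (1 - w) + - 2 * ln (1 - w))%R by ring.
  rewrite expRD lnK ?posrE//; ring.
- move=> w; rewrite /= in_itv/= => /andP[w0 w1].
  by rewrite mulr_gt0// powR_gt0// subr_gt0.
- move=> x y; rewrite /= !in_itv/= => /andP[x0 x1] /andP[y0 y1] xy.
  rewrite !V// ltr_pdivrMr ?subr_gt0// mulrAC ltr_pdivlMr ?subr_gt0//.
  by rewrite !mulrBr !mulr1 mulrC ltrD2r.
- move=> y y0; rewrite /= in_itv/= divr_gt0 ?addr_gt0//=.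
  by rewrite ltr_pdivrMr ?addr_gt0// mul1r ltrDr.
- move=> y y0; have y10 : (1 + y != 0)%R by rewrite gt_eqF// addr_gt0.
  rewrite V; last by rewrite ltr_pdivrMr ?addr_gt0// mul1r ltrDr.
  have -> : (1 - y / (1 + y) = (1 + y)^-1)%R by field.
  by rewrite invrK divfK.
Qed.

Variables (c z sigma a b e k : R).
Hypotheses (c0 : (0 < c)%R) (z0 : (0 < z < 1)%R) (s0 : (0 < sigma)%R) (k0 : (0 < k)%R).
Hypothesis abe : (a + b + e = k * sigma)%R.

(** Up to the factor [c], the joint Laplace exponent of the total masses of [mu_1 + mu_0] and
    [mu_2 + mu_0]. It is homogeneous of degree [sigma]. *)
Definition psi12 (u v : R) : R :=
  (z * u `^ sigma + z * v `^ sigma + (1 - z) * (u + v) `^ sigma)%R.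

Definition radial_fun (u v : R) : R :=
  (u `^ (a - 1) * v `^ (b - 1) * (u + v) `^ e * expR (- (c * psi12 u v)))%R.

Lemma psi12_gt0 u v : (0 < u)%R -> (0 < v)%R -> (0 < psi12 u v)%R.
Proof.
case/andP: z0 => z00 z1 u0 v0; rewrite /psi12 !addr_gt0// mulr_gt0 ?powR_gt0 ?subr_gt0//.
exact: addr_gt0.
Qed.

Lemma measurable_psi12 : measurable_fun setT (fun u : R * R => psi12 u.1 u.2).
Proof.
apply: measurable_funD; first apply: measurable_funD.
- by apply: measurable_funM => //; exact: measurable_powR_comp.
- by apply: measurable_funM => //; exact: measurable_powR_comp.
- apply: measurable_funM => //; apply: measurable_powR_comp.
  exact: measurable_funD.
Qed.

Lemma measurable_radial_fun :
  measurable_fun setT (fun u : R * R => radial_fun u.1 u.2).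
Proof.
apply: measurable_funM.
  apply: measurable_funM; last first.
    by apply: measurable_powR_comp; exact: measurable_funD.
  by apply: measurable_funM; exact: measurable_powR_comp.
apply: measurable_expRN; apply: measurable_funM => //.
exact: measurable_psi12.
Qed.

Lemma radial_fun_ge0 u v : (0 <= radial_fun u v)%R.
Proof. by rewrite /radial_fun !mulr_ge0 ?powR_ge0 ?expR_ge0. Qed.

(** Substitute [u = v s]. By homogeneity of [psi12] and by [abe] the integrand becomes a function of
    [s] times [v ^ (k sigma - 1) exp (- c psi12 s 1 v ^ sigma)], so the integral over [v] is
    [integral_gamma_powR]. The substitution [s = w / (1 - w)] then brings [s] back to the unit
    interval. *)
Lemma integral_radial :
  \int[leb]_(u in pos) \int[leb]_(v in pos) (radial_fun u v)%:E =
  (Gamma k / sigma * c `^ (- k))%:E *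
  \int[leb]_(w in `]0%R, 1%R[) (w `^ (a - 1) * (1 - w) `^ (b - 1) *
     (psi12 w (1 - w)) `^ (- k))%:E.
Proof.
have mpos : measurable (pos : set (measurableTypeR R)) by exact: measurable_itv.
rewrite tonelli_in//; last 2 first.
- by apply/measurable_EFinP; exact: measurable_radial_fun.
- by move=> u v; rewrite lee_fin radial_fun_ge0.
transitivity (\int[leb]_(v in pos) \int[leb]_(s in pos) (radial_fun (v * s) v * v)%:E).
  apply: eq_integral => v /set_mem; rewrite /= in_itv/= andbT => v0.
  rewrite (substitution_scale v0)//.
  - apply/measurable_EFinP.
    exact: (measurableT_comp measurable_radial_fun (pair2_measurable v)).
  - by move=> u; rewrite lee_fin radial_fun_ge0.
have mrv : measurable_fun setT (fun u : R * R => radial_fun (u.1 * u.2) u.1).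
  apply: (measurableT_comp measurable_radial_fun (g := fun u : R * R => (u.1 * u.2, u.1)%R)).
  by apply/measurable_fun_pair => //=; exact: measurable_funM.
(* [tonelli_in] wants an integrand that is nonnegative on the whole plane, while the factor [v] is
   so only on the half line; the absolute value repairs this. *)
transitivity (\int[leb]_(v in pos) \int[leb]_(s in pos) (`|radial_fun (v * s) v * v|)%:E).
  apply: eq_integral => v /set_mem; rewrite /= in_itv/= andbT => v0.
  apply: eq_integral => s _.
  rewrite ger0_norm; first by [].
  by apply: mulr_ge0; [exact: radial_fun_ge0|exact: ltW].
rewrite tonelli_in//; last 1 first.
  apply/measurable_EFinP; apply: measurableT_comp => //.
  exact: measurable_funM.
pose K (s : R) := psi12 s 1.
have K0 s : (0 < s)%R -> (0 < K s)%R by move=> s00; exact: psi12_gt0.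
have mK : measurable_fun setT K.
  exact: (measurableT_comp measurable_psi12 (pair2_measurable (1%R : R))).
pose g (s : R) := (s `^ (a - 1) * (1 + s) `^ e * K s `^ (- k))%R.
have mg : measurable_fun setT g.
  apply: measurable_funM; last exact: measurable_powR_comp.
  apply: measurable_funM => //; apply: measurable_powR_comp.
  exact: measurable_funD.
have g0 s : (0 <= g s)%R by rewrite !mulr_ge0 ?powR_ge0.
transitivity (\int[leb]_(s in pos) ((Gamma k / sigma * c `^ (- k))%:E * (g s)%:E)).
  apply: eq_integral => s /set_mem; rewrite /= in_itv/= andbT => s00.
  have s10 : (0 < 1 + s)%R by rewrite addr_gt0.
  transitivity (\int[leb]_(v in pos) ((s `^ (a - 1) * (1 + s) `^ e)%:E *
     (v `^ (k * sigma - 1) * expR (- (c * K s * v `^ sigma)))%:E)).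
    apply: eq_integral => v /set_mem; rewrite /= in_itv/= andbT => v0.
    rewrite ger0_norm; last by rewrite mulr_ge0 ?radial_fun_ge0// ltW.
    rewrite -EFinM; congr EFin; rewrite /radial_fun /K /psi12.
    have -> : (v * s + v = v * (1 + s))%R by ring.
    rewrite !powRM ?(ltW v0) ?(ltW s00) ?(ltW s10)// powR1.
    rewrite (addrC s 1%R) -abe.
    have -> : (v `^ (a + b + e - 1) = v `^ (a - 1) * v `^ (b - 1) * v `^ e * v)%R.
      rewrite -[X in (_ * X)%R](powRr1 (ltW v0)) -!powRD ?(gt_eqF v0) ?implybT//.
      by congr (_ `^ _)%R; ring.
    have -> : (c * (z * s `^ sigma + z * 1 + (1 - z) * (1 + s) `^ sigma) * v `^ sigma
      = c * (z * (v `^ sigma * s `^ sigma) + z * v `^ sigma + (1 - z) *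
           (v `^ sigma * (1 + s) `^ sigma)))%R by ring.
    by ring.
  rewrite ge0_integralZl; last 4 first.
  - exact: mpos.
  - apply/measurable_EFinP/measurable_funTS; apply: measurable_funM.
      exact: measurable_powR.
    by apply: measurable_expRN; apply: measurable_funM.
  - by move=> v _; rewrite lee_fin mulr_ge0 ?powR_ge0 ?expR_ge0.
  - by rewrite lee_fin mulr_ge0 ?powR_ge0.
  rewrite integral_gamma_powR//; last by rewrite mulr_gt0 ?K0.
  rewrite powRM ?(ltW c0) ?(ltW (K0 _ s00))// -!EFinM; congr EFin.
  by rewrite /g; ring.
rewrite ge0_integralZl; last 4 first.
- exact: mpos.
- by apply/measurable_EFinP/measurable_funTS.
- by move=> s _; rewrite lee_fin.
- rewrite lee_fin !mulr_ge0 ?powR_ge0 ?invr_ge0 ?(ltW s0)//.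
  by rewrite ltW// Gamma_gt0.
apply: (congr1 (mule _)).
rewrite substitution_ratio; last 2 first.
- exact/measurable_EFinP.
- by move=> s; rewrite lee_fin.
apply: eq_integral => w /set_mem; rewrite /= in_itv/= => /andP[w0 w1].
have w10 : (0 < 1 - w)%R by rewrite subr_gt0.
rewrite -EFinM; congr EFin; rewrite /g.
rewrite (powR_inv1 (ltW w10)).
have -> : (1 + w / (1 - w) = (1 - w)^-1)%R.
  by field; rewrite gt_eqF.
have -> : (K (w / (1 - w)) = psi12 w (1 - w) * (1 - w)^-1 `^ sigma)%R.
  rewrite /K /psi12 (_ : w / (1 - w) + 1 = (1 - w)^-1)%R; last first.
    by field; rewrite gt_eqF.
  rewrite powRM ?(ltW w0) ?invr_ge0 ?(ltW w10)// powR1.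
  rewrite (_ : w + (1 - w) = 1)%R ?powR1; last by ring.
  have -> : ((1 - w)^-1 `^ sigma = ((1 - w) `^ sigma)^-1)%R.
    by rewrite -powR_inv1 ?(ltW w10)// -powRrM mulN1r powRN.
  by field; rewrite powR_eq0 gt_eqF.
have V p : ((1 - w)^-1 `^ p = (1 - w) `^ (- p))%R.
  by rewrite -powR_inv1 ?(ltW w10)// -powRrM mulN1r.
rewrite !powRM ?powR_ge0 ?(ltW w0) ?invr_ge0 ?(ltW w10) ?(ltW (psi12_gt0 _ _))//.
rewrite !V -powRrM.
(* The four powers come from [s], from [1 + s = (1 - w)^-1], from [K] and from the Jacobian; [abe]
   makes their exponents add up to [b - 1]. *)
have -> : ((1 - w) `^ (b - 1) = (1 - w) `^ (- (a - 1)) * (1 - w) `^ (- e) *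
    (1 - w) `^ (- sigma * - k) * (1 - w) `^ (- 2))%R.
  rewrite -!powRD ?(gt_eqF w10) ?implybT//; congr (_ `^ _)%R.
  rewrite (_ : - sigma * - k = k * sigma)%R; last by ring.
  by rewrite -abe; ring.
by ring.
Qed.

End radial.

(** * Laplace transforms of Poisson and stable random measures *)

Lemma measurable_fin_prod d (T : measurableType d) (R : realType) (I : finType)
    (Q : pred I) (f : I -> T -> R) :
  (forall i, measurable_fun setT (f i)) ->
  measurable_fun setT (fun x => \prod_(i | Q i) f i x).
Proof.
move=> mf; under eq_fun do rewrite big_mkcond/=.
apply: (@measurable_prod _ _ _ _ I (index_enum I)
  (fun i x => if Q i then f i x else 1)) => i _.
by case: (Q i).
Qed.

Section layer_cake.
Context d (T : measurableType d) (R : realType).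
Variable mu : {sigma_finite_measure set T -> \bar R}.
Local Notation leb := (@lebesgue_measure R).
Local Notation pos := `]0%R, +oo[%classic.
Local Open Scope ereal_scope.

(** [F w] is the integral over [t > 0] of the indicator of [t < F w]. The formula carries identities
    known for events over to nonnegative functions. *)
Lemma layer_cake (F : T -> R) (W : T -> \bar R) :
  measurable_fun setT F -> measurable_fun setT W ->
  (forall w, (0 <= F w)%R) -> (forall w, 0 <= W w) ->
  \int[mu]_w (W w * (F w)%:E) =
  \int[leb]_(t in pos) \int[mu]_w (W w * (\1_[set w | (t < F w)%R] w)%:E).
Proof.
move=> mF mW F0 W0.
pose f (w : T) (t : R) := W w * (\1_[set u : T * R | (u.2 < F u.1)%R] (w, t))%:E.
have mlt : measurable [set u : T * R | (u.2 < F u.1)%R].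
  have := @measurable_fun_ltr _ _ R setT _ _ (@measurable_snd _ _ T R)
    (measurableT_comp mF (@measurable_fst _ _ T R)).
  by move=> /(_ measurableT [set true]); rewrite setTI; exact.
have mf : measurable_fun setT (fun u : T * R => f u.1 u.2).
  rewrite /f; under eq_fun do rewrite -surjective_pairing.
  apply: emeasurable_funM.
    exact: (measurableT_comp mW measurable_fst).
  by apply/measurable_EFinP; exact: measurable_indic.
have f0 w t : 0 <= f w t by rewrite mule_ge0// lee_fin indicE.
have := @tonelli_in _ _ _ _ R mu leb setT pos f measurableT _ mf f0.
move=> /(_ (measurable_itv _)) H.
transitivity (\int[mu]_w \int[leb]_(t in pos) f w t); last first.
  rewrite H; apply: eq_integral => t _; apply: eq_integral => w _.
  by rewrite /f !indic_bool.
apply: eq_integral => w _; rewrite /f.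
under eq_integral.
  move=> t _; rewrite indic_bool /= -(@indic_bool _ _ (fun t => t < F w)%R); over.
have mI : measurable [set t : R | (t < F w)%R].
  have -> : [set t : R | (t < F w)%R] = `]-oo, F w[%classic.
    by apply/seteqP; split => s /=; rewrite in_itv.
  exact: measurable_itv.
rewrite ge0_integralZl; last 4 first.
- exact: measurable_itv.
- by apply/measurable_EFinP/measurable_funTS; exact: measurable_indic.
- by move=> t _; rewrite lee_fin indicE.
- exact: W0.
rewrite integral_indic; last 2 first.
- exact: measurable_itv.
- exact: mI.
have -> : [set t | (t < F w)%R] `&` pos = `]0%R, F w[%classic.
  by apply/seteqP; split => s /=; rewrite !in_itv/= andbT;
    [case=> -> ->|case/andP=> -> ->].
apply: (congr1 (mule _)); rewrite [RHS]lebesgue_measure_itv/= lte_fin.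
have := F0 w; rewrite le_eqVlt => /predU1P[<-|->]; first by rewrite ltxx.
by rewrite oppr0 adde0.
Qed.

End layer_cake.

Section independence_product.
Context d (Omega : measurableType d) (R : realType) (P : probability Omega R).
Local Notation leb := (@lebesgue_measure R).
Local Notation pos := `]0%R, +oo[%classic.
Local Open Scope ereal_scope.
Variables (I : finType) (Fam : I -> set (set Omega)).
Hypothesis ind : independent P Fam.
Hypothesis mFam : forall i A, Fam i A -> measurable A.
Hypothesis FamT : forall i, Fam i setT.
Variable f : I -> Omega -> R.
Hypothesis f0 : forall i w, (0 <= f i w)%R.
Hypothesis mf : forall i, measurable_fun setT (f i).
Hypothesis Famf : forall i t, Fam i [set w | (t < f i w)%R].

(** [independent] is the product rule for indicators. Indicators are replaced by the functions [f i]
    one index at a time, each replacement being an application of [layer_cake]. *)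
Lemma integral_prod_independent :
  \int[P]_w (\prod_i f i w)%:E = \prod_i \int[P]_w (f i w)%:E.
Proof.
(* The mixed product carries [f i] for the indices in [s] and an indicator for the others, so that
   an induction on [s] goes from the independence of events to the claim. *)
pose h (s : seq I) (A : I -> set Omega) i : Omega -> R :=
  if i \in s then f i else \1_(A i).
suff H s A : (forall i, Fam i (A i)) ->
    \int[P]_w (\prod_i h s A i w)%:E = \prod_i \int[P]_w (h s A i w)%:E.
  have := H (enum I) (fun=> setT) FamT; rewrite /h.
  under eq_integral do under eq_bigr do rewrite mem_enum.
  by move=> ->; apply: eq_bigr => i _; rewrite mem_enum.
have h0 s' A' i w : (0 <= h s' A' i w)%R by rewrite /h; case: ifP.
elim: s A => [|j s IH] A FA.
  have -> : \int[P]_w (\prod_i h [::] A i w)%:E = P (\bigcap_(i in [set: I]) A i).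
    rewrite -[in RHS](setIT (\bigcap_(i in _) _)) -integral_indic//; last first.
      apply: fin_bigcap_measurable => [|i _]; last exact: mFam (FA i).
      exact: finite_finset.
    apply: eq_integral => w _; congr EFin.
    rewrite /h /= indicE; have [wA|wA] := boolP (w \in _).
      rewrite big1// => i _; rewrite indicE mem_set//.
      by move/set_mem: wA; exact.
    apply/eqP; rewrite prodf_seq_eq0 /=.
    have : exists i, ~ A i w.
      apply/existsNP => wAi; move: wA; apply/negP; rewrite negbK.
      by apply/mem_set => i _.
    case=> i wAi; apply/hasP; exists i => //=.
      by rewrite mem_index_enum.
    by rewrite indicE memNset.
  rewrite ind//; apply: eq_bigr => i _.
  by rewrite /h /= integral_indic ?setIT//; exact: mFam (FA i).
have [js|js] := boolP (j \in s).
  have hE : h (j :: s) = h s.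
    apply/funext => B; apply/funext => i; rewrite /h inE.
    by case: eqP => [->|//]; rewrite js.
  by rewrite hE; exact: IH.
have mh s' A' i : (forall i, Fam i (A' i)) -> measurable_fun setT (h s' A' i).
  by move=> FA'; rewrite /h; case: ifP => _ //; apply: measurable_indic; exact: mFam (FA' i).
(* Putting a superlevel set of [f j] in place of [A j] stays within the family by [Famf], and [j] is
   still outside [s]: the induction hypothesis applies for each fixed [t]. *)
pose A' t i := if i == j then [set w | (t < f j w)%R] else A i.
have FA' t i : Fam i (A' t i) by rewrite /A'; case: eqP => [->|].
have hjs i : i != j -> h (j :: s) A i = h s A i.
  by move=> ij; rewrite /h inE (negbTE ij).
have hA' t i : i != j -> h s (A' t) i = h s A i.
  by move=> ij; rewrite /h /A' (negbTE ij).
have hj : h (j :: s) A j = f j by rewrite /h inE eqxx.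
have hA'j t : h s (A' t) j = \1_[set w | (t < f j w)%R].
  by rewrite /h (negbTE js) /A' eqxx.
have mprod s' B : (forall i, Fam i (B i)) ->
    measurable_fun setT (fun w => (\prod_(i | i != j) h s' B i w)%:E).
  move=> FB; apply/measurable_EFinP.
  by apply: measurable_fin_prod => i; exact: mh.
rewrite [RHS](bigD1 j)//= hj.
under [in RHS]eq_bigr => i ij do rewrite hjs//.
have -> : \int[P]_w (\prod_i h (j :: s) A i w)%:E =
    \int[P]_w ((\prod_(i | i != j) h s A i w)%:E * (f j w)%:E).
  apply: eq_integral => w _; rewrite (bigD1 j)//= hj mulrC EFinM.
  by congr (_%:E * _); apply: eq_bigr => i ij; rewrite hjs.
rewrite layer_cake//; last 2 first.
- exact: mprod.
- by move=> w; rewrite lee_fin prodr_ge0.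
have step t : \int[P]_w ((\prod_(i | i != j) h s A i w)%:E *
      (\1_[set w | (t < f j w)%R] w)%:E) =
    \prod_(i | i != j) \int[P]_w (h s A i w)%:E *
      \int[P]_w (1 * (\1_[set w | (t < f j w)%R] w)%:E).
  have := IH (A' t) (FA' t); rewrite [RHS in _ = RHS -> _](bigD1 j)//= hA'j.
  under [X in _ = _ * X -> _]eq_bigr => i ij do rewrite hA'//.
  rewrite muleC; under [X in _ = _ * X -> _]eq_integral do rewrite -[X in X%:E]mul1r EFinM.
  move=> <-; apply: eq_integral => w _; rewrite [in RHS](bigD1 j)//= hA'j EFinM muleC.
  by congr (_ * _%:E); apply: eq_bigr => i ij; rewrite hA'.
under eq_integral do rewrite step.
rewrite ge0_integralZl; last 4 first.
- exact: measurable_itv.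
- apply: measurable_funTS.
  apply: (@measurable_integral_snd _ _ (measurableTypeR R) Omega R P setT
    (fun t w => 1 * (\1_[set w | (t < f j w)%R] w)%:E)) => //.
    apply: emeasurable_funM => //; apply/measurable_EFinP.
    rewrite (_ : (fun _ => _) = \1_[set u : R * Omega | (u.1 < f j u.2)%R]); last first.
      by apply/funext => u; rewrite !indic_bool.
    apply: measurable_indic.
    have := @measurable_fun_ltr _ _ R setT _ _ (@measurable_fst _ _ R Omega)
      (measurableT_comp (mf j) (@measurable_snd _ _ R Omega)).
    by move=> /(_ measurableT [set true]); rewrite setTI; exact.
- move=> t _; apply: integral_ge0 => w _; rewrite mule_ge0// lee_fin indicE//.
- apply: prode_ge0 => i _; apply: integral_ge0 => w _.
  by rewrite lee_fin.
rewrite -(@layer_cake _ _ _ P (f j) (cst 1))//.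
rewrite muleC; congr (_ * _).
by apply: eq_integral => w _; rewrite mul1e.
Qed.

End independence_product.

Section lap.
Context {R : realType}.
Local Open Scope ereal_scope.

(* [lap x] is [exp (- x)] with [exp (- oo) = 0]; it is only meant for
   nonnegative [x]. *)
Definition lap (x : \bar R) : R := (expR (- fine x) * \1_(~` [set +oo%E]) x)%R.

Lemma lap_EFin (r : R) : lap r%:E = expR (- r).
Proof. by rewrite /lap indicE mem_set ?mulr1. Qed.

Lemma lapy : lap +oo = 0%R.
Proof. by rewrite /lap indicE memNset ?mulr0//=; exact. Qed.

Lemma lap0 : lap 0 = 1%R.
Proof. by rewrite lap_EFin oppr0 expR0. Qed.

Lemma lap_ge0 x : (0 <= lap x)%R.
Proof. by rewrite /lap mulr_ge0 ?expR_ge0// indicE. Qed.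

Lemma lap_le1 x : 0 <= x -> (lap x <= 1)%R.
Proof.
case: x => [r r0| |//]; last by rewrite lapy.
by rewrite lap_EFin expR_le1 oppr_le0.
Qed.

Lemma lapD x y : 0 <= x -> 0 <= y -> lap (x + y) = (lap x * lap y)%R.
Proof.
case: x y => [x| |] [y| |]//= x0 y0; rewrite ?lapy ?mulr0 ?mul0r//.
by rewrite -EFinD !lap_EFin opprD expRD.
Qed.

Lemma lap_sum (I : finType) (x : I -> \bar R) : (forall i, 0 <= x i) ->
  lap (\sum_i x i) = (\prod_i lap (x i))%R.
Proof.
move=> x0.
have [] : lap (\sum_i x i) = (\prod_i lap (x i))%R /\ 0 <= \sum_i x i.
  elim/big_ind2 : _ => //; first by rewrite lap0.
  by move=> x1 x2 y1 y2 [h1 h2] [h3 h4]; rewrite lapD// h1 h3 adde_ge0.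
by [].
Qed.

Lemma measurable_lap : measurable_fun setT lap.
Proof.
apply: measurable_funM.
  by do 2 apply: measurableT_comp => //; exact: fine_measurable.
by apply: measurable_indic; apply: measurableC; exact: emeasurable_set1.
Qed.

Lemma measurable_lap_comp d (T : measurableType d) (f : T -> \bar R) :
  measurable_fun setT f -> measurable_fun setT (fun w => lap (f w)).
Proof. by move=> mf; exact: (measurableT_comp measurable_lap mf). Qed.

Lemma cvg_lap (u : (\bar R)^nat) x : (forall n, 0 <= u n) -> 0 <= x ->
  u n @[n --> \oo] --> x -> lap (u n) @[n --> \oo] --> lap x.
Proof.
move=> u0; case: x => [x|_|//].
  move=> x0 /fine_cvgP[fu cu]; rewrite lap_EFin.
  have : expR (- fine (u n)) @[n --> \oo] --> expR (- x).
    have h : (- fine (u n))%R @[n --> \oo] --> (- x)%R by exact: cvgN.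
    exact: (cvg_comp _ _ h (@continuous_expR _ (- x)%R)).
  apply: cvg_trans; apply: near_eq_cvg; near=> n.
  have /fineK <- : u n \is a fin_num by near: n.
  by rewrite lap_EFin fineK//; near: n.
move/cvgeyPge => cu; rewrite lapy; apply/cvgrPdist_le => e e0.
have := cu (- ln e)%R; apply: filterS => n en.
rewrite sub0r normrN ger0_norm ?lap_ge0//.
case: (u n) en => [r| |//]; last by rewrite lapy (ltW e0).
by rewrite lee_fin lap_EFin => h; rewrite -[leRHS]lnK ?posrE// ler_expR lerNl.
Unshelve. all: by end_near. Qed.

Lemma eseries_expR (x r : R) :
  \sum_(k <oo) (x ^+ k / k`!%:R * r)%:E = (expR x * r)%:E.
Proof.
apply/cvg_lim => //.
have h : (fun n => series (exp_coeff x) n * r)%R @ \oo --> (expR x * r)%R.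
  by apply: cvgMr_tmp; exact: is_cvg_series_exp_coeff.
have -> : (fun n => \sum_(0 <= k < n) (x ^+ k / k`!%:R * r)%:E) =
    EFin \o (fun n => series (exp_coeff x) n * r)%R.
  apply/funext => n /=; rewrite sumEFin; congr EFin.
  by rewrite /series /= mulr_suml.
by apply: cvg_EFin; [exact: nearW|exact: h].
Qed.

End lap.

Section poisson.
Context d (Omega : measurableType d) (R : realType) (P : probability Omega R).
Local Open Scope ereal_scope.

(** On the events where [M] is a natural number the expectation is the exponential series; the rest
    of the space must be shown to be null. *)
Lemma laplace_poisson (M : Omega -> \bar R) (r a : R) :
  measurable_fun setT M ->
  (forall k : nat, P [set w | M w = k%:R%:E] = (poisson_mass r k)%:E) ->
  \int[P]_w (lap (a%:E * M w))%:E = (expR (- ((1 - expR (- a)) * r)))%:E.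
Proof.
move=> mM HM.
pose F (k : nat) := [set w | M w = k%:R%:E].
have mF k : measurable (F k).
  rewrite (_ : F k = M @^-1` [set k%:R%:E])//.
  by rewrite -[X in measurable X]setTI; apply: mM => //; exact: emeasurable_set1.
have tF : trivIset setT F.
  apply/trivIsetP => i j _ _ ij; rewrite -subset0 => w [] /=.
  by rewrite /F /= => -> [] /eqP; rewrite eqr_nat (negbTE ij).
have mU : measurable (\bigcup_k F k) by exact: bigcupT_measurable.
have mlap b : measurable_fun setT (fun w => (lap (b%:E * M w))%:E).
  apply/measurable_EFinP; apply: measurable_lap_comp.
  exact: measurable_funeM.
have key (b : R) : \int[P]_(w in \bigcup_k F k) (lap (b%:E * M w))%:E =
    (expR (- ((1 - expR (- b)) * r)))%:E.
  rewrite ge0_integral_bigcup//; last 2 first.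
  - exact: measurable_funTS.
  - by move=> w _; rewrite lee_fin lap_ge0.
  transitivity (\sum_(k <oo) (((r * expR (- b)) ^+ k / k`!%:R) * expR (- r))%:E).
    apply: eq_eseriesr => k _.
    transitivity (\int[P]_(w in F k) (expR (- b) ^+ k)%:E).
      apply: eq_integral => w /set_mem; rewrite /F /= => ->.
      by rewrite -EFinM lap_EFin -mulNr mulrC expRM_natl.
    rewrite integral_cst//= HM -EFinM /poisson_mass exprMn; congr EFin; ring.
  rewrite eseries_expR -expRD; congr (expR _)%:E; ring.
(* At exponent 0 the series computed in [key] says that the Poisson masses add up to 1. *)
have PU : P (~` \bigcup_k F k) = 0.
  rewrite probability_setC//; have := key 0%R.
  under eq_integral do rewrite mul0e lap0.
  by rewrite integral_cst// mul1e oppr0 expR0 subrr mul0r oppr0 expR0 => ->; rewrite subee.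
rewrite -(key a) [LHS](@ge0_negligible_integral _ _ _ P setT (~` \bigcup_k F k))//.
- by rewrite setDE setTI setCK.
- exact: measurableC.
- by move=> w _; rewrite lee_fin lap_ge0.
Qed.

(** The independence of counts over disjoint sets is stated for families indexed by ordinals, hence
    the enumeration of [T]. *)
Lemma laplace_poisson_family (T : finType) d' (E : measurableType d')
  (N : R.-ker Omega ~> E) (nu : set E -> \bar R) (A : T -> set E) (a : T -> R) :
  poisson_random_measure P N nu ->
  (forall t, measurable (A t)) -> trivIset setT A ->
  (forall t, 0 <= nu (A t) < +oo) -> (forall t, (0 <= a t)%R) ->
  \int[P]_w (\prod_t lap ((a t)%:E * N w (A t)))%:E =
  (expR (- \sum_t (1 - expR (- a t)) * fine (nu (A t))))%:E.
Proof.
move=> [HP _ HI] mA tA nuA a0.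
pose A' (i : 'I_#|T|) := A (enum_val i).
have tA' : trivIset setT A'.
  apply/trivIsetP => i j _ _ ij; move/trivIsetP : tA => /(_ (enum_val i) (enum_val j) I I).
  by apply; apply: contra ij => /eqP/enum_val_inj ->.
have mN t : measurable_fun setT (fun w => N w (A t)) by exact: measurable_kernel.
have ind := HI _ A' (fun i => mA _) tA'.
have := @integral_prod_independent _ _ _ P _ _ ind _ _
  (fun i w => lap ((a (enum_val i))%:E * N w (A' i))).
have reidx (F : T -> \bar R) : \prod_t F t = \prod_(i < #|T|) F (enum_val i).
  rewrite (reindex (fun i : 'I_#|T| => enum_val i))//=.
  exists enum_rank => t _; [exact: enum_valK|exact: enum_rankK].
have reidxR (F : T -> R) : (\prod_t F t = \prod_(i < #|T|) F (enum_val i))%R.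
  rewrite (reindex (fun i : 'I_#|T| => enum_val i))//=.
  exists enum_rank => t _; [exact: enum_valK|exact: enum_rankK].
move=> H; under eq_integral do rewrite reidxR.
rewrite H.
- rewrite -(reidx (fun t => \int[P]_w (lap ((a t)%:E * N w (A t)))%:E)).
  rewrite -sumrN expR_sum -prodEFin; apply: eq_bigr => t _.
  apply: laplace_poisson => // k; apply: HP => //.
  by case/andP: (nuA t).
- move=> i B [C mC <-]; rewrite setTI -[X in measurable X]setTI.
  exact: mN.
- by move=> i; exists setT => //; rewrite setTI preimage_setT.
- by move=> i w; exact: lap_ge0.
- by move=> i; apply: measurable_lap_comp; apply: measurable_funeM; exact: mN.
- move=> i t; rewrite /rv_events /=.
  exists [set x | (t < lap ((a (enum_val i))%:E * x))%R]; last by rewrite setTI.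
  have mlap : measurable_fun setT (fun x => lap ((a (enum_val i))%:E * x)).
    apply: measurable_lap_comp; exact: measurable_funeM.
  rewrite -[X in measurable X]setTI.
  exact: (measurable_fun_ltr (measurable_cst t) mlap measurableT (Y := [set true])).
Qed.

End poisson.

Section discretization.
Context {R : realType}.
Local Notation leb := (@lebesgue_measure R).
Local Notation pos := `]0%R, +oo[%classic.
Import HBNNSimple.
Variable g : {nnsfun R >-> R}.
Hypothesis gle : forall s, 0 < s -> g s <= s.
Local Notation S := (fset_set (range g)).
Local Notation p := #|`S|.

Definition lvl (i : 'I_p) : R := S`_i.
(** The level of value 0 is replaced by the empty set: it reaches down to 0, where the jump
    intensity may be infinite, and it adds nothing to the integral of [g]. On any other level [s]
    stays above a positive bound. *)
Definition lvlset (i : 'I_p) : set R :=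
  if lvl i == 0 then set0 else pos `&` g @^-1` [set lvl i].

Lemma lvl_ge0 i : 0 <= lvl i.
Proof.
have : lvl i \in S by exact: mem_nth.
by rewrite in_fset_set// => /set_mem[x _ <-]; exact: fun_ge0.
Qed.

Lemma measurable_lvlset i : measurable (lvlset i).
Proof.
rewrite /lvlset; case: eqP => // _.
by apply: measurableI => //; exact: measurable_itv.
Qed.

Lemma lvlset_disj i j : i != j -> lvlset i `&` lvlset j = set0.
Proof.
move=> ij; rewrite -subset0 /lvlset => s [].
case: eqP => // _ [_ /= gi]; case: eqP => // _ [_ /= gj].
move: ij; apply/negP; rewrite negbK; apply/eqP/val_inj => /=.
apply/eqP; rewrite -(@nth_uniq _ 0 S) ?fset_uniq//.
by rewrite -/(lvl i) -/(lvl j) -gi gj.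
Qed.

(** [phi 0 = 0] compensates for the discarded level of value 0. *)
Lemma lvl_sum (phi : R -> R) s : phi 0 = 0 -> 0 < s ->
  phi (g s) = \sum_i phi (lvl i) * \1_(lvlset i) s.
Proof.
move=> phi0 s0.
have gS : g s \in S by rewrite in_fset_set//; apply/mem_set; exists s.
have ip : (index (g s) S < p)%N by rewrite index_mem.
have lE : lvl (Ordinal ip) = g s by rewrite /lvl nth_index.
rewrite (bigD1 (Ordinal ip))//= big1 ?addr0; last first.
  move=> i ij; rewrite /lvlset; case: eqP => [->|_]; first by rewrite phi0 mul0r.
  rewrite indicE memNset ?mulr0// => -[_ /= gi].
  move/negP: ij; apply; apply/eqP/val_inj => /=.
  by rewrite -[RHS]/(index (g s) S) gi /lvl index_uniq// fset_uniq.
rewrite lE /lvlset lE; case: eqP => [->|_]; first by rewrite phi0 mul0r.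
rewrite indicE mem_set ?mulr1//; split => //=.
by rewrite in_itv/= s0.
Qed.

Lemma lvlset_pos i s : lvlset i s -> 0 < s.
Proof.
by rewrite /lvlset; case: eqP => // _ [] /=; rewrite in_itv/= andbT.
Qed.

Lemma lvlset_ge i s : lvlset i s -> 0 < lvl i <= s.
Proof.
move=> Bs; have s0 := lvlset_pos Bs; move: Bs; rewrite /lvlset.
have := lvl_ge0 i; rewrite le_eqVlt eq_sym; case: eqP => //= _ l0 [_ /= gs].
by rewrite l0 -gs gle.
Qed.

Local Open Scope ereal_scope.

Lemma integral_lvl d (T : measurableType d) (m : {measure set (R * T) -> \bar R})
    (A : set T) : measurable A ->
  \int[m]_(u in pos `*` A) (g u.1)%:E = \sum_i (lvl i)%:E * m (lvlset i `*` A).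
Proof.
move=> mA.
have mpA : measurable ((pos : set R) `*` A).
  by apply: measurableX => //; exact: measurable_itv.
have mB i : measurable_fun setT (fun u : R * T => \1_(lvlset i) u.1 : R).
  exact: (measurableT_comp (measurable_indic (measurable_lvlset i)) measurable_fst).
transitivity (\int[m]_(u in pos `*` A) \sum_i (lvl i * \1_(lvlset i) u.1)%:E).
  apply: eq_integral => u /set_mem [/=]; rewrite in_itv/= andbT => u0 _.
  by rewrite sumEFin -(@lvl_sum id).
rewrite ge0_integral_sum//; last 2 first.
- move=> i; apply/measurable_EFinP/measurable_funTS.
  exact: measurable_funM.
- by move=> i u _; rewrite lee_fin mulr_ge0 ?lvl_ge0// indicE.
apply: eq_bigr => i _.
under eq_integral do rewrite EFinM.
rewrite ge0_integralZl; last 4 first.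
- exact: mpA.
- by apply/measurable_EFinP/measurable_funTS.
- by move=> u _; rewrite lee_fin indicE.
- by rewrite lee_fin lvl_ge0.
apply: (congr1 (mule _)).
transitivity (\int[m]_(u in pos `*` A) (\1_(lvlset i `*` setT) u)%:E).
  apply: eq_integral => -[u t] _; congr EFin; rewrite !indicE /=.
  by rewrite in_setX in_setT andbT.
rewrite integral_indic//; last first.
  by apply: measurableX => //; exact: measurable_lvlset.
congr (m _); rewrite -setXI setTI; congr (_ `*` _).
apply/seteqP; split => s; first by case.
move=> Bs; split => //.
by rewrite /= in_itv/= andbT; exact: lvlset_pos Bs.
Qed.

Variables (rho : R -> R).
Hypotheses (rho0 : forall s, (0 <= rho s)%R) (mrho : measurable_fun setT rho).
Hypothesis rho_tail : forall e, (0 < e)%R ->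
  \int[leb]_(s in `[e, +oo[) (rho s)%:E < +oo.
Context d (Theta : measurableType d) (P0 : probability Theta R) (a : R).
Hypothesis a0 : (0 <= a)%R.

Let nu := levy_intensity a rho P0.

Lemma levy_intensity_lvl i (A : set Theta) : measurable A ->
  nu (lvlset i `*` A) =
  (a%:E * P0 A) * \int[leb]_(s in pos) (rho s * \1_(lvlset i) s)%:E.
Proof.
move=> mA; rewrite /nu /levy_intensity -ge0_integralZl; last 4 first.
- exact: measurable_itv.
- apply/measurable_EFinP/measurable_funTS; apply: measurable_funM => //.
  by apply: measurable_indic; exact: measurable_lvlset.
- by move=> s _; rewrite lee_fin mulr_ge0// indicE.
- by rewrite mule_ge0// lee_fin.
apply: eq_integral => s _; rewrite indicE.
have [sB|sB] := boolP (s \in lvlset i).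
  by rewrite in_xsectionX// mulr1 EFinM muleAC.
by rewrite notin_xsectionX// measure0 mule0 mulr0 mule0.
Qed.

(** A nonempty level set lies in [[lvl i, +oo[] with [lvl i > 0], where [rho] has finite
    integral. *)
Lemma levy_intensity_lvl_lty i (A : set Theta) : measurable A ->
  0 <= nu (lvlset i `*` A) < +oo.
Proof.
move=> mA; have mlvl := measurable_lvlset i.
have i0 : 0 <= \int[leb]_(s in pos) (rho s * \1_(lvlset i) s)%:E.
  by apply: integral_ge0 => s _; rewrite lee_fin mulr_ge0// indicE.
rewrite levy_intensity_lvl// mule_ge0//=; last by rewrite mule_ge0// lee_fin.
apply: lte_mul_pinfty.
- by rewrite mule_ge0// lee_fin.
- by rewrite fin_numM// fin_num_measure.
have [l0|l0] := eqVneq (lvl i) 0%R.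
  rewrite /lvlset l0 eqxx; under eq_integral do rewrite indic0 mulr0.
  by rewrite integral0.
have {}l0 : (0 < lvl i)%R by rewrite lt_neqAle eq_sym l0 lvl_ge0.
apply: le_lt_trans (rho_tail l0).
rewrite integral_indicM [leRHS]integral_indicM.
apply: ge0_le_integral => //.
- by move=> s _; rewrite -EFinM lee_fin !mulr_ge0// indicE.
- apply/measurable_EFinP; apply: measurable_funM.
    by apply: measurable_funM => //; exact: measurable_indic.
  by apply: measurable_indic; exact: measurable_itv.
- by apply/measurable_EFinP; apply: measurable_funM => //.
- move=> s _; rewrite -!EFinM lee_fin -mulrA ler_wpM2l// !indicE.
  have [/set_mem sB|] := boolP (s \in lvlset i); last by rewrite mul0r.
  rewrite mul1r; apply: (@le_trans _ _ 1%R); first by case: (s \in pos).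
  rewrite le_eqVlt; apply/orP; left; apply/eqP/esym; rewrite mem_set//.
  by have /andP[_] := lvlset_ge sB; rewrite /= in_itv/= andbT.
Qed.

Lemma levy_intensity_lvl_sum (A : set Theta) (l : R) : measurable A -> (0 <= l)%R ->
  (\sum_i (1 - expR (- (l * lvl i))) * fine (nu (lvlset i `*` A)))%:E =
  (a%:E * P0 A) * \int[leb]_(s in pos) ((1 - expR (- (l * g s))) * rho s)%:E.
Proof.
move=> mA l0.
have e0 (r : R) : (0 <= r)%R -> (0 <= 1 - expR (- (l * r)))%R.
  by move=> r0; rewrite subr_ge0 expR_le1 oppr_le0 mulr_ge0.
have mlvl i : measurable_fun setT (\1_(lvlset i) : R -> R).
  by apply: measurable_indic; exact: measurable_lvlset.
transitivity (\sum_i (1 - expR (- (l * lvl i)))%:E * nu (lvlset i `*` A)).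
  rewrite -sumEFin; apply: eq_bigr => i _; rewrite EFinM fineK//.
  by case/andP: (levy_intensity_lvl_lty i mA) => h1 h2; rewrite ge0_fin_numE.
transitivity (\sum_i ((a%:E * P0 A) * \int[leb]_(s in pos)
    ((1 - expR (- (l * lvl i))) * \1_(lvlset i) s * rho s)%:E)).
  apply: eq_bigr => i _; rewrite levy_intensity_lvl// muleCA.
  apply: (congr1 (mule _)); rewrite -ge0_integralZl; last 4 first.
  - exact: measurable_itv.
  - apply/measurable_EFinP/measurable_funTS.
    by apply: measurable_funM; [exact: mrho|exact: mlvl].
  - by move=> s _; rewrite lee_fin mulr_ge0// indicE.
  - by rewrite lee_fin e0// lvl_ge0.
  by apply: eq_integral => s _; rewrite -EFinM -mulrA [(rho s * _)%R]mulrC.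
rewrite -ge0_sume_distrr; last first.
  move=> i _; apply: integral_ge0 => s _; rewrite lee_fin.
  by rewrite !mulr_ge0 ?indicE// e0// lvl_ge0.
apply: (congr1 (mule _)).
rewrite -ge0_integral_sum//.
- apply: eq_integral => s /set_mem; rewrite /= in_itv/= andbT => s0.
  rewrite sumEFin -mulr_suml; congr (_ * _)%:E.
  rewrite (@lvl_sum (fun r => 1 - expR (- (l * r)))%R)//.
  by rewrite mulr0 oppr0 expR0 subrr.
- move=> i; apply/measurable_EFinP/measurable_funTS.
  apply: measurable_funM; last exact: mrho.
  by apply: measurable_funM; last exact: mlvl.
- by move=> i s _; rewrite lee_fin !mulr_ge0 ?indicE// e0// lvl_ge0.
Qed.

End discretization.

Section cvg_bigop.
Context {R : realType} (T : Type).
Implicit Types (s : seq T) (Q : pred T) (u : T -> R^nat) (v : T -> R).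

Lemma cvgn_prod s Q u v : (forall t, u t n @[n --> \oo] --> v t) ->
  (\prod_(t <- s | Q t) u t n) @[n --> \oo] --> \prod_(t <- s | Q t) v t.
Proof.
move=> uv; elim: s => [|t s IH].
  by rewrite big_nil; under eq_fun do rewrite big_nil; exact: cvg_cst.
rewrite big_cons; under eq_fun do rewrite big_cons.
by case: (Q t) => //; apply: cvgM.
Qed.

Lemma cvgn_sum s Q u v : (forall t, u t n @[n --> \oo] --> v t) ->
  (\sum_(t <- s | Q t) u t n) @[n --> \oo] --> \sum_(t <- s | Q t) v t.
Proof.
move=> uv; elim: s => [|t s IH].
  by rewrite big_nil; under eq_fun do rewrite big_nil; exact: cvg_cst.
rewrite big_cons; under eq_fun do rewrite big_cons.
by case: (Q t) => //; apply: cvgD.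
Qed.

End cvg_bigop.

Section laplace_crm.
Import HBNNSimple.
Context {R : realType}.
Local Notation leb := (@lebesgue_measure R).
Local Notation pos := `]0%R, +oo[%classic.
Context d (Omega : measurableType d) (P : probability Omega R).
Context d' (Theta : measurableType d') (P0 : probability Theta R).
Variables (sigma a : R).
Hypotheses (sigma01 : 0 < sigma < 1) (a0 : 0 <= a).
Variable N : R.-ker Omega ~> (R * Theta)%type.
Local Notation rho := (rho_stable sigma).
Hypothesis prmN : poisson_random_measure P N (levy_intensity a rho P0).
Local Open Scope ereal_scope.

Lemma rho_stable_tail e : (0 < e)%R -> \int[leb]_(s in `[e, +oo[) (rho s)%:E < +oo.
Proof.
move=> e0; case/andP: (sigma01) => s0 s1.
rewrite -integral_itv_obnd_cbnd; last first.
  by apply/measurable_EFinP/measurable_funTS; exact: measurable_rho_stable.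
have -> : \int[leb]_(s in `]e, +oo[) (rho s)%:E = \int[leb]_(s in `]e, +oo[)
    (((Gamma (1 - sigma))^-1)%:E * (sigma * s `^ (-1 - sigma))%:E).
  by apply: eq_integral => s _; rewrite -EFinM mulrC.
rewrite ge0_integralZl; last 4 first.
- exact: measurable_itv.
- apply/measurable_EFinP/measurable_funTS; apply: measurable_funM => //.
- by move=> s _; rewrite lee_fin mulr_ge0 ?powR_ge0// ltW.
- by rewrite lee_fin invr_ge0 ltW// Gamma_gt0// subr_gt0.
by rewrite integral_gt_powRN// -EFinM ltry.
Qed.

Lemma measurable_crm B : measurable B ->
  measurable_fun setT (fun w => crm N w B).
Proof.
move=> mB; rewrite /crm.
have mpB : measurable ((pos : set R) `*` B).
  by apply: measurableX => //; exact: measurable_itv.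
have mi : measurable_fun setT (\1_((pos : set R) `*` B) : R * Theta -> R).
  exact: measurable_indic.
(* The absolute value makes the integrand nonnegative everywhere, as the measurability of integrals
   against a kernel requires; on the positive jumps nothing changes. *)
rewrite (_ : (fun _ => _) = (fun w => \int[N w]_u (`|u.1|%:E * (\1_((pos : set R) `*` B) u)%:E))).
  apply: measurable_fun_integral_kernel.
  - by move=> U mU; exact: measurable_kernel.
  - by move=> u; rewrite mule_ge0// lee_fin indicE.
  - apply: emeasurable_funM; apply/measurable_EFinP => //.
    exact: measurableT_comp.
apply/funext => w; rewrite -integral_indicM.
apply: eq_integral => u /set_mem[/=]; rewrite in_itv/= andbT => u0 _.
by rewrite ger0_norm// ltW.
Qed.

Lemma crm_ge0 w B : 0 <= crm N w B.
Proof.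
apply: integral_ge0 => u [/=]; rewrite in_itv/= andbT => u0 _.
by rewrite lee_fin ltW.
Qed.

(** With the jump size [s] replaced by a simple function below it, the random measure of [A t] is a
    finite combination of Poisson counts over disjoint sets of finite intensity, and
    [laplace_poisson_family] applies. The simple functions increase to [s]: the left side converges
    by domination by 1, and the exponents converge monotonically to the integral in
    [laplace_stable]. *)
Lemma laplace_crm (T : finType) (A : T -> set Theta) (l : T -> R) :
  (forall t, measurable (A t)) -> trivIset setT A -> (forall t, (0 <= l t)%R) ->
  \int[P]_w (\prod_t lap ((l t)%:E * crm N w (A t)))%:E =
  (expR (- \sum_t a * fine (P0 (A t)) * l t `^ sigma))%:E.
Proof.
move=> mA tA l0.
have mpos : measurable (pos : set R) by exact: measurable_itv.
have mid : measurable_fun (pos : set R) (@EFin R).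
  exact: measurable_funTS.
pose G : {nnsfun R >-> R}^nat := nnsfun_approx mpos mid.
have pos0 (s : R) : (0 < s)%R -> (pos : set R) s.
  by rewrite /= in_itv/= andbT.
have cG (s : R) : (0 < s)%R -> (G n s)%:E @[n --> \oo] --> s%:E.
  move=> s0; apply: cvg_nnsfun_approx; last exact: pos0.
  by move=> x /=; rewrite in_itv/= andbT lee_fin => /ltW.
have ndG (s : R) m n : (m <= n)%N -> (G m s <= G n s)%R.
  by move=> mn; exact/lefP/nd_nnsfun_approx.
have leG n (s : R) : (0 < s)%R -> (G n s <= s)%R.
  move=> s0; rewrite -lee_fin; apply: (cvge_ge _ (cG _ s0)).
  by exists n => // m /= nm; rewrite lee_fin ndG.
pose crmn n w t := \int[N w]_(u in (pos : set R) `*` A t) (G n u.1)%:E.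
have mpA t : measurable ((pos : set R) `*` A t) by exact: measurableX.
have mG1 n : measurable_fun setT (fun u : R * Theta => G n u.1).
  by apply: (@measurableT_comp _ _ _ _ _ _ (G n)).
have crmn0 n w t : 0 <= crmn n w t.
  by apply: integral_ge0 => u _; rewrite lee_fin.
have crmn_cvg w t : crmn n w t @[n --> \oo] --> crm N w (A t).
  have -> : crm N w (A t) =
      \int[N w]_(u in (pos : set R) `*` A t) limn (fun n => (G n u.1)%:E).
    apply: eq_integral => u /set_mem[/=]; rewrite in_itv/= andbT => u0 _.
    by apply/esym/cvg_lim => //; exact: cG.
  apply: cvg_monotone_convergence => //.
  - by move=> n; apply/measurable_EFinP/measurable_funTS; exact: mG1.
  - by move=> n u _; rewrite lee_fin.
  - by move=> u _ m n mn; rewrite lee_fin; exact: ndG.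
pose In n t := \int[leb]_(s in pos) ((1 - expR (- (l t * G n s))) * rho s)%:E.
have rho0 s : (0 <= rho s)%R by exact: rho_stable_ge0.
have mrho : measurable_fun setT rho by exact: measurable_rho_stable.
have le0 t r : (0 <= r)%R -> (0 <= 1 - expR (- (l t * r)))%R.
  by move=> r0; rewrite subr_ge0 expR_le1 oppr_le0 mulr_ge0.
have mIn n t : measurable_fun setT
    (fun s : R => (1 - expR (- (l t * G n s))) * rho s)%R.
  apply: measurable_funM => //; apply: measurable_funB => //.
  by apply: measurable_expRN; apply: measurable_funM.
have In_cvg t : In n t @[n --> \oo] --> (l t `^ sigma)%:E.
  rewrite -(laplace_stable sigma01 (l0 t)).
  have -> : \int[leb]_(s in pos) ((1 - expR (- (l t * s))) * rho s)%:E =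
      \int[leb]_(s in pos) limn (fun n => ((1 - expR (- (l t * G n s))) * rho s)%:E).
    apply: eq_integral => s /set_mem; rewrite /= in_itv/= andbT => s0.
    apply/esym/cvg_lim => //; rewrite EFinM.
    under eq_fun do rewrite EFinM.
    apply: cvgeZr => //; apply: cvg_EFin; first exact: nearW.
    apply: cvgB; first exact: cvg_cst.
    have h : (- (l t * G n s))%R @[n --> \oo] --> (- (l t * s))%R.
      apply: cvgN; apply: cvgMl_tmp.
      by have /fine_cvgP[] := cG _ s0.
    exact: (cvg_comp _ _ h (@continuous_expR _ _)).
  apply: cvg_monotone_convergence => //.
  - by move=> n; apply/measurable_EFinP/measurable_funTS; exact: mIn.
  - by move=> n s _; rewrite lee_fin mulr_ge0// le0.
  - move=> s _ m n mn; rewrite lee_fin ler_wpM2r// lerB// ler_expR lerN2.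
    by rewrite ler_wpM2l// ndG.
have In_ge0 n t : 0 <= In n t.
  by apply: integral_ge0 => s _; rewrite lee_fin mulr_ge0// le0.
have In_fin n t : In n t \is a fin_num.
  rewrite ge0_fin_numE//; apply: (@le_lt_trans _ _ (l t `^ sigma)%:E); last exact: ltry.
  rewrite -(laplace_stable sigma01 (l0 t)); apply: ge0_le_integral => //.
  - by move=> s _; rewrite lee_fin mulr_ge0// le0.
  - by apply/measurable_EFinP/measurable_funTS; exact: mIn.
  - apply/measurable_EFinP/measurable_funTS; apply: measurable_funM => //.
    apply: measurable_funB => //; apply: measurable_expRN.
    exact: measurable_funM.
  - move=> s; rewrite /= in_itv/= andbT => s0; rewrite lee_fin ler_wpM2r//.
    by rewrite lerB// ler_expR lerN2 ler_wpM2l// leG.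
have step n : \int[P]_w (\prod_t lap ((l t)%:E * crmn n w t))%:E =
    (expR (- \sum_t a * fine (P0 (A t)) * fine (In n t)))%:E.
  (* One set per cell and per level: disjoint for two cells because the [A t] are, and for two
     levels because the level sets are. *)
  pose E (u : T * 'I_#|`fset_set (range (G n))|) : set (R * Theta) :=
    lvlset (g := G n) u.2 `*` A u.1.
  have mE u : measurable (E u).
    by apply: measurableX => //; exact: measurable_lvlset.
  have tE : trivIset setT E.
    apply/trivIsetP => -[t i] [t' i'] _ _ ne; rewrite /E /= -setXI.
    have [tt'|tt'] := eqVneq t t'.
      have ii' : i != i' by apply: contra ne => /eqP ->; rewrite tt'.
      by rewrite lvlset_disj// set0X.
    by move/trivIsetP : tA => /(_ _ _ I I tt') ->; rewrite setX0.
  have tail e : (0 < e)%R -> \int[leb]_(s in `[e, +oo[) (rho s)%:E < +oo.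
    exact: rho_stable_tail.
  have fE u := levy_intensity_lvl_lty (leG n) rho0 mrho tail P0 a0 u.2 (mA u.1).
  have := @laplace_poisson_family _ _ _ P _ _ _ N _ E
    (fun u => l u.1 * lvl (g := G n) u.2)%R prmN mE tE fE.
  move=> /(_ (fun u => mulr_ge0 (l0 _) (lvl_ge0 _))) H.
  transitivity (\int[P]_w (\prod_u lap ((l u.1 * lvl u.2)%:E * N w (E u)))%:E).
    apply: eq_integral => w _; congr EFin.
    rewrite -(pair_bigA _ (fun t i => lap ((l t * lvl i)%:E * N w (E (t, i)))))/=.
    apply: eq_bigr => t _; rewrite /crmn integral_lvl//.
    rewrite ge0_sume_distrr; last by move=> i _; rewrite mule_ge0// lee_fin lvl_ge0.
    rewrite lap_sum; last by move=> i; rewrite !mule_ge0// lee_fin ?lvl_ge0.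
    by apply: eq_bigr => i _; rewrite muleA EFinM.
  rewrite H; congr (expR (- _))%:E.
  rewrite -(pair_bigA _ (fun t i => (1 - expR (- (l t * lvl i))) *
    fine (levy_intensity a rho P0 (E (t, i))))%R)/=.
  apply: eq_bigr => t _; apply: EFin_inj.
  rewrite (levy_intensity_lvl_sum (leG n) rho0 mrho tail P0 a0 (mA t) (l0 t)).
  rewrite -/(In n t) !EFinM !fineK//.
  by rewrite fin_num_measure.
have mcrm t : measurable_fun setT (fun w => crm N w (A t)) by exact: measurable_crm.
have mcrmn n t : measurable_fun setT (fun w => crmn n w t).
  rewrite /crmn; under eq_fun do rewrite integral_indicM.
  apply: measurable_fun_integral_kernel.
  - by move=> U mU; exact: measurable_kernel.
  - by move=> u; rewrite mule_ge0// lee_fin ?indicE.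
  - apply: emeasurable_funM; apply/measurable_EFinP; first exact: mG1.
    exact: measurable_indic.
have mlapn n t : measurable_fun setT (fun w => lap ((l t)%:E * crmn n w t)).
  by apply: measurable_lap_comp; exact: measurable_funeM.
have prod01 (x : T -> \bar R) : (forall t, 0 <= x t) ->
    (0 <= \prod_t lap ((l t)%:E * x t) <= 1)%R.
  move=> x0; rewrite prodr_ge0/=; last by move=> t _; exact: lap_ge0.
  apply: (@le_trans _ _ (\prod_(t : T) 1)%R); last by rewrite big1.
  apply: ler_prod => t _; rewrite lap_ge0/= lap_le1//.
  by rewrite mule_ge0// lee_fin.
have c1 : \int[P]_w (\prod_t lap ((l t)%:E * crmn n w t))%:E @[n --> \oo] -->
    \int[P]_w (\prod_t lap ((l t)%:E * crm N w (A t)))%:E.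
  apply: (@dominated_cvg _ _ _ P setT _ _ _ (cst 1)) => //.
  - by move=> n; apply/measurable_EFinP; exact: measurable_fin_prod.
  - move=> w _; apply: cvg_EFin; first exact: nearW.
    apply: cvgn_prod => t; apply: cvg_lap.
    + by move=> n; rewrite mule_ge0// lee_fin.
    + by rewrite mule_ge0// ?lee_fin// crm_ge0.
    + by apply: cvgeZl => //; exact: crmn_cvg.
  - by apply: finite_measure_integrable_cst.
  - move=> n w _; have /andP[h1 h2] := prod01 (crmn n w) (crmn0 n w).
    by rewrite /= ger0_norm// lee_fin.
rewrite -(cvg_lim _ c1)//; apply/cvg_lim => //.
under eq_fun do rewrite step.
apply: cvg_EFin; first exact: nearW.
have h : (- \sum_t a * fine (P0 (A t)) * fine (In n t))%R @[n --> \oo] -->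
    (- \sum_t a * fine (P0 (A t)) * l t `^ sigma)%R.
  apply: cvgN; apply: cvgn_sum => t; apply: cvgMl_tmp.
  by have /fine_cvgP[] := In_cvg t.
exact: (cvg_comp _ _ h (@continuous_expR _ _)).
Qed.

End laplace_crm.

(** * Moments from Laplace transforms *)

Section coefficients.
Context {R : realType}.
Variable sigma : R.
Hypothesis sigma01 : 0 < sigma < 1.

(* Coefficients of [(-1)^n (d/dx)^n exp (- q x^sigma)
   = exp (- q x^sigma) \sum_j momcoef n j q^j x^(j sigma - n)]. *)
Fixpoint momcoef (n j : nat) : R :=
  match n with
  | 0 => (j == 0)%:R
  | m.+1 => (if j is i.+1 then sigma * momcoef m i else 0) +
            (m%:R - j%:R * sigma) * momcoef m j
  end.

Lemma momcoef_gt n j : (n < j)%N -> momcoef n j = 0.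
Proof.
elim: n j => [|n IH] [|j] //= nj.
by rewrite !IH ?mulr0 ?addr0// ltnW.
Qed.

(** The factor [n - j sigma] of the recursion can be negative only for [j > n], where the
    coefficient vanishes. *)
Lemma momcoef_ge0 n j : 0 <= momcoef n j.
Proof.
case/andP: sigma01 => s0 s1.
elim: n j => [|n IH] j; first by rewrite /= ler0n.
have H : 0 <= (n%:R - j%:R * sigma) * momcoef n j.
  have [nj|jn] := ltnP n j; first by rewrite momcoef_gt// mulr0.
  rewrite mulr_ge0// subr_ge0 (@le_trans _ _ (j%:R : R)) ?ler_nat//.
  by rewrite ler_piMr// ltW.
by case: j H => [|j] H /=; apply: addr_ge0 => //; rewrite mulr_ge0 ?(ltW s0).
Qed.

Lemma momcoefS0 n : momcoef n.+1 0 = 0.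
Proof.
elim: n => [|n IH]; first by rewrite /= mul0r subr0 mul0r addr0.
rewrite -[LHS]/(0 + (n.+1%:R - 0%:R * sigma) * momcoef n.+1 0).
by rewrite IH mulr0 addr0.
Qed.

(** The constant coefficient vanishes, so the recursion at [j = 1] just multiplies by
    [n + 1 - sigma], the next factor of the rising factorial. This linear coefficient is what a
    cluster contributes in the limit. *)
Lemma momcoefS1 n : momcoef n.+1 1 = sigma * rising (1 - sigma) n.
Proof.
case/andP: sigma01 => s0 s1; have s10 : 0 < 1 - sigma by rewrite subr_gt0.
elim: n => [|n IH]; first by rewrite rising0//= mulr1 mulr0 addr0.
rewrite risingS// -[LHS]/(sigma * momcoef n.+1 0 + (n.+1%:R - 1%:R * sigma) * momcoef n.+1 1).
by rewrite momcoefS0 mulr0 add0r IH -natr1 mul1r; ring.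
Qed.

Definition mompoly (n : nat) (q x : R) : R :=
  \sum_(j < n.+1) momcoef n j * q ^+ j * x `^ (j%:R * sigma - n%:R).

Definition mom (n : nat) (q x : R) : R := expR (- (q * x `^ sigma)) * mompoly n q x.

Lemma mom0 q x : 0 < x -> mom 0 q x = expR (- (q * x `^ sigma)).
Proof.
by move=> x0; rewrite /mom /mompoly big_ord1 /= mul0r subr0 powRr0 !mulr1.
Qed.

(** The product rule behind [is_derive_mom]: the first term is the derivative of the exponential,
    the sum that of the powers of [x]. *)
Lemma mompolyS n q x : 0 < x -> mompoly n.+1 q x =
  q * sigma * x `^ (sigma - 1) * mompoly n q x -
  \sum_(j < n.+1) momcoef n j * q ^+ j *
     ((j%:R * sigma - n%:R) * x `^ (j%:R * sigma - n%:R - 1)).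
Proof.
move=> x0; rewrite /mompoly.
have -> : \sum_(j < n.+2) momcoef n.+1 j * q ^+ j * x `^ (j%:R * sigma - n.+1%:R) =
   \sum_(j < n.+2) (if (j : nat) is i.+1 then sigma * momcoef n i else 0) * q ^+ j *
       x `^ (j%:R * sigma - n.+1%:R) +
   \sum_(j < n.+2) (n%:R - j%:R * sigma) * momcoef n j * q ^+ j *
       x `^ (j%:R * sigma - n.+1%:R).
  by rewrite -big_split/=; apply: eq_bigr => j _; rewrite -!mulrDl.
congr (_ + _).
  rewrite big_ord_recl/= !mul0r add0r mulr_sumr; apply: eq_bigr => j _.
  rewrite /bump /= add1n.
  have -> : x `^ (j.+1%:R * sigma - n.+1%:R) =
      x `^ (sigma - 1) * x `^ (j%:R * sigma - n%:R).
    rewrite -powRD ?(gt_eqF x0) ?implybT//; congr (_ `^ _).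
    by rewrite -!natr1; ring.
  by rewrite exprS; ring.
rewrite big_ord_recr/= momcoef_gt// mulr0 !mul0r addr0 -sumrN.
apply: eq_bigr => j _; rewrite -natr1 opprD addrA; ring.
Qed.

Lemma is_derive_mom n q (x : R) : 0 < x ->
  is_derive x (1 : R) (mom n q) (- mom n.+1 q x).
Proof.
move=> x0.
have d1 : is_derive x (1 : R) (fun y : R => expR (- (q * y `^ sigma)))
    (- (q * (sigma * x `^ (sigma - 1))) * expR (- (q * x `^ sigma))).
  have h : is_derive x (1 : R) (fun y : R => - (q * y `^ sigma))
      (- (q * (sigma * x `^ (sigma - 1)))).
    exact: (is_deriveN (is_deriveZ q (is_derive1_powR sigma x0))).
  have := @is_derive1_comp _ expR (fun y : R => - (q * y `^ sigma)) _ _ _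
    (is_derive_expR (- (q * x `^ sigma))) h.
  by rewrite mulrC.
have d2 : is_derive x (1 : R) (mompoly n q)
    (\sum_(j < n.+1) momcoef n j * q ^+ j *
     ((j%:R * sigma - n%:R) * x `^ (j%:R * sigma - n%:R - 1))).
  have -> : mompoly n q = \sum_(j < n.+1)
     (fun y => momcoef n j * q ^+ j * y `^ (j%:R * sigma - n%:R)).
    by apply/funext => y; rewrite /mompoly fct_sumE.
  apply: is_derive_sum => j.
  exact: (is_deriveZ _ (is_derive1_powR _ x0)).
have := is_deriveM d1 d2; rewrite /GRing.scale/= => h.
apply: is_derive_eq h _.
by rewrite /mom mompolyS//; ring.
Qed.

Lemma mompoly_ge0 n q x : 0 <= q -> 0 <= mompoly n q x.
Proof.
move=> q0; apply: sumr_ge0 => j _.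
by rewrite !mulr_ge0 ?powR_ge0 ?momcoef_ge0// exprn_ge0.
Qed.

End coefficients.

Section moments.
Context {R : realType} d (Omega : measurableType d) (P : probability Omega R).
Variables (T : finType) (Y : T -> Omega -> R) (q : T -> R) (sigma : R).
Hypothesis mY : forall t, measurable_fun setT (Y t).
Hypothesis Y0 : forall t w, 0 <= Y t w.
Local Notation M := (mom sigma).
Hypothesis HL : forall l : T -> R, (forall t, 0 < l t) ->
  \int[P]_w (\prod_t expR (- (l t * Y t w))) = \prod_t expR (- (q t * l t `^ sigma)).

Definition momfun (n : nat) (l y : R) : R := y ^+ n * expR (- (l * y)).

(** From [x ^ n / n! <= e ^ x] at [x = l y]. The bound does not depend on [y], so it dominates the
    integrands. *)
Lemma momfun_le n (l y : R) : 0 < l -> 0 <= y -> momfun n l y <= n`!%:R / l ^+ n.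
Proof.
move=> l0 y0; rewrite /momfun ler_pdivlMr ?exprn_gt0//.
have ly0 : 0 <= l * y by rewrite mulr_ge0// ltW.
have : (l * y) ^+ n * expR (- (l * y)) <= n`!%:R.
  rewrite expRN ler_pdivrMr ?expR_gt0//; case: n => [|n].
    by rewrite expr0 fact0 mul1r -[leLHS]addr0 (le_trans _ (expR_ge1Dx _))// lerD2l.
  have := expR_ge1Dxn n ly0; move=> h.
  rewrite -ler_pdivrMl ?ltr0n ?fact_gt0// mulrC (le_trans _ h)//.
  by rewrite lerDr.
suff -> : (l * y) ^+ n * expR (- (l * y)) = y ^+ n * expR (- (l * y)) * l ^+ n by [].
by rewrite exprMn; ring.
Qed.

Lemma momfun_ge0 n l y : 0 <= y -> 0 <= momfun n l y.
Proof. by move=> y0; rewrite mulr_ge0 ?expR_ge0 ?exprn_ge0. Qed.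

Lemma measurable_momfun n l t : measurable_fun setT (fun w => momfun n l (Y t w)).
Proof.
apply: measurable_funM; first exact: measurable_funX.
by apply: measurable_expRN; exact: measurable_funM.
Qed.

Lemma integrable_bounded (f : Omega -> R) (K : R) : measurable_fun setT f ->
  (forall w, `|f w| <= K) -> P.-integrable setT (EFin \o f).
Proof.
move=> mf fK; apply: (@le_integrable _ _ _ P setT _ _ (EFin \o cst K)) => //.
- exact/measurable_EFinP.
- move=> w _; rewrite /= lee_fin (le_trans (fK w))// ler_norm//.
- exact: finite_measure_integrable_cst.
Qed.

(** Differentiation of the identity in [l s] under the integral sign raises the order at [s] by one;
    the sign of the derivative is the same on both sides. *)
Lemma moment_step (n : T -> nat) (s : T) :
  (forall l, (forall t, 0 < l t) ->
    \int[P]_w (\prod_t momfun (n t) (l t) (Y t w)) = \prod_t M (n t) (q t) (l t)) ->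
  forall l, (forall t, 0 < l t) ->
    \int[P]_w (\prod_t momfun (n t + (t == s)) (l t) (Y t w)) =
    \prod_t M (n t + (t == s))%N (q t) (l t).
Proof.
move=> IH l l0.
pose Z w := \prod_(t | t != s) momfun (n t) (l t) (Y t w).
pose K := \prod_(t | t != s) ((n t)`!%:R / l t ^+ n t).
have Z0 w : 0 <= Z w by apply: prodr_ge0 => t _; exact: momfun_ge0.
have ZK w : Z w <= K.
  by apply: ler_prod => t _; rewrite momfun_ge0//= momfun_le.
have K0 : 0 <= K by apply: le_trans (ZK point).
have mZ : measurable_fun setT Z.
  by apply: measurable_fin_prod => t; exact: measurable_momfun.
pose f (x : R) w := Z w * momfun (n s) x (Y s w).
pose C := \prod_(t | t != s) M (n t) (q t) (l t).
have FE x : 0 < x -> \int[P]_w (f x w) = C * M (n s) (q s) x.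
  move=> x0; pose l' t := if t == s then x else l t.
  have l'0 t : 0 < l' t by rewrite /l'; case: eqP.
  have := IH l' l'0; rewrite [in RHS](bigD1 s)//= {2}/l' eqxx mulrC.
  rewrite (eq_bigr (fun t => M (n t) (q t) (l t))); last first.
    by move=> t ts; rewrite /l' (negbTE ts).
  move=> <-; apply: eq_Rintegral => w _; rewrite (bigD1 s)//= /l' eqxx mulrC.
  by congr (_ * _); apply: eq_bigr => t ts; rewrite (negbTE ts).
have mf m x : measurable_fun setT (fun w => Z w * momfun m x (Y s w)).
  by apply: measurable_funM => //; exact: measurable_momfun.
have fK m x w : 0 < x -> `|Z w * momfun m x (Y s w)| <= K * (m`!%:R / x ^+ m).
  move=> x0; have mg := momfun_ge0 m x (Y0 s w).
  rewrite (ger0_norm (mulr_ge0 (Z0 w) mg)).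
  by apply: ler_pM => //; exact: momfun_le.
have fi m x : 0 < x -> P.-integrable setT (EFin \o (fun w => Z w * momfun m x (Y s w))).
  by move=> x0; apply: (integrable_bounded (mf m x)) => w; exact: fK.
have df (x : R) w : is_derive x (1 : R) (f ^~ w) (- (Z w * momfun (n s).+1 x (Y s w))).
  have h : is_derive x (1 : R) (fun x : R => - (x * Y s w)) (- Y s w).
    have -> : (fun x : R => - (x * Y s w)) = - (Y s w \*: id).
      by apply/funext => y; rewrite /= mulrC.
    have := is_deriveN (is_deriveZ (Y s w) (@is_derive_id R R x 1)).
    by rewrite [X in is_derive _ _ _ (- X)]mulr1.
  have h2 := @is_derive1_comp _ expR (fun x : R => - (x * Y s w)) _ _ _
    (is_derive_expR (- (x * Y s w))) h.
  have := is_deriveZ (Z w * Y s w ^+ n s) h2.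
  rewrite /GRing.scale/= => h3.
  have -> : f ^~ w = (fun x => Z w * Y s w ^+ n s * expR (- (x * Y s w))).
    by apply/funext => y; rewrite /f /momfun mulrA.
  apply: is_derive_eq h3 _; rewrite /momfun exprS; ring.
have ls0 := l0 s.
(* A neighbourhood of [l s] bounded away from 0: the bound of [momfun_le] blows up at 0, and its
   value at [u] dominates over the whole interval. *)
pose u := l s / 2; pose v := l s * 2.
have u0 : 0 < u by rewrite divr_gt0.
have Iuv : `]u, v[%classic (l s).
  by rewrite /= in_itv/= /u /v; apply/andP; split; lra.
have D := @differentiation_under_integral R _ Omega P f setT measurableT (l s) u v Iuv.
have xpos x : `]u, v[%classic x -> 0 < x.
  by rewrite /= in_itv/= => /andP[ux _]; exact: lt_trans ux.
have {}D : derive1 (fun x : R => \int[P]_w (f x w)) (l s) =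
    \int[P]_w (- (Z w * momfun (n s).+1 (l s) (Y s w))).
  rewrite (D _ _ (cst (K * ((n s).+1`!%:R / u ^+ (n s).+1)))).
  - by apply: eq_Rintegral => w _; rewrite /partial1of2 derive1E; apply: derive_val.
  - by move=> x /xpos x0; exact: fi.
  - by move=> x w _ _; have [] := df x w.
  - by move=> w /=; rewrite mulr_ge0// divr_ge0// exprn_ge0// (ltW u0).
  - exact: finite_measure_integrable_cst.
  - move=> x w xI _; rewrite /partial1of2 derive1E.
    have [_ ->] := df x w; rewrite normrN (le_trans (fK _ _ _ (xpos _ xI)))//=.
    rewrite ler_wpM2l// ler_wpM2l// lef_pV2 ?posrE ?exprn_gt0//; last exact: xpos xI.
    apply: lerXn2r; rewrite ?nnegrE ?(ltW u0) ?(ltW (xpos _ xI))//.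
    by move: xI; rewrite /= in_itv/= => /andP[/ltW].
have D2 : derive1 (fun x : R => \int[P]_w (f x w)) (l s) = - (C * M (n s).+1 (q s) (l s)).
  rewrite derive1E.
  rewrite (@near_eq_derive _ _ _ _ (fun x => C * M (n s) (q s) x)).
  - have := is_deriveZ C (is_derive_mom sigma (n s) (q s) ls0).
    by move=> h; rewrite -mulrN; apply: derive_val.
  - by near=> x; apply: FE; near: x; exact: lt_nbhsr.
have E : \int[P]_w (Z w * momfun (n s).+1 (l s) (Y s w)) = C * M (n s).+1 (q s) (l s).
  apply: oppr_inj; rewrite -D2 D -[LHS]mulN1r -RintegralZl//; last exact: fi.
  by apply: eq_Rintegral => w _; rewrite mulN1r.
rewrite [RHS](bigD1 s)//= eqxx addn1 mulrC.
rewrite [X in X * _](eq_bigr (fun t => M (n t) (q t) (l t))); last first.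
  by move=> t ts; rewrite (negbTE ts) addn0.
rewrite -/C -E; apply: eq_Rintegral => w _.
rewrite (bigD1 s)//= eqxx addn1 mulrC; congr (_ * _).
by apply: eq_bigr => t ts; rewrite (negbTE ts) addn0.
Unshelve. all: by end_near. Qed.

(** Induction on the total order of the moment: order 0 is the Laplace transform [HL], and each step
    is one derivative. *)
Lemma moment_formula (n : T -> nat) (l : T -> R) : (forall t, 0 < l t) ->
  \int[P]_w (\prod_t momfun (n t) (l t) (Y t w)) = \prod_t M (n t) (q t) (l t).
Proof.
move: {2}(\sum_t n t)%N (erefl (\sum_t n t)%N) => m.
elim: m n l => [|m IH] n l nm l0.
  have -> : n = fun=> 0%N.
    by apply/funext => t; move/eqP: nm; rewrite sum_nat_eq0 => /forallP /(_ t) /eqP.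
  under [RHS]eq_bigr => t _ do rewrite mom0//.
  rewrite -HL//; apply: eq_Rintegral => w _.
  by apply: eq_bigr => t _; rewrite /momfun expr0 mul1r.
have [s ns] : exists s, (0 < n s)%N.
  apply: contrapT => h.
  have : (\sum_t n t = 0)%N.
    apply: big1 => t _; apply/eqP; rewrite -leqn0 leqNgt.
    by apply/negP => ht; apply: h; exists t.
  by rewrite nm.
pose n' t := (n t - (t == s))%N.
have nE : n = fun t => (n' t + (t == s))%N.
  by apply/funext => t; rewrite /n'; case: eqP => [->|]; rewrite ?subn0 ?addn0// subnK.
rewrite nE; apply: moment_step l0 => l' l'0; apply: IH => //.
apply/eqP; rewrite -eqSS -nm nE big_split/= -addn1 eqn_add2l eq_sym.
by rewrite (bigD1 s)//= eqxx big1 ?addn0// => t /negbTE ->.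
Qed.

End moments.

Lemma sub_sigma_measurable d (T : measurableType d) (G : set (set T)) :
  G `<=` measurable -> <<s G >> `<=` measurable.
Proof. by move=> GT; apply: smallest_sub => //; exact: sigma_algebra_measurable. Qed.

Lemma measure_finbigcup {R : realType} d (T : measurableType d)
    (mu : {measure set T -> \bar R}) (I : finType) (A : I -> set T) :
  (forall i, measurable (A i)) -> trivIset setT A ->
  mu (\bigcup_i A i) = (\sum_i mu (A i))%E.
Proof.
move=> mA tA; rewrite measure_fin_bigcup//; last exact: finite_finset.
rewrite [RHS]fsbig_seq ?index_enum_uniq//; apply: eq_fsbigl.
by apply/seteqP; split=> i //= _; exact: mem_index_enum.
Qed.

(** * Joint moments of the three independent components *)

Section gm.
Context {R : realType}.
Local Notation leb := (@lebesgue_measure R).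
Local Notation pos := `]0%R, +oo[%classic.
Context d (Omega : measurableType d) (P : probability Omega R).
Context d' (Theta : measurableType d') (P0 : probability Theta R).
Variables (sigma c z : R).
Hypotheses (sigma01 : 0 < sigma < 1) (c0 : 0 < c) (z01 : 0 < z < 1).
Variable N : 'I_3 -> R.-ker Omega ~> (R * Theta)%type.
Local Notation rho := (rho_stable sigma).
Local Notation a := (gm_rate c z).
Hypothesis gmN : gm_dependent P c z rho P0 N.

Lemma gm_rate_gt0 j : 0 < a j.
Proof.
case/andP: z01 => z0 z1.
by rewrite /gm_rate; case: ifP => _; rewrite mulr_gt0// subr_gt0.
Qed.

Lemma measurable_crm_sigma (mu : Omega -> set Theta -> \bar R) B :
  measurable B ->
  measurable_fun (setT : set (g_sigma_algebraType (rm_events mu))) (mu ^~ B).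
Proof.
move=> mB _ U mU; rewrite setTI; apply: sub_sigma_algebra.
by exists B => //; exists U => //; rewrite setTI.
Qed.

Lemma rm_events_measurable j : rm_events (crm (N j)) `<=` measurable.
Proof.
move=> F [B mB [U mU <-]]; rewrite setTI -[X in measurable X]setTI.
exact: measurable_crm.
Qed.

Local Open Scope ereal_scope.

Lemma laplace_gm (T : finType) (A : T -> set Theta) (l : 'I_3 -> T -> R) :
  (forall t, measurable (A t)) -> trivIset setT A -> (forall j t, (0 <= l j t)%R) ->
  \int[P]_w (\prod_j \prod_t lap ((l j t)%:E * crm (N j) w (A t)))%:E =
  (\prod_j \prod_t expR (- (a j * fine (P0 (A t)) * l j t `^ sigma)))%:E.
Proof.
move=> mA tA l0; have [prm ind] := gmN.
have := @integral_prod_independent _ _ _ P _ _ ind _ _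
  (fun j w => \prod_t lap ((l j t)%:E * crm (N j) w (A t)))%R.
move=> ->.
- rewrite -prodEFin; apply: eq_bigr => j _.
  rewrite (laplace_crm sigma01 (ltW (gm_rate_gt0 j)) (prm j) mA tA (l0 j)).
  by rewrite -sumrN expR_sum.
- by move=> j; apply: sub_sigma_measurable; exact: rm_events_measurable.
- by move=> j; exact: (@measurableT _ (g_sigma_algebraType (rm_events (crm (N j))))).
- by move=> j w; apply: prodr_ge0 => t _; exact: lap_ge0.
- move=> j; apply: measurable_fin_prod => t; apply: measurable_lap_comp.
  by apply: measurable_funeM; exact: measurable_crm.
- move=> j t.
  have mp : measurable_fun (setT : set (g_sigma_algebraType (rm_events (crm (N j)))))
      (fun w => \prod_t lap ((l j t)%:E * crm (N j) w (A t)))%R.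
    apply: measurable_fin_prod => t'; apply: measurable_lap_comp.
    by apply: measurable_funeM; exact: measurable_crm_sigma.
  have := measurable_fun_ltr (measurable_cst t) mp measurableT (Y := [set true]).
  by rewrite setTI => h; apply: h.
Qed.

Lemma laplace_mass j (x : R) : (0 <= x)%R ->
  \int[P]_w (lap (x%:E * crm (N j) w setT))%:E = (expR (- (a j * x `^ sigma)))%:E.
Proof.
move=> x0; have [prm _] := gmN.
have := @laplace_crm R _ _ P _ _ P0 _ _ sigma01 (ltW (gm_rate_gt0 j)) _ (prm j)
  'I_1 (fun=> setT) (fun=> x).
rewrite big_ord1 => H; rewrite -[LHS]/(\int[P]_w _).
under eq_integral do rewrite -(big_ord1 *%R (fun=> lap (x%:E * crm (N j) _ setT))).
rewrite H//.
- by rewrite probability_setT mulr1.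
- by apply/trivIsetP => i k _ _; rewrite !ord1 eqxx.
Qed.

(** In [laplace_mass], letting [x] tend to 0 excludes an infinite mass and letting [x] tend to
    infinity excludes a zero mass. [hy] chooses [x] so that the exponent takes a prescribed
    value. *)
Lemma mass_ae j : {ae P, forall w, 0 < crm (N j) w setT < +oo}.
Proof.
have aj := gm_rate_gt0 j; case/andP: (sigma01) => s0 s1.
have mc : measurable_fun setT (fun w => crm (N j) w setT) by exact: measurable_crm.
pose Foo := (fun w => crm (N j) w setT) @^-1` [set +oo].
pose F0 := (fun w => crm (N j) w setT) @^-1` [set 0].
have mFoo : measurable Foo.
  by rewrite -[X in measurable X]setTI; apply: mc => //; exact: emeasurable_set1.
have mF0 : measurable F0.
  by rewrite -[X in measurable X]setTI; apply: mc => //; exact: emeasurable_set1.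
have hy (y : R) : (0 < y)%R -> exists2 x : R, (0 < x)%R & (a j * x `^ sigma = y)%R.
  move=> y0; exists ((y / a j) `^ sigma^-1)%R; first by rewrite powR_gt0// divr_gt0.
  rewrite -powRrM mulVf ?gt_eqF// powRr1 ?divr_ge0 ?ltW//.
  by rewrite mulrC divfK// gt_eqF.
have small (p : \bar R) : 0 <= p -> (forall y : R, (0 < y)%R -> p <= y%:E) -> p = 0.
  move=> p0 hp; apply/eqP; rewrite eq_le p0 andbT.
  apply/lee_addgt0Pr => y y0; rewrite add0e; exact: hp.
have mlap x : measurable_fun setT (fun w => (lap (x%:E * crm (N j) w setT))%:E).
  apply/measurable_EFinP; apply: measurable_lap_comp.
  exact: measurable_funeM.
have Poo : P Foo = 0.
  apply: (small (P Foo)) => // y y0; have [x x0 xy] := hy _ y0.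
  have h : (expR (- y))%:E <= P (~` Foo).
    rewrite -xy -laplace_mass ?(ltW x0)// -(setIT (~` Foo)).
    rewrite -integral_indic//; last exact: measurableC.
    apply: ge0_le_integral => //.
    - by move=> w _; rewrite lee_fin lap_ge0.
    - by apply/measurable_EFinP; apply: measurable_indic; exact: measurableC.
    - move=> w _; rewrite lee_fin indicE; have [wF|wF] := boolP (w \in _).
        by apply: lap_le1; rewrite mule_ge0// ?lee_fin ?(ltW x0)// crm_ge0.
      move: wF; rewrite in_setC negbK => /set_mem; rewrite /Foo /= => ->.
      by rewrite gt0_muley ?lte_fin// lapy.
  rewrite probability_setC// in h.
  have : P Foo <= 1 - (expR (- y))%:E.
    move: h; rewrite -(@fineK _ (P Foo)) ?fin_num_measure// -!EFinB !lee_fin.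
    by rewrite lerBrDr addrC -lerBrDr.
  move=> /le_trans; apply; rewrite -EFinB lee_fin lerBlDr addrC -lerBlDr.
  exact: expR_ge1Dx.
have P00 : P F0 = 0.
  apply: (small (P F0)) => // e e0; have ei0 : (0 < e^-1)%R by rewrite invr_gt0.
  have [x x0 xy] := hy _ ei0.
  have h : P F0 <= (expR (- e^-1))%:E.
    rewrite -xy -laplace_mass ?(ltW x0)// -(setIT F0).
    rewrite -integral_indic//.
    apply: ge0_le_integral => //.
    - by apply/measurable_EFinP; apply: measurable_indic.
    - move=> w _; rewrite lee_fin indicE; have [wF|wF] := boolP (w \in _).
        by move/set_mem: wF; rewrite /F0 /= => ->; rewrite mule0 lap0.
      by rewrite lap_ge0.
  apply: le_trans h _; rewrite lee_fin expRN -[leRHS]invrK.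
  rewrite lef_pV2 ?posrE ?expR_gt0 ?invr_gt0//.
  by rewrite (le_trans _ (expR_ge1Dx _))// lerDr.
have A1 : {ae P, forall w, crm (N j) w setT < +oo}.
  exists Foo; split => // w /= h; apply/eqP; rewrite -leye_eq leNgt.
  exact/negP.
have A2 : {ae P, forall w, 0 < crm (N j) w setT}.
  exists F0; split => // w /= h; apply/eqP; rewrite eq_le crm_ge0 andbT leNgt.
  exact/negP.
by apply: filterS2 A1 A2 => w h1 h2; rewrite h1 h2.
Qed.

Lemma crm_le w j (A B : set Theta) : measurable A -> measurable B -> A `<=` B ->
  crm (N j) w A <= crm (N j) w B.
Proof.
move=> mA mB AB; rewrite /crm.
have mp C : measurable C -> measurable ((pos : set R) `*` C).
  by move=> mC; apply: measurableX => //; exact: measurable_itv.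
apply: ge0_subset_integral; [exact: mp|exact: mp| | |].
- by apply/measurable_EFinP/measurable_funTS; exact: measurable_fst.
- by move=> u [/=]; rewrite in_itv/= andbT => u0 _; rewrite lee_fin ltW.
- by move=> u [u1 u2]; split => //; exact: AB.
Qed.

Lemma crm_sum w j (T : finType) (A : T -> set Theta) :
  (forall t, measurable (A t)) -> trivIset setT A -> \bigcup_t A t = setT ->
  crm (N j) w setT = \sum_t crm (N j) w (A t).
Proof.
move=> mA tA cA.
have mp t : measurable ((pos : set R) `*` A t).
  by apply: measurableX => //; exact: measurable_itv.
have tp : trivIset setT (fun t => (pos : set R) `*` A t).
  apply/trivIsetP => t t' _ _ tt'; rewrite -setXI.
  by move/trivIsetP : tA => /(_ _ _ I I tt') ->; rewrite setX0.
rewrite /crm -ge0_integral_bigsetU.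
- apply: (congr1 (fun D => integral (N j w) D (fun u => (u.1)%:E))).
  rewrite -bigcup_seq; apply/seteqP; split => [[x y] [/= x0 _]|[x y] [t _ []]//].
  have : (\bigcup_t A t) y by rewrite cA.
  by case=> t _ At; exists t => //=; exact: mem_index_enum.
- exact: mp.
- exact: index_enum_uniq.
- by apply: sub_trivIset tp.
- by apply/measurable_EFinP/measurable_funTS; exact: measurable_fst.
- move=> [x y]; rewrite -bigcup_seq => -[t _ [/=]].
  by rewrite in_itv/= andbT => x0 _; rewrite lee_fin ltW.
Qed.

Lemma measurable_fine_crm j B : measurable B ->
  measurable_fun setT (fun w => fine (crm (N j) w B)).
Proof.
move=> mB; apply: measurableT_comp; first exact: fine_measurable.
exact: measurable_crm.
Qed.

Lemma fine_crm_ge0 j w B : (0 <= fine (crm (N j) w B))%R.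
Proof. by apply: fine_ge0; exact: crm_ge0. Qed.

(** Pairs of a component and a cell form one finite index set, so [moment_formula] handles the three
    measures together. The masses being almost surely finite, [lap] is there an ordinary
    exponential. *)
Lemma moments_gm (T : finType) (A : T -> set Theta) (n : 'I_3 * T -> nat)
    (l : 'I_3 * T -> R) :
  (forall t, measurable (A t)) -> trivIset setT A -> (forall u, (0 < l u)%R) ->
  \int[P]_w (\prod_u momfun (n u) (l u) (fine (crm (N u.1) w (A u.2))))%:E =
  (\prod_u mom sigma (n u) (a u.1 * fine (P0 (A u.2))) (l u))%:E.
Proof.
move=> mA tA l0.
pose Y (u : 'I_3 * T) w := fine (crm (N u.1) w (A u.2)).
have mY u : measurable_fun setT (Y u) by exact: measurable_fine_crm.
have Y0 u w : (0 <= Y u w)%R by exact: fine_crm_ge0.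
rewrite -(@moment_formula R _ Omega P _ Y (fun u => a u.1 * fine (P0 (A u.2)))%R sigma mY Y0)//.
  rewrite /Rintegral fineK//; apply: integrable_fin_num => //.
  apply: (@integrable_bounded _ _ _ P _ (\prod_u ((n u)`!%:R / l u ^+ n u))%R).
    by apply: measurable_fin_prod => u; exact: (measurable_momfun mY).
  move=> w; rewrite ger0_norm; last by apply: prodr_ge0 => u _; exact: momfun_ge0.
  by apply: ler_prod => u _; rewrite momfun_ge0//= momfun_le.
move=> l' l'0; rewrite /Rintegral.
have -> : \int[P]_w (\prod_u expR (- (l' u * Y u w)))%:E =
    \int[P]_w (\prod_j \prod_t lap ((l' (j, t))%:E * crm (N j) w (A t)))%:E.
  apply: ge0_ae_eq_integral => //.
  - apply/measurable_EFinP; apply: measurable_fin_prod => u.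
    by apply: measurable_expRN; exact: measurable_funM.
  - apply/measurable_EFinP; do 2 apply: measurable_fin_prod => ?.
    by apply: measurable_lap_comp; apply: measurable_funeM; exact: measurable_crm.
  - by move=> w _; rewrite lee_fin; apply: prodr_ge0 => u _; exact: expR_ge0.
  - move=> w _; rewrite lee_fin; do 2 apply: prodr_ge0 => ? _.
    exact: lap_ge0.
  have := mass_ae ord0; have := mass_ae (inord 1); have := mass_ae (inord 2).
  apply: filterS3 => w h2 h1 h0 _; congr EFin.
  have hj j : crm (N j) w setT < +oo.
    have : j \in [:: ord0; inord 1; inord 2].
      rewrite !inE -!(inj_eq val_inj)/= !inordK//.
      by case: j => -[|[|[|]]].
    by rewrite !inE => /or3P[] /eqP ->; [case/andP: h0|case/andP: h1|case/andP: h2].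
  rewrite pair_bigA/=; apply: eq_bigr => -[j t] _ /=; rewrite /Y /=.
  have fj : crm (N j) w (A t) \is a fin_num.
    rewrite ge0_fin_numE ?crm_ge0//; apply: le_lt_trans (hj j).
    exact: crm_le.
  by rewrite -{2}(fineK fj) -EFinM lap_EFin.
rewrite laplace_gm//; last by move=> j t; rewrite ltW.
by rewrite /= pair_bigA/=; apply: eq_bigr => -[j t].
Qed.

End gm.

Section ord3.
Context {R : realType}.

Lemma prod_ord3 (F : 'I_3 -> R) :
  \prod_j F j = F ord0 * F (inord 1) * F (inord 2).
Proof.
rewrite !big_ord_recl big_ord0 mulr1 mulrA; congr (_ * F _ * F _);
  by apply/val_inj; rewrite /= inordK.
Qed.

Lemma prod_label k (lb : 'I_k -> 'I_3) (m : 'I_k -> nat) (F : 'I_3 -> 'I_k -> nat -> R) :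
  (forall j r, F j r 0%N = 1) ->
  \prod_j \prod_r F j r (if lb r == j then m r else 0%N) = \prod_r F (lb r) r (m r).
Proof.
move=> F0; rewrite exchange_big/=; apply: eq_bigr => r _.
rewrite (bigD1 (lb r))//= eqxx big1 ?mulr1// => j jl.
by rewrite eq_sym (negbTE jl).
Qed.

End ord3.

Section gm_moment.
Context {R : realType}.
Local Notation leb := (@lebesgue_measure R).
Local Notation pos := `]0%R, +oo[%classic.
Context d (Omega : measurableType d) (P : probability Omega R).
Context d' (Theta : measurableType d') (P0 : probability Theta R).
Variables (sigma c z : R).
Hypotheses (sigma01 : 0 < sigma < 1) (c0 : 0 < c) (z01 : 0 < z < 1).
Variable N : 'I_3 -> R.-ker Omega ~> (R * Theta)%type.
Local Notation rho := (rho_stable sigma).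
Local Notation a := (gm_rate c z).
Hypothesis gmN : gm_dependent P c z rho P0 N.
Variables (k n1 n2 : nat) (lb : 'I_k -> 'I_3) (m : 'I_k -> nat).
Hypotheses (n1_gt0 : (0 < n1)%N) (n2_gt0 : (0 < n2)%N).

(* The variable of the Laplace transform of [mu_j] when the exponents [u] and
   [v] are attached to [mu_1 + mu_0] and [mu_2 + mu_0]. *)
Definition lvar (u v : R) (j : 'I_3) : R :=
  if j == ord0 then u + v else if j == inord 1 then u else v.

Lemma lvar0 u v : lvar u v ord0 = u + v. Proof. by []. Qed.
Lemma lvar1 u v : lvar u v (inord 1) = u.
Proof. by rewrite /lvar -(inj_eq val_inj)/= inordK//= eqxx. Qed.
Lemma lvar2 u v : lvar u v (inord 2) = v.
Proof. by rewrite /lvar -!(inj_eq val_inj)/= !inordK. Qed.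

Lemma lvar_gt0 u v j : 0 < u -> 0 < v -> 0 < lvar u v j.
Proof. by move=> u0 v0; rewrite /lvar; case: ifP => _; [rewrite addr_gt0|case: ifP]. Qed.

Lemma gm_rate0 : a ord0 = c * (1 - z). Proof. by []. Qed.
Lemma gm_rate1 : a (inord 1) = c * z.
Proof. by rewrite /gm_rate -(inj_eq val_inj)/= inordK. Qed.
Lemma gm_rate2 : a (inord 2) = c * z.
Proof. by rewrite /gm_rate -(inj_eq val_inj)/= inordK. Qed.

(** The part that does not see the clusters: the powers come from the Gamma integrals for the two
    normalizations, the exponential is the Laplace transform of the two total masses. *)
Definition weightfun (u v : R) : R :=
  u `^ (n1%:R - 1) * v `^ (n2%:R - 1) * expR (- (c * psi12 z sigma u v)).

(** Its double integral is [Gamma n1 * Gamma n2] times the probability that the labels are [lb] and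
    that the values of each cluster [r] lie in a set of mass [p r], these sets being disjoint; see
    [cluster_prob]. *)
Definition levelfun (p : 'I_k -> R) (u v : R) : R :=
  weightfun u v *
  \prod_r mompoly sigma (m r) (a (lb r) * p r) (lvar u v (lb r)).

Definition total1 w := mass N (inord 1) w + mass N ord0 w.
Definition total2 w := mass N (inord 2) w + mass N ord0 w.

Local Open Scope ereal_scope.

(** Exchanging the sums, [u total1 + v total2] is the sum over the components [j] of [lvar u v j]
    times the mass of [mu_j], so the left side is a joint moment in the sense of [moments_gm]. *)
Lemma laplace_cluster (A : 'I_k -> set Theta) u v :
  (forall r, measurable (A r)) -> trivIset setT A -> (0 < u)%R -> (0 < v)%R ->
  \int[P]_w (expR (- (u * total1 w)) * expR (- (v * total2 w)) *
     \prod_r fine (crm (N (lb r)) w (A r)) ^+ m r)%:E =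
  (expR (- (c * psi12 z sigma u v)) *
   \prod_r mompoly sigma (m r) (a (lb r) * fine (P0 (A r))) (lvar u v (lb r)))%:E.
Proof.
move=> mA tA u0 v0.
(* The complement is added as cell [ord0], so that the cells cover [Theta] and a total mass is the
   sum over the cells. *)
pose B (t : 'I_k.+1) : set Theta :=
  if unlift ord0 t is Some r then A r else ~` \bigcup_r A r.
have mB t : measurable (B t).
  rewrite /B; case: unlift => [r|]//; apply: measurableC.
  by apply: fin_bigcup_measurable => //; exact: finite_finset.
have BS r : B (lift ord0 r) = A r by rewrite /B liftK.
have B0 : B ord0 = ~` \bigcup_r A r by rewrite /B unlift_none.
have tB : trivIset setT B.
  apply/trivIsetP => t t' _ _.
  case: (unliftP ord0 t) => [r ->|->]; case: (unliftP ord0 t') => [r' ->|->];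
    rewrite ?BS ?B0 ?eqxx// => tt'.
  - move/trivIsetP : tA; apply => //; apply: contra tt' => /eqP ->.
  - by rewrite -subset0 => y [Ay]; apply; exists r.
  - by rewrite -subset0 => y [+ Ay]; apply; exists r'.
have cB : \bigcup_t B t = setT.
  apply/seteqP; split => // y _; have [[r _ Ay]|nA] := pselect ((\bigcup_r A r) y).
    by exists (lift ord0 r) => //; rewrite BS.
  by exists ord0 => //; rewrite B0.
(* Order [m r] for cell [r] under the component that its label designates, order 0 for the other
   components and for the complement. *)
pose nn (x : 'I_3 * 'I_k.+1) : nat :=
  if unlift ord0 x.2 is Some r then (if lb r == x.1 then m r else 0%N) else 0%N.
pose ll (x : 'I_3 * 'I_k.+1) : R := lvar u v x.1.
have ll0 x : (0 < ll x)%R by exact: lvar_gt0.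
have H := moments_gm sigma01 c0 z01 gmN nn mB tB ll0.
have split_prod (F : 'I_3 -> 'I_k.+1 -> nat -> R) :
    (forall j t, F j t 0%N = 1%R) ->
    (\prod_x F x.1 x.2 (nn x) = \prod_r F (lb r) (lift ord0 r) (m r))%R.
  move=> F0; rewrite -(pair_bigA _ (fun j t => F j t (nn (j, t))))/=.
  rewrite -(@prod_label R k lb m (fun j r => F j (lift ord0 r)))//.
  apply: eq_bigr => j _; rewrite big_ord_recl /nn /= unlift_none F0 mul1r.
  by apply: eq_bigr => r _; rewrite liftK.
transitivity (\int[P]_w (\prod_x momfun (nn x) (ll x) (fine (crm (N x.1) w (B x.2))))%:E).
  apply: ge0_ae_eq_integral => //.
  - apply/measurable_EFinP; apply: measurable_funM.
      by apply: measurable_funM; apply: measurable_expRN; apply: measurable_funM => //;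
        apply: measurable_funD; exact: measurable_fine_crm.
    apply: measurable_fin_prod => r; apply: measurable_funX.
    exact: measurable_fine_crm.
  - apply/measurable_EFinP; apply: measurable_fin_prod => x.
    apply: (@measurable_momfun R _ Omega _ (fun x w => fine (crm (N x.1) w (B x.2)))) => y.
    exact: measurable_fine_crm.
  - move=> w _; rewrite lee_fin !mulr_ge0 ?expR_ge0//.
    by apply: prodr_ge0 => r _; rewrite exprn_ge0// fine_crm_ge0.
  - move=> w _; rewrite lee_fin; apply: prodr_ge0 => x _.
    by apply: momfun_ge0; exact: fine_crm_ge0.
  have := mass_ae sigma01 c0 z01 gmN ord0.
  have := mass_ae sigma01 c0 z01 gmN (inord 1).
  have := mass_ae sigma01 c0 z01 gmN (inord 2).
  apply: filterS3 => w h2 h1 h0 _; congr EFin.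
  have massE j : 0 < crm (N j) w setT < +oo ->
      (\sum_t fine (crm (N j) w (B t)) = mass N j w)%R.
    case/andP => _ hj; rewrite /mass (crm_sum N w j mB tB cB) sum_fine//.
    move=> t _; rewrite ge0_fin_numE ?crm_ge0//; apply: le_lt_trans hj.
    exact: crm_le.
  rewrite /momfun big_split/= mulrC.
  rewrite (split_prod (fun j t n => fine (crm (N j) w (B t)) ^+ n)%R)//.
  congr (_ * _)%R; first by apply: eq_bigr => r _; rewrite BS.
  rewrite -(pair_bigA _ (fun j t => expR (- (ll (j, t) * fine (crm (N j) w (B t))))))/=.
  have e j : (\prod_t expR (- (ll (j, t) * fine (crm (N j) w (B t)))) =
      expR (- (lvar u v j * \sum_t fine (crm (N j) w (B t)))))%R.
    by rewrite mulr_sumr -sumrN expR_sum.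
  under eq_bigr do rewrite e.
  rewrite prod_ord3 lvar0 lvar1 lvar2 !massE// -!expRD; congr expR.
  by rewrite /total1 /total2; ring.
rewrite H; congr EFin; rewrite /mom big_split/=.
rewrite (split_prod (fun j t n => mompoly sigma n (a j * fine (P0 (B t))) (lvar u v j)))//.
  congr (_ * _)%R; last by apply: eq_bigr => r _; rewrite BS.
  rewrite -(pair_bigA _ (fun j t => expR (- (a j * fine (P0 (B t)) * ll (j, t) `^ sigma))))/=.
  have P1 : (\sum_t fine (P0 (B t)) = 1)%R.
    rewrite sum_fine; last by move=> t _; rewrite fin_num_measure.
    have /esym := measure_finbigcup P0 mB tB.
    by move=> ->; rewrite cB; exact: (congr1 fine (probability_setT P0)).
  have e j : (\prod_t expR (- (a j * fine (P0 (B t)) * ll (j, t) `^ sigma)) =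
      expR (- (a j * lvar u v j `^ sigma)))%R.
    rewrite -expR_sum sumrN; congr (expR (- _))%R.
    rewrite /ll /= -(mulr_suml _ _ _ (lvar u v j `^ sigma)%R) -mulr_sumr P1 mulr1//.
  under eq_bigr do rewrite e.
  rewrite prod_ord3 lvar0 lvar1 lvar2 gm_rate0 gm_rate1 gm_rate2 -!expRD.
  by congr expR; rewrite /psi12; ring.
by move=> j t; rewrite /mompoly big_ord1 /= mul0r subr0 powRr0 !mulr1.
Qed.

End gm_moment.

(** Where [T] vanishes the quotient is 0 by convention while the integral over [u] may diverge,
    hence the almost sure positivity. *)
Lemma integral_inverse_power {R : realType} d (Omega : measurableType d)
    (P : probability Omega R) (T W : Omega -> R) (n : nat) : (0 < n)%N ->
  measurable_fun setT T -> measurable_fun setT W -> (forall w, 0 <= W w) -> (forall w, 0 <= T w) ->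
  {ae P, forall w, 0 < T w} ->
  (\int[P]_w (Gamma n%:R * W w / T w ^+ n)%:E =
   \int[@lebesgue_measure R]_(u in `]0%R, +oo[) ((u `^ (n%:R - 1))%:E *
      \int[P]_w (W w * expR (- (u * T w)))%:E))%E.
Proof.
move=> n0 mT mW W0 T0 aeT; have n00 : 0 < n%:R :> R by rewrite ltr0n.
pose f (u : R) w := (u `^ (n%:R - 1) * (W w * expR (- (u * T w))))%:E.
have f0 u w : (0 <= f u w)%E by rewrite lee_fin !mulr_ge0 ?powR_ge0 ?expR_ge0.
have mf : measurable_fun setT (fun x : R * Omega => f x.1 x.2).
  apply/measurable_EFinP; apply: measurable_funM; first exact: measurable_powR_comp.
  apply: measurable_funM; first exact: measurableT_comp.
  apply: measurable_expRN; apply: measurable_funM => //.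
  exact: measurableT_comp.
transitivity (\int[P]_w \int[@lebesgue_measure R]_(u in `]0%R, +oo[) f u w)%E; last first.
  rewrite tonelli_in//; last first.
    exact: (measurableT_comp mf (@measurable_swap _ _ Omega R)).
  apply: eq_integral => u _; rewrite /f.
  under eq_integral do rewrite EFinM.
  rewrite ge0_integralZl//.
  - apply/measurable_EFinP; apply: measurable_funM => //.
    by apply: measurable_expRN; exact: measurable_funM.
  - by move=> w _; rewrite lee_fin mulr_ge0// expR_ge0.
  - by rewrite lee_fin powR_ge0.
have mcl : measurable_fun setT (fun w => Gamma n%:R * W w * (T w `^ (- n%:R))).
  apply: measurable_funM; first exact: measurable_funM.
  by apply: (measurableT_comp (f := @powR R ^~ (- n%:R))).
transitivity (\int[P]_w (Gamma n%:R * W w * (T w `^ (- n%:R)))%:E)%E; last first.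
  apply: ge0_ae_eq_integral => //.
  - exact/measurable_EFinP.
  - apply: (measurable_integral_snd (@lebesgue_measure R) (f := fun w u => f u w)) => //.
    exact: (measurableT_comp mf (@measurable_swap _ _ Omega R)).
  - move=> w _; rewrite lee_fin !mulr_ge0 ?powR_ge0// ltW//.
    exact: Gamma_gt0.
  - by move=> w _; apply: integral_ge0.
  apply: filterS aeT => w Tw _; rewrite /f.
  under eq_integral do rewrite mulrCA (mulrC _ (T w)) EFinM.
  rewrite ge0_integralZl//.
  - by rewrite (integral_gamma n00 Tw) -EFinM; congr EFin; ring.
  - apply/measurable_EFinP/measurable_funTS; apply: measurable_funM => //.
    by apply: measurable_expRN; exact: measurable_funM.
  - by move=> u _; rewrite lee_fin mulr_ge0 ?powR_ge0 ?expR_ge0.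
  - by rewrite lee_fin.
by apply: eq_integral => w _; rewrite powRN powR_mulrn.
Qed.

Section gm_moment.
Context {R : realType}.
Local Notation leb := (@lebesgue_measure R).
Local Notation pos := `]0%R, +oo[%classic.
Context d (Omega : measurableType d) (P : probability Omega R).
Context d' (Theta : measurableType d') (P0 : probability Theta R).
Variables (sigma c z : R).
Hypotheses (sigma01 : 0 < sigma < 1) (c0 : 0 < c) (z01 : 0 < z < 1).
Variable N : 'I_3 -> R.-ker Omega ~> (R * Theta)%type.
Hypothesis gmN : gm_dependent P c z (rho_stable sigma) P0 N.
Variables (k n1 n2 : nat) (lb : 'I_k -> 'I_3) (m : 'I_k -> nat).
Hypotheses (n1_gt0 : (0 < n1)%N) (n2_gt0 : (0 < n2)%N).

Lemma mass_ge0 j w : 0 <= mass N j w.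
Proof. exact: fine_crm_ge0. Qed.

Lemma measurable_mass j : measurable_fun setT (mass N j).
Proof. exact: measurable_fine_crm. Qed.

Lemma mass_gt0_ae : {ae P, forall w, forall j, 0 < mass N j w /\ (crm (N j) w setT < +oo)%E}.
Proof.
have := mass_ae sigma01 c0 z01 gmN ord0.
have := mass_ae sigma01 c0 z01 gmN (inord 1).
have := mass_ae sigma01 c0 z01 gmN (inord 2).
apply: filterS3 => w h2 h1 h0 j.
suff hj : (0 < crm (N j) w setT < +oo)%E.
  by split; [exact: fine_gt0|case/andP: hj].
have : j \in [:: ord0; inord 1; inord 2].
  rewrite !inE -!(inj_eq val_inj)/= !inordK//.
  by case: j => -[|[|[|]]].
by rewrite !inE => /or3P[] /eqP ->.
Qed.

Lemma total_ge0 i j w : 0 <= mass N i w + mass N j w.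
Proof. by rewrite addr_ge0// mass_ge0. Qed.

Lemma measurable_total i j : measurable_fun setT (fun w => mass N i w + mass N j w).
Proof. by apply: measurable_funD; exact: measurable_mass. Qed.

Lemma total_gt0_ae i j : {ae P, forall w, 0 < mass N i w + mass N j w}.
Proof.
by apply: filterS mass_gt0_ae => w h; rewrite addr_gt0//; apply: (h _).1.
Qed.

(** [integral_inverse_power] is used once per sample: for [total1] with the inverse power of
    [total2] kept in the weight, then for [total2] with the exponential of [total1] in the
    weight. *)
Lemma gm_moment (A : 'I_k -> set Theta) :
  (forall r, measurable (A r)) -> trivIset setT A ->
  (\int[P]_w (Gamma n1%:R * (Gamma n2%:R *
      (\prod_r fine (crm (N (lb r)) w (A r)) ^+ m r) / total2 N w ^+ n2) /
      total1 N w ^+ n1)%:E =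
  \int[leb]_(u in pos) \int[leb]_(v in pos)
    (levelfun sigma c z n1 n2 lb m (fun r => fine (P0 (A r))) u v)%:E)%E.
Proof.
move=> mA tA; pose W w := \prod_r fine (crm (N (lb r)) w (A r)) ^+ m r.
have mW : measurable_fun setT W.
  apply: measurable_fin_prod => r; apply: measurable_funX.
  exact: measurable_fine_crm.
have W0 w : 0 <= W w by apply: prodr_ge0 => r _; rewrite exprn_ge0// fine_crm_ge0.
have mT j : measurable_fun setT (fun w => mass N j w + mass N ord0 w).
  exact: measurable_total.
have G0 n : (0 < n)%N -> 0 <= Gamma n%:R :> R.
  by move=> n0; rewrite ltW// Gamma_gt0// ltr0n.
rewrite (integral_inverse_power (T := total1 N)
  (W := fun w => Gamma n2%:R * W w / total2 N w ^+ n2))//; last 4 first.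
- apply: measurable_funM; first exact: measurable_funM.
  have -> : (fun w => (total2 N w ^+ n2)^-1) = (fun w => total2 N w `^ (- n2%:R)).
    by apply/funext => w; rewrite powRN powR_mulrn// total_ge0.
  by apply: (measurableT_comp (f := @powR R ^~ (- n2%:R))) => //; exact: mT.
- move=> w; rewrite divr_ge0 ?exprn_ge0 ?total_ge0//.
  by rewrite mulr_ge0 ?W0// G0.
- by move=> w; exact: total_ge0.
- exact: total_gt0_ae.
apply: eq_integral => u /set_mem; rewrite /= in_itv/= andbT => u0.
under eq_integral => w _.
  rewrite (_ : _ * _ * expR _ =
    Gamma n2%:R * (W w * expR (- (u * total1 N w))) / total2 N w ^+ n2);
    last by ring.
  over.
rewrite (integral_inverse_power (T := total2 N)
  (W := fun w => W w * expR (- (u * total1 N w))))//; last 4 first.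
- apply: measurable_funM => //; apply: measurable_expRN; apply: measurable_funM => //.
  exact: mT.
- by move=> w; rewrite mulr_ge0 ?W0// expR_ge0.
- by move=> w; exact: total_ge0.
- exact: total_gt0_ae.
have e v : (0 < v)%R -> (\int[P]_w (W w * expR (- (u * total1 N w)) *
    expR (- (v * total2 N w)))%:E = (expR (- (c * psi12 z sigma u v)) *
   \prod_r mompoly sigma (m r) (gm_rate c z (lb r) * fine (P0 (A r))) (lvar u v (lb r)))%:E)%E.
  move=> v0; rewrite -(laplace_cluster sigma01 c0 z01 gmN lb m mA tA u0 v0).
  by apply: eq_integral => w _; congr EFin; rewrite /W; ring.
rewrite -ge0_integralZl//.
- apply: eq_integral => v /set_mem; rewrite /= in_itv/= andbT => v0.
  by rewrite e// -!EFinM; congr EFin; rewrite /levelfun /weightfun; ring.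
- apply: measurable_funTS; apply: emeasurable_funM.
    by apply/measurable_EFinP.
  apply: (measurable_integral_snd P (T1 := measurableTypeR R) (f := fun v w => (W w *
    expR (- (u * total1 N w)) * expR (- (v * total2 N w)))%:E)) => //.
    apply/measurable_EFinP; apply: measurable_funM.
      apply: (measurableT_comp (f := fun w => W w * expR (- (u * total1 N w)))) => //.
      apply: measurable_funM => //; apply: measurable_expRN; apply: measurable_funM => //.
      exact: mT.
    apply: measurable_expRN; apply: measurable_funM => //.
    by apply: measurableT_comp => //; exact: mT.
  by move=> v w; rewrite lee_fin !mulr_ge0// ?expR_ge0 ?W0.
- by move=> v _; rewrite mule_ge0// ?lee_fin ?powR_ge0//; apply: integral_ge0 => w _;
    rewrite lee_fin !mulr_ge0// ?expR_ge0 ?W0.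
- by rewrite lee_fin powR_ge0.
- exact: mT.
- exact: mT.
Qed.

End gm_moment.

(** * From conditional laws to the law of the latent values *)

Section cond_laws.
Context d (Omega : measurableType d) (R : realType) (P : probability Omega R).
Context (G : set (set Omega)) (I : finType) d' (T : measurableType d').
Variables (Z : I -> Omega -> T) (K : I -> Omega -> set T -> \bar R).
Hypotheses (GT : G `<=` measurable) (ZK : cond_independent_laws P G Z K).
Hypotheses (mZ : forall i, measurable_fun setT (Z i)) (K0 : forall i w B, (0 <= K i w B)%E).

(** [cond_independent_laws] speaks of events of [G]; applied to the superlevel sets of [F] and
    integrated over the level, it gives the same rule with the weight [F]. *)
Lemma cond_laws_integral (F : Omega -> R) (B : I -> set T) :
  measurable_fun setT F -> (forall w, 0 <= F w) ->
  (forall t, G [set w | t < F w]) -> (forall i, measurable (B i)) ->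
  measurable_fun setT (fun w => \prod_i K i w (B i))%E ->
  (\int[P]_(w in \bigcap_(i in [set: I]) (Z i @^-1` B i)) (F w)%:E =
   \int[P]_w ((\prod_i K i w (B i)) * (F w)%:E))%E.
Proof.
move=> mF F0 GF mB mK; pose C := \bigcap_(i in [set: I]) (Z i @^-1` B i).
have mC : measurable C.
  apply: fin_bigcap_measurable; first exact: finite_finset.
  by move=> i _; rewrite -[X in measurable X]setTI; exact: mZ.
have mFt t : measurable [set w | t < F w] by exact: GT.
rewrite integral_indicM; under eq_integral do rewrite muleC.
rewrite layer_cake//; last by apply/measurable_EFinP; exact: measurable_indic.
rewrite [RHS]layer_cake; [|exact: mF|exact: mK|exact: F0|
  by move=> w; apply: prode_ge0 => i _].
apply: eq_integral => t _; rewrite -integral_indicM -[RHS]integral_indicM.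
by rewrite -ZK.2// integral_indic// setIC.
Qed.

End cond_laws.

Section latent.
Context d (Omega : measurableType d) (R : realType) (P : probability Omega R).
Context d' (Theta : measurableType d') (P0 : probability Theta R).
Variables (sigma c z : R).
Hypotheses (sigma01 : 0 < sigma < 1) (c0 : 0 < c) (z01 : 0 < z < 1).
Variable N : 'I_3 -> R.-ker Omega ~> (R * Theta)%type.
Hypothesis gmN : gm_dependent P c z (rho_stable sigma) P0 N.
Variables n1 n2 : nat.
Local Notation I := (sample_index n1 n2).
Variables (zeta : I -> {RV P >-> 'I_3}) (theta : I -> {RV P >-> Theta}).
Let crm_events := \bigcup_(j in [set: 'I_3]) rm_events (crm (N j)).
Let label_events := \bigcup_(i in [set: I]) rv_events (zeta i).
Hypothesis zetaP : cond_independent_laws P <<s crm_events >> zeta (label_law (n2 := n2) N).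
Hypothesis thetaP : cond_independent_laws P <<s crm_events `|` label_events >>
  theta (fun i w B => normalized_crm N (zeta i w) w B).

Lemma crm_events_measurable : crm_events `<=` measurable.
Proof. by move=> A [j _]; exact: rm_events_measurable. Qed.

Lemma measurable_crm_events j B : measurable B ->
  measurable_fun (setT : set (g_sigma_algebraType crm_events))
    (fun w => fine (crm (N j) w B)).
Proof.
move=> mB; apply: (measurableT_comp (@fine_measurable R _ measurableT)).
move=> _ U mU; rewrite setTI; apply: sub_sigma_algebra.
by exists j => //; exists B => //; exists U => //; rewrite setTI.
Qed.

Lemma label_set l : <<s crm_events `|` label_events >> [set w | forall i, zeta i w = l i].
Proof.
have -> : [set w | forall i, zeta i w = l i] =
    \bigcap_(i in [set: I]) (zeta i @^-1` [set l i]).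
  by apply/seteqP; split => [w h i _|w h i]; [exact: h|exact: (h i)].
apply: (@fin_bigcap_measurable _ (g_sigma_algebraType (crm_events `|` label_events))).
  exact: finite_finset.
move=> i _; apply: sub_sigma_algebra; right; exists i => //.
by exists [set l i] => //; rewrite setTI.
Qed.

Lemma label_law_ae (l : I -> 'I_3) : (forall i, l i = ord0 \/ l i = own i) ->
  {ae P, forall w, forall i, label_law N i w [set l i] =
     (mass N (l i) w / (mass N (own i) w + mass N ord0 w))%:E}.
Proof.
move=> lP; apply: filterS (mass_gt0_ae sigma01 c0 z01 gmN) => w h i.
have [hi _] := h (own i); have [h0 _] := h ord0.
have o0 : own i != ord0.
  by rewrite /own; case: ifP => _; rewrite -(inj_eq val_inj)/= inordK.
rewrite /label_law /weight !diracE; have [li|li] := lP i; rewrite li.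
  rewrite (negbTE (_ : own i \notin _)); last by rewrite notin_setE => /= /eqP; exact/negP.
  rewrite mem_set// mule0 mule1 add0e; congr EFin.
  by rewrite -[1](@divff _ (mass N (own i) w + mass N ord0 w)) ?gt_eqF ?addr_gt0//;
     rewrite -mulrBl addrAC subrr add0r.
rewrite mem_set// (negbTE (_ : ord0 \notin _)); last first.
  by rewrite notin_setE => /= /esym/eqP; exact/negP.
by rewrite mule0 mule1 adde0.
Qed.

Lemma label_law_ge0 (i : I) w B : (0 <= label_law N i w B)%E.
Proof.
have w01 : 0 <= @weight _ _ _ _ _ n1 n2 N i w <= 1.
  rewrite /weight divr_ge0 ?addr_ge0 ?mass_ge0//=.
  (* With a zero total the weight is 0 by the convention on division, so the bounds hold everywhere
     and not just almost surely. *)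
  have [T0|T0] := eqVneq (mass N (own i) w + mass N ord0 w) 0.
    by rewrite T0 invr0 mulr0.
  rewrite ler_pdivrMr ?mul1r ?lerDl ?mass_ge0//.
  by rewrite lt_neqAle eq_sym T0 addr_ge0 ?mass_ge0.
case/andP: w01 => w0 w1.
by rewrite /label_law adde_ge0// mule_ge0// lee_fin ?subr_ge0.
Qed.

Lemma measurable_latent_weight (l : I -> 'I_3) (B : I -> set Theta) :
  (forall i, measurable (B i)) ->
  measurable_fun setT (fun w => \prod_i (fine (crm (N (l i)) w (B i)) /
     (mass N (own i) w + mass N ord0 w))).
Proof.
move=> mB; apply: measurable_fin_prod => i; apply: measurable_funM.
  exact: measurable_fine_crm.
have -> : (fun w => (mass N (own i) w + mass N ord0 w)^-1) =
    (fun w => (mass N (own i) w + mass N ord0 w) `^ (- 1)).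
  by apply/funext => w; rewrite powR_inv1// addr_ge0 ?mass_ge0.
by apply: (measurableT_comp (f := @powR R ^~ (- 1))) => //; exact: measurable_total.
Qed.

(** Conditioning on the labels gives the factors [mu_l(B) / mu_l(Theta)], conditioning on the
    measures gives the label weights [mu_l(Theta)] over the total; the mass of [mu_l] cancels. *)
Lemma latent_prob (l : I -> 'I_3) (B : I -> set Theta) :
  (forall i, l i = ord0 \/ l i = own i) -> (forall i, measurable (B i)) ->
  P ([set w | forall i, zeta i w = l i] `&` \bigcap_(i in [set: I]) (theta i @^-1` B i)) =
  (\int[P]_w (\prod_i (fine (crm (N (l i)) w (B i)) /
     (mass N (own i) w + mass N ord0 w)))%:E)%E.
Proof.
move=> lP mB; pose F w := \prod_i (fine (crm (N (l i)) w (B i)) / mass N (l i) w).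
have F0 w : 0 <= F w.
  by apply: prodr_ge0 => i _; rewrite divr_ge0 ?mass_ge0 ?fine_crm_ge0.
have mFG : measurable_fun (setT : set (g_sigma_algebraType crm_events)) F.
  apply: measurable_fin_prod => i; apply: measurable_funM.
    exact: measurable_crm_events.
  have -> : (fun w => (mass N (l i) w)^-1) = (fun w => mass N (l i) w `^ (- 1)).
    by apply/funext => w; rewrite powR_inv1// mass_ge0.
  apply: (measurableT_comp (f := @powR R ^~ (- 1))) => //.
  exact: measurable_crm_events.
have GT : <<s crm_events >> `<=` @measurable _ Omega.
  by apply: sub_sigma_measurable; exact: crm_events_measurable.
have mF : measurable_fun setT F.
  by move=> _ U mU; rewrite setTI; apply: GT; rewrite -[X in <<s _ >> X]setTI; exact: mFG.
have GF t : <<s crm_events >> [set w | t < F w].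
  have := measurable_fun_ltr (measurable_cst t) mFG measurableT (Y := [set true]).
  by rewrite setTI => h; apply: h.
have eqL : [set w | forall i, zeta i w = l i] =
    \bigcap_(i in [set: I]) (zeta i @^-1` [set l i]).
  by apply/seteqP; split => [w h i _|w h i]; [exact: h|exact: (h i)].
rewrite thetaP.2//; last exact: label_set.
transitivity (\int[P]_(w in [set w | forall i, zeta i w = l i]) (F w)%:E)%E.
  apply: eq_integral => w /set_mem /= lw; rewrite /normalized_crm prodEFin.
  by congr EFin; apply: eq_bigr => i _; rewrite lw.
have mL : measurable_fun setT (fun w => \prod_i label_law N i w [set l i])%E.
  have -> : (fun w => \prod_i label_law N i w [set l i])%E =
      (fun w => (\prod_i fine (label_law N i w [set l i]))%:E).
    by apply/funext => w; rewrite -prodEFin; apply: eq_bigr => i _; rewrite fineK.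
  apply/measurable_EFinP; apply: measurable_fin_prod => i.
  apply: (measurableT_comp (@fine_measurable R _ measurableT)) => _ U mU.
  by rewrite setTI; apply: GT; exact: zetaP.1.
rewrite eqL (cond_laws_integral GT zetaP)//; last exact: label_law_ge0.
apply: ge0_ae_eq_integral => //.
- by apply: emeasurable_funM => //; exact/measurable_EFinP.
- by apply/measurable_EFinP; exact: measurable_latent_weight.
- by move=> w _; rewrite mule_ge0 ?lee_fin//; apply: prode_ge0 => i _; exact: label_law_ge0.
- move=> w _; rewrite lee_fin; apply: prodr_ge0 => i _.
  by rewrite divr_ge0 ?fine_crm_ge0 ?addr_ge0 ?mass_ge0.
have := label_law_ae lP; have := mass_gt0_ae sigma01 c0 z01 gmN.
apply: filterS2 => w hm hl _.
rewrite (eq_bigr _ (fun i _ => hl i)).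
rewrite prodEFin -EFinM; congr EFin; rewrite mulrC /F -big_split/=.
apply: eq_bigr => i _; rewrite mulrA divfK// gt_eqF//.
exact: (hm _).1.
Qed.

Lemma cluster_prob k (cl : I -> 'I_k) (lb : 'I_k -> 'I_3) (A : 'I_k -> set Theta) :
  (0 < n1)%N -> (0 < n2)%N ->
  (forall i, lb (cl i) = ord0 \/ lb (cl i) = own i) ->
  (forall r, measurable (A r)) -> trivIset setT A ->
  ((Gamma n1%:R * Gamma n2%:R)%:E *
    P ([set w | forall i, zeta i w = lb (cl i)] `&`
      \bigcap_(i in [set: I]) (theta i @^-1` A (cl i))) =
  \int[@lebesgue_measure R]_(u in `]0%R, +oo[) \int[@lebesgue_measure R]_(v in `]0%R, +oo[)
    (levelfun sigma c z n1 n2 lb (fun r => #|[pred i | cl i == r]|)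
       (fun r => fine (P0 (A r))) u v)%:E)%E.
Proof.
move=> n10 n20 lP mA tA; rewrite latent_prob//.
rewrite -(gm_moment sigma01 c0 z01 gmN lb _ n10 n20 mA tA).
have G0 n : (0 < n)%N -> (0 <= Gamma n%:R :> R) by move=> n0; rewrite ltW// Gamma_gt0// ltr0n.
rewrite -ge0_integralZl//; last 3 first.
- by apply/measurable_EFinP; exact: measurable_latent_weight.
- move=> w _; rewrite lee_fin; apply: prodr_ge0 => i _.
  by rewrite divr_ge0 ?fine_crm_ge0 ?addr_ge0 ?mass_ge0.
- by rewrite lee_fin mulr_ge0// G0.
apply: eq_integral => w _; rewrite -EFinM; congr EFin.
rewrite prodf_div (partition_big cl xpredT)//=.
have -> : \prod_(j < k) \prod_(i | cl i == j) fine (crm (N (lb (cl i))) w (A (cl i))) =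
    \prod_r fine (crm (N (lb r)) w (A r)) ^+ #|[pred i | cl i == r]|.
  apply: eq_bigr => r _; rewrite -prodr_const; apply: eq_bigr => i /eqP -> //.
rewrite big_sumType/= /own /= !big_const_ord !iter_mulr_1.
by rewrite /total1 /total2 invfM; ring.
Qed.

End latent.

(** * The limit over finer and finer partitions *)

Section sum_injective.
Context {R : realFieldType}.

(** Expanding the product gives [2 ^ size s] terms. Each of them except the product of the [x r] has
    a factor [S], and since [S <= 1] and [x r <= G r] it is at most [S] times the product of the
    [G r]. *)
Lemma prod_add_le (T : Type) (s : seq T) (x G : T -> R) (S : R) : 0 <= S <= 1 ->
  (forall r, 0 <= x r <= G r) ->
  \prod_(r <- s) (x r + S * G r) <=
    \prod_(r <- s) x r + S * (2 ^+ size s - 1) * \prod_(r <- s) G r.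
Proof.
move=> /andP[S0 S1] xG.
have x0 r : 0 <= x r by case/andP: (xG r).
have G0 r : 0 <= G r by case/andP: (xG r) => h; exact: le_trans.
elim: s => [|r s IH]; first by rewrite !big_nil expr0 subrr mulr0 mul0r addr0.
rewrite !big_cons/= exprS.
set A := \prod_(j <- s) (x j + S * G j) in IH *.
set X := \prod_(j <- s) x j in IH *; set H := \prod_(j <- s) G j in IH *.
set t := 2 ^+ size s in IH *.
have X0 : 0 <= X by apply: prodr_ge0.
have H0 : 0 <= H by apply: prodr_ge0.
have XH : X <= H by apply: ler_prod => j _; exact: xG.
have t1 : 0 <= t - 1 by rewrite subr_ge0 exprn_ege1// ler1n.
have AH : A <= t * H.
  apply: le_trans IH _; rewrite -[leRHS]mul1r.
  have : S * (t - 1) * H <= (t - 1) * H by rewrite ler_wpM2r// ler_piMl.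
  lra.
case/andP: (xG r) => xr xGr.
have h1 : x r * A <= x r * (X + S * (t - 1) * H) by rewrite ler_wpM2l.
have h2 : S * G r * A <= S * G r * (t * H) by rewrite ler_wpM2l// mulr_ge0.
have h3 : x r * (S * (t - 1) * H) <= G r * (S * (t - 1) * H).
  by rewrite ler_wpM2r// !mulr_ge0.
rewrite mulrDl; apply: le_trans (lerD h1 h2) _.
rewrite mulrDr -addrA lerD2l; apply: le_trans (lerD h3 (lexx _)) _.
by rewrite le_eqVlt; apply/orP; left; apply/eqP; ring.
Qed.

Variables (C : finType) (p : C -> R).
Hypotheses (p0 : forall x, 0 <= p x) (p1 : \sum_x p x = 1).
Let S := \sum_x p x ^+ 2.

Lemma sum_square01 : 0 <= S <= 1.
Proof.
have px x : p x <= 1 by rewrite -p1 (bigD1 x)//= lerDl; apply: sumr_ge0.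
rewrite sumr_ge0/=; last by move=> x _; exact: exprn_ge0.
by rewrite -p1; apply: ler_sum => x _; rewrite expr2 ler_piMl.
Qed.

(** For independent draws with law [p], the probability that the draws [r] and [s] coincide. Summing
    over the common value [x] makes the sum factor: the indices [r] and [s] give [p x] each, the
    others give 1. *)
Lemma sum_coincide k (r s : 'I_k) : r != s ->
  \sum_(c : {ffun 'I_k -> C} | c r == c s) \prod_t p (c t) = S.
Proof.
move=> rs; pose f x t y := p y * (if (t == r) || (t == s) then (y == x)%:R else 1).
transitivity (\sum_x \prod_t \sum_y f x t y).
  under [RHS]eq_bigr do rewrite bigA_distr_bigA/=.
  rewrite exchange_big/= big_mkcond; apply: eq_bigr => c _.
  have e x : \prod_t f x t (c t) = (\prod_t p (c t)) *
      \prod_t (if (t == r) || (t == s) then (c t == x)%:R else 1).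
    by rewrite -big_split.
  under [RHS]eq_bigr do rewrite e.
  rewrite -mulr_sumr.
  have -> : \sum_x \prod_t (if (t == r) || (t == s) then (c t == x)%:R else 1) =
      (c r == c s)%:R :> R.
    under eq_bigr => x _.
      rewrite -big_mkcond/= (bigD1 r) ?eqxx//= (bigD1 s) ?eqxx ?orbT 1?eq_sym//=.
      rewrite big1 ?mulr1; last by move=> t /andP[/andP[/orP[] -> //]]; rewrite ?andbF.
      over.
    rewrite /= (bigD1 (c r))//= eqxx mul1r big1 ?addr0 1?eq_sym// => x xr.
    by rewrite (negbTE xr) mul0r.
  by case: eqP => _; rewrite ?mulr1 ?mulr0.
apply: eq_bigr => x _; rewrite (bigD1 r)//= (bigD1 s) ?(eq_sym s)//= /f.
have e : \sum_y p y * (y == x)%:R = p x.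
  by rewrite (bigD1 x)//= eqxx mulr1 big1 ?addr0// => y /negbTE ->; rewrite mulr0.
rewrite eqxx /= e eqxx orbT e big1 ?mulr1// => t /andP[/negbTE -> /negbTE ->].
by under eq_bigr do rewrite mulr1.
Qed.

(** Union bound over the ordered pairs of distinct indices, of which there are at most [k ^ 2]. *)
Lemma sum_noninjective k :
  \sum_(c : {ffun 'I_k -> C} | ~~ injectiveb c) \prod_t p (c t) <= (k ^ 2)%:R * S.
Proof.
have P0 (c : {ffun 'I_k -> C}) : 0 <= \prod_t p (c t) by apply: prodr_ge0.
apply: (@le_trans _ _ (\sum_(c : {ffun 'I_k -> C}) \sum_(u : 'I_k * 'I_k | u.1 != u.2)
    (if c u.1 == c u.2 then \prod_t p (c t) else 0))).
  rewrite big_mkcond; apply: ler_sum => c _; case: ifP => [|_]; last first.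
    by apply: sumr_ge0 => u _; case: ifP.
  move=> /injectivePn[r [s rs crs]]; rewrite (bigD1 (r, s))//= crs eqxx lerDl.
  by apply: sumr_ge0 => u _; case: ifP.
rewrite exchange_big/=.
under eq_bigr => u us do rewrite -big_mkcond/= sum_coincide//.
rewrite sumr_const -[S *+ _]mulr_natl ler_wpM2r//; first by case/andP: sum_square01.
by rewrite ler_nat; apply: leq_trans (max_card _) _; rewrite card_prod card_ord mulnn.
Qed.

(** The sum over all assignments of cells factors. For the lower bound the noninjective ones are
    removed at the cost given by [sum_noninjective]; for the upper bound they are kept and
    [prod_add_le] expands the product. *)
Lemma sum_injective_bounds k (y : 'I_k -> C -> R) (x G : 'I_k -> R) :
  (forall r, 0 <= x r <= G r) ->
  (forall r c, 0 <= y r c <= p c * G r) ->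
  (forall r, x r <= \sum_c y r c <= x r + S * G r) ->
  \prod_r x r <= \sum_(c : {ffun 'I_k -> C} | injectiveb c) \prod_r y r (c r) +
    (k ^ 2)%:R * S * \prod_r G r /\
  \sum_(c : {ffun 'I_k -> C} | injectiveb c) \prod_r y r (c r) <=
    \prod_r x r + 2 ^+ k * S * \prod_r G r.
Proof.
move=> xG yG ys.
have G0 r : 0 <= G r by case/andP: (xG r) => h; exact: le_trans.
have G0' : 0 <= \prod_r G r by apply: prodr_ge0.
have y0 r c : 0 <= y r c by case/andP: (yG r c).
have all_sum : \sum_(c : {ffun 'I_k -> C}) \prod_r y r (c r) = \prod_r \sum_c y r c.
  by rewrite bigA_distr_bigA.
have S01 := sum_square01; case/andP: (S01) => S0 S1; split.
  apply: (@le_trans _ _ (\prod_r \sum_c y r c)).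
    apply: ler_prod => r _; case/andP: (ys r) => -> _.
    by case/andP: (xG r) => ->.
  rewrite -all_sum (bigID (fun c : {ffun 'I_k -> C} => injectiveb c))/= lerD2l.
  apply: (@le_trans _ _ (\sum_(c : {ffun 'I_k -> C} | ~~ injectiveb c)
      (\prod_t p (c t)) * \prod_r G r)).
    apply: ler_sum => c _; rewrite -big_split/=; apply: ler_prod => r _.
    exact: yG.
  by rewrite -mulr_suml ler_wpM2r// sum_noninjective.
apply: (@le_trans _ _ (\prod_r \sum_c y r c)).
  rewrite -all_sum [leRHS](bigID (fun c : {ffun 'I_k -> C} => injectiveb c))/= lerDl.
  by apply: sumr_ge0 => c _; apply: prodr_ge0.
apply: (@le_trans _ _ (\prod_r (x r + S * G r))).
  apply: ler_prod => r _; case/andP: (ys r) => _ ->.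
  by rewrite sumr_ge0.
apply: le_trans (prod_add_le _ S01 xG) _; rewrite lerD2l ler_wpM2r//.
rewrite mulrC ler_wpM2r// /index_enum -enumT size_enum_ord.
by rewrite lerBlDr lerDl.
Qed.

End sum_injective.

Section mompoly_bounds.
Context {R : realType}.
Variables (sigma : R) (n : nat) (a x : R).
Hypotheses (sigma01 : 0 < sigma < 1) (n_gt0 : (0 < n)%N) (a0 : 0 <= a).
Let lead := momcoef sigma n 1 * a * x `^ (sigma - n%:R).

Let term_ge0 j : 0 <= momcoef sigma n j * a ^+ j * x `^ (j%:R * sigma - n%:R).
Proof. by rewrite !mulr_ge0 ?powR_ge0 ?momcoef_ge0 ?exprn_ge0. Qed.

Let mompolyE q : mompoly sigma n (a * q) x =
  \sum_(j < n.+1) q ^+ j * (momcoef sigma n j * a ^+ j * x `^ (j%:R * sigma - n%:R)).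
Proof. by rewrite /mompoly; apply: eq_bigr => j _; rewrite exprMn; ring. Qed.

Let mompolyS q : mompoly sigma n (a * q) x = q * lead +
  \sum_(j < n.-1) q ^+ j.+2 * (momcoef sigma n j.+2 * a ^+ j.+2 * x `^ (j.+2%:R * sigma - n%:R)).
Proof.
rewrite mompolyE /lead; case: n n_gt0 => // n' _.
rewrite 2!big_ord_recl (_ : momcoef sigma n'.+1 (ord0 : 'I_n'.+2) = 0); last exact: momcoefS0.
by rewrite !mul0r mulr0 add0r [(lift _ _ : nat)%:R * sigma]mul1r.
Qed.

(** As [n > 0] there is no constant term, so each monomial has [q ^ j <= q <= p]. In the application
    [q] is the mass of the part of a cell inside the target set and [p] that of the whole cell. *)
Lemma mompoly_le q p : 0 <= q <= p -> p <= 1 ->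
  mompoly sigma n (a * q) x <= p * mompoly sigma n a x.
Proof.
case/andP=> q0 qp p1; have q1 : q <= 1 by exact: le_trans p1.
have l0 : 0 <= lead by rewrite !mulr_ge0 ?momcoef_ge0 ?powR_ge0.
rewrite -[a in leRHS]mulr1 !mompolyS mulrDr mul1r; apply: lerD.
  by rewrite ler_wpM2r.
rewrite mulr_sumr; apply: ler_sum => j _; rewrite expr1n mul1r ler_wpM2r ?term_ge0//.
by rewrite exprS; apply: le_trans qp; rewrite ler_piMr// exprn_ile1.
Qed.

(** The terms other than the linear one have degree at least 2, hence a factor at most [p ^+ 2];
    summed over the cells this produces the concentration. *)
Lemma mompoly_lead q p : 0 <= q <= p -> p <= 1 ->
  q * lead <= mompoly sigma n (a * q) x <= q * lead + p ^+ 2 * mompoly sigma n a x.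
Proof.
case/andP=> q0 qp p1; have q1 : q <= 1 by exact: le_trans p1.
have l0 : 0 <= lead by rewrite !mulr_ge0 ?momcoef_ge0 ?powR_ge0.
have p0 : 0 <= p by exact: le_trans qp.
rewrite mompolyS lerDl; apply/andP; split.
  by apply: sumr_ge0 => j _; rewrite mulr_ge0 ?exprn_ge0 ?term_ge0.
rewrite lerD2l -[a in leRHS]mulr1 mompolyS mulrDr -[leLHS]add0r lerD//.
  by rewrite mul1r mulr_ge0 ?exprn_ge0.
rewrite mulr_sumr; apply: ler_sum => j _; rewrite expr1n mul1r ler_wpM2r ?term_ge0//.
rewrite -addn2 exprD; apply: (@le_trans _ _ (q ^+ 2)).
  by rewrite ler_piMl ?exprn_ge0 ?exprn_ile1.
by rewrite ler_pXn2r ?nnegrE.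
Qed.

Lemma mompoly_lead_le : lead <= mompoly sigma n a x.
Proof.
have := @mompoly_lead 1 1; rewrite ler01 lexx mul1r mulr1 => /(_ isT isT).
by case/andP.
Qed.

(** The degree is at most [n] and [p <= 1]. This lets the masses be pulled out of [levelfun] when
    its finiteness is proved. *)
Lemma mompoly_lower p : 0 <= p <= 1 ->
  p ^+ n * mompoly sigma n a x <= mompoly sigma n (a * p) x.
Proof.
case/andP=> p0 p1; rewrite -[a in leLHS]mulr1 !mompolyE mulr_sumr.
apply: ler_sum => j _; rewrite expr1n mul1r ler_wpM2r ?term_ge0//.
by rewrite ler_wiXn2l// -ltnS.
Qed.

End mompoly_bounds.

(** * Cells of a separating family and their concentration *)

Section cells.
Context d (T : measurableType d) (R : realType) (P0 : probability T R).
Variable U : nat -> set T.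
Hypothesis mU : forall j, measurable (U j).
Hypothesis sepU : forall x y, (forall j, U j x <-> U j y) -> x = y.
Hypothesis P0x : forall x, P0 [set x] = 0%E.

(** The cells are the atoms of the algebra generated by the first [m] sets [U j]. They are indexed
    by all boolean vectors, so some may be empty. *)
Definition cell_code m (x : T) : {ffun 'I_m -> bool} := [ffun j => x \in U (nat_of_ord j)].

Definition cell m (c : {ffun 'I_m -> bool}) : set T := [set x | cell_code m x = c].

Lemma measurable_point (x : T) : measurable [set x].
Proof.
have -> : [set x] = \bigcap_j (if x \in U j then U j else ~` U j).
  apply/seteqP; split => [_ -> j _|y h].
    by case: ifPn => [/set_mem//|]; rewrite notin_setE.
  by apply: sepU => j; have := h j I; case: ifPn => [/set_mem //|];
     rewrite notin_setE /setC /=; tauto.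
by apply: bigcapT_measurable => j; case: ifP => _ //; exact: measurableC.
Qed.

Lemma cell_code_eq m x y : (cell_code m x = cell_code m y) <->
  (forall j, (j < m)%N -> (U j x <-> U j y)).
Proof.
split=> [/ffunP h j jm|h].
  have := h (Ordinal jm); rewrite !ffunE /= => e.
  by split=> /mem_set; [rewrite e|rewrite -e] => /set_mem.
apply/ffunP => j; rewrite !ffunE; apply/idP/idP => /set_mem Ux; apply/mem_set;
  exact/h.
Qed.

Lemma cell_code_separates x y : x <> y ->
  exists M, forall m, (M <= m)%N -> cell_code m x <> cell_code m y.
Proof.
move=> xy; have [j Uj] : exists j, ~ (U j x <-> U j y).
  by apply: contrapT => h; apply: xy; apply: sepU => j; apply: contrapT => h';
     apply: h; exists j.
by exists j.+1 => m jm /cell_code_eq h; apply: Uj; exact: h.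
Qed.

Lemma measurable_cell m (c : {ffun 'I_m -> bool}) : measurable (cell c).
Proof.
have -> : cell c = \bigcap_(j in [set: 'I_m]) (if c j then U j else ~` U j).
  apply/seteqP; split => [x <- j _|x h].
    by rewrite ffunE; case: ifPn => [/set_mem//|]; rewrite notin_setE.
  apply/ffunP => j; rewrite ffunE; have := h j I; case: (c j) => [/mem_set//|].
  by move/mem_set; rewrite in_setC => /negbTE.
apply: fin_bigcap_measurable; first exact: finite_finset.
by move=> j _; case: ifP => _ //; exact: measurableC.
Qed.

Lemma trivIset_cell m : trivIset setT (@cell m).
Proof.
apply/trivIsetP => c c' _ _ cc'; rewrite -subset0 /cell => x [/= cx cx'].
by move: cc'; rewrite -cx -cx' eqxx.
Qed.

Lemma bigcup_cell m : \bigcup_c @cell m c = setT.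
Proof. by apply/seteqP; split => // x _; exists (cell_code m x). Qed.

Lemma sum_cell m (B : set T) : measurable B ->
  \sum_c fine (P0 (B `&` @cell m c)) = fine (P0 B).
Proof.
move=> mB; rewrite sum_fine; last first.
  by move=> c _; rewrite fin_num_measure//; exact: measurableI (measurable_cell _).
have mBc c : measurable (B `&` @cell m c) by exact: measurableI (measurable_cell _).
have tBc : trivIset setT (fun c => B `&` @cell m c).
  apply/trivIsetP => c c' _ _ cc'.
  move/trivIsetP : (@trivIset_cell m) => /(_ c c' I I cc') h.
  by rewrite setIACA h setI0.
by rewrite -(measure_finbigcup P0 mBc tBc) -setI_bigcupr bigcup_cell setIT.
Qed.

Definition concentration m : R := \sum_c fine (P0 (@cell m c)) ^+ 2.

(** The concentration is the probability that two independent draws from [P0] fall in the same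
    cell. *)
Lemma concentrationE m :
  (P0 \x P0)%E [set u : T * T | cell_code m u.1 = cell_code m u.2] = (concentration m)%:E.
Proof.
have -> : [set u : T * T | cell_code m u.1 = cell_code m u.2] = \bigcup_c (cell c `*` @cell m c).
  apply/seteqP; split => [[x y] /= xy|[x y] [c _ [/= <- ->]]//].
  by exists (cell_code m x).
have mX (c : {ffun 'I_m -> bool}) : measurable (cell c `*` cell c).
  by apply: measurableX; exact: measurable_cell.
rewrite (measure_finbigcup (P0 \x P0)%E mX).
  rewrite /concentration -sumEFin; apply: eq_bigr => c _.
  transitivity (P0 (cell c) * P0 (cell c))%E.
    by apply: product_measure1E; exact: measurable_cell.
  by rewrite expr2 EFinM fineK// fin_num_measure//; exact: measurable_cell.
apply/trivIsetP => c c' _ _ cc'; rewrite -subset0 => -[x y] [[/= h _] [h' _]].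
by move: cc'; rewrite -h -h' eqxx.
Qed.

(** The events of [concentrationE] decrease with [m] to the diagonal, because the [U j] separate
    points; each section of the diagonal is a point, of mass 0. *)
Lemma cvg_concentration : concentration m @[m --> \oo] --> (0 : R).
Proof.
pose F m := [set u : T * T | cell_code m u.1 = cell_code m u.2].
have mF m : measurable (F m).
  have -> : F m = \bigcup_c (cell c `*` @cell m c).
    apply/seteqP; split => [[x y] /= xy|[x y] [c _ [/= h1 h2]]].
      by exists (cell_code m x).
    by rewrite /F /= h1 h2.
  by apply: fin_bigcup_measurable => [|c _]; [exact: finite_finset|
     apply: measurableX; exact: measurable_cell].
have mcF : measurable (\bigcap_m F m) by exact: bigcapT_measurable.
have cF0 : (P0 \x P0)%E (\bigcap_m F m) = 0%E.
  rewrite [LHS]/(product_measure1 P0 P0 _) /product_measure1 integral0_eq// => x _.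
  apply/eqP; rewrite eq_le measure_ge0 andbT -(P0x x); apply: le_measure.
  - by apply/mem_set; exact: measurable_xsection.
  - by apply/mem_set; exact: measurable_point.
  - move=> y; rewrite /xsection /= => /set_mem h; apply/esym/sepU => j.
    by have := h j.+1 I; rewrite /F /= => /cell_code_eq; exact.
have ndF : nonincreasing_seq F.
  by move=> m m' mm'; rewrite subsetEset => u /cell_code_eq h; apply/cell_code_eq => j jm;
    apply: h; exact: leq_trans mm'.
have e : (EFin \o concentration) = (P0 \x P0)%E \o F.
  by apply/funext => m; exact/esym/concentrationE.
have h : (EFin \o concentration) m @[m --> \oo] --> (P0 \x P0)%E (\bigcap_m F m).
  rewrite e; apply: nonincreasing_cvg_mu => //.
  by apply: (@le_lt_trans _ _ (concentration 0)%:E); rewrite ?ltry// -concentrationE.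
by rewrite cF0 in h; exact: (fine_cvg h).
Qed.

End cells.

Section level_bounds.
Context {R : realType}.
Local Notation leb := (@lebesgue_measure R).
Local Notation pos := (`]0%R, +oo[%classic : set R).
Variables (sigma c z : R).
Hypotheses (sigma01 : 0 < sigma < 1) (c0 : 0 < c) (z01 : 0 < z < 1).
Variables (k n1 n2 : nat) (lb : 'I_k -> 'I_3) (m : 'I_k -> nat).
Hypothesis m_gt0 : forall r, (0 < m r)%N.
Local Notation a := (gm_rate c z).
Local Notation levelfun := (levelfun sigma c z n1 n2 lb m).

(** [levelfun] with each polynomial reduced to its linear term. It is multilinear in [p], which is
    why it survives refinement unchanged. *)
Definition leadfun (p : 'I_k -> R) (u v : R) : R :=
  weightfun sigma c z n1 n2 u v *
  \prod_r (p r * (momcoef sigma (m r) 1 * a (lb r) *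
     lvar u v (lb r) `^ (sigma - (m r)%:R))).

Lemma measurable_weightfun :
  measurable_fun setT (fun x : R * R => weightfun sigma c z n1 n2 x.1 x.2).
Proof.
apply: measurable_funM.
  by apply: measurable_funM; exact: measurable_powR_comp.
by apply: measurable_expRN; apply: measurable_funM => //; exact: measurable_psi12.
Qed.

Lemma measurable_lvar j : measurable_fun setT (fun x : R * R => lvar x.1 x.2 j).
Proof. rewrite /lvar; case: (j == ord0); first exact: measurable_funD.
case: (j == inord 1); [exact: measurable_fst|exact: measurable_snd]. Qed.

Lemma measurable_levelfun p :
  measurable_fun setT (fun x : R * R => levelfun p x.1 x.2).
Proof.
apply: measurable_funM; first exact: measurable_weightfun.
apply: measurable_fin_prod => r; rewrite /mompoly.
apply: measurable_sum => j; apply: measurable_funM => //.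
exact: (measurable_powR_comp _ (measurable_lvar (lb r))).
Qed.

Lemma measurable_leadfun p :
  measurable_fun setT (fun x : R * R => leadfun p x.1 x.2).
Proof.
apply: measurable_funM; first exact: measurable_weightfun.
apply: measurable_fin_prod => r; apply: measurable_funM => //.
apply: measurable_funM => //.
exact: (measurable_powR_comp _ (measurable_lvar (lb r))).
Qed.

Lemma weightfun_ge0 u v : 0 <= weightfun sigma c z n1 n2 u v.
Proof. by rewrite !mulr_ge0 ?powR_ge0 ?expR_ge0. Qed.

Lemma levelfun_ge0 p u v : (forall r, 0 <= p r) -> 0 <= levelfun p u v.
Proof.
move=> p0; rewrite mulr_ge0 ?weightfun_ge0//; apply: prodr_ge0 => r _.
by apply: mompoly_ge0 => //; rewrite mulr_ge0// ltW// gm_rate_gt0.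
Qed.

Lemma leadfun_ge0 p u v : (forall r, 0 <= p r) -> 0 <= leadfun p u v.
Proof.
move=> p0; rewrite mulr_ge0 ?weightfun_ge0//; apply: prodr_ge0 => r _.
rewrite !mulr_ge0 ?powR_ge0 ?momcoef_ge0//.
by rewrite ltW// gm_rate_gt0.
Qed.

Definition int2 (f : R -> R -> R) : \bar R :=
  (\int[leb]_(u in pos) \int[leb]_(v in pos) (f u v)%:E)%E.

Lemma int2E (f : R -> R -> R) : measurable_fun setT (fun x : R * R => f x.1 x.2) ->
  (forall u v, 0 <= f u v) ->
  (int2 f = \int[leb \x leb]_(x in pos `*` pos) (f x.1 x.2)%:E)%E.
Proof.
move=> mf f0; have mpos : measurable pos by exact: measurable_itv.
have mpp : measurable (pos `*` pos) by exact: measurableX.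
rewrite integral_indicM fubini_tonelli1.
- rewrite /int2 integral_indicM; apply: eq_integral => u _; rewrite /fubini_F /=.
  rewrite integral_indicM -ge0_integralZr//.
  + by apply: eq_integral => v _; rewrite !indicE in_setX/= -mulnb natrM -!EFinM; congr EFin; ring.
  + apply: emeasurable_funM; last by apply/measurable_EFinP; exact: measurable_indic.
    apply/measurable_EFinP.
    exact: (measurableT_comp mf (pair1_measurable u)).
  + by move=> v _; rewrite mule_ge0// lee_fin.
- apply: emeasurable_funM; first exact/measurable_EFinP.
  by apply/measurable_EFinP; exact: measurable_indic.
- by move=> x; rewrite mule_ge0// lee_fin.
Qed.

Lemma int2_le (f g : R -> R -> R) : measurable_fun setT (fun x : R * R => f x.1 x.2) ->
  measurable_fun setT (fun x : R * R => g x.1 x.2) ->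
  (forall u v, 0 <= f u v <= g u v) -> (int2 f <= int2 g)%E.
Proof.
move=> mf mg fg; have f0 u v : 0 <= f u v by case/andP: (fg u v).
have g0 u v : 0 <= g u v by case/andP: (fg u v) => h; exact: le_trans.
rewrite !int2E//; have mpos : measurable pos by exact: measurable_itv.
apply: ge0_le_integral.
- exact: measurableX.
- by move=> x _; rewrite lee_fin.
- by apply/measurable_funTS/measurable_EFinP.
- by apply/measurable_funTS/measurable_EFinP.
- by move=> x _; rewrite lee_fin; case/andP: (fg x.1 x.2).
Qed.

Lemma int2DZ (f g : R -> R -> R) (K : R) : measurable_fun setT (fun x : R * R => f x.1 x.2) ->
  measurable_fun setT (fun x : R * R => g x.1 x.2) ->
  (forall u v, 0 <= f u v) -> (forall u v, 0 <= g u v) -> 0 <= K ->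
  (int2 (fun u v => (f u v + K * g u v)%R) = int2 f + K%:E * int2 g)%E.
Proof.
move=> mf mg f0 g0 K0; have mpos : measurable pos by exact: measurable_itv.
have mpp : measurable (pos `*` pos) by exact: measurableX.
rewrite !int2E//; last 2 first.
- by apply: measurable_funD => //; exact: measurable_funM.
- by move=> u v; rewrite addr_ge0 ?mulr_ge0.
rewrite -ge0_integralZl//; last 2 first.
- by apply/measurable_funTS/measurable_EFinP.
- by move=> x _; rewrite lee_fin.
rewrite -ge0_integralD//.
- by move=> x _; rewrite lee_fin.
- by apply/measurable_funTS/measurable_EFinP.
- by move=> x _; rewrite -EFinM lee_fin mulr_ge0.
- by apply/measurable_funTS/measurable_EFinP; exact: measurable_funM.
Qed.

Lemma int2_sum (T : finType) (Q : pred T) (f : T -> R -> R -> R) :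
  (forall t, measurable_fun setT (fun x : R * R => f t x.1 x.2)) ->
  (forall t u v, 0 <= f t u v) ->
  (int2 (fun u v => (\sum_(t | Q t) f t u v)%R) = \sum_(t | Q t) int2 (f t))%E.
Proof.
move=> mf f0; have mpos : measurable pos by exact: measurable_itv.
have mpp : measurable (pos `*` pos) by exact: measurableX.
rewrite int2E; last 2 first.
- under eq_fun do rewrite big_mkcond/=; apply: measurable_sum => t.
  by case: (Q t).
- by move=> u v; exact: sumr_ge0.
under eq_integral do rewrite -sumEFin big_mkcond/=.
rewrite [RHS]big_mkcond ge0_integral_sum//.
- apply: eq_bigr => t _; case: (Q t); first by rewrite int2E.
  by rewrite integral0.
- move=> t; case: (Q t) => //; apply: measurable_funTS.
  by apply/measurable_EFinP; exact: mf.
- by move=> t x _; case: (Q t) => //; rewrite lee_fin.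
Qed.

Lemma int2Z (f : R -> R -> R) (K : R) : measurable_fun setT (fun x : R * R => f x.1 x.2) ->
  (forall u v, 0 <= f u v) -> 0 <= K ->
  (int2 (fun u v => (K * f u v)%R) = K%:E * int2 f)%E.
Proof.
move=> mf f0 K0; have mpos : measurable pos by exact: measurable_itv.
have mpp : measurable (pos `*` pos) by exact: measurableX.
rewrite !int2E//; last 2 first.
- exact: measurable_funM.
- by move=> u v; rewrite mulr_ge0.
rewrite -ge0_integralZl//.
- by apply/measurable_funTS/measurable_EFinP.
- by move=> x _; rewrite lee_fin.
Qed.

Lemma levelfun_lower (p : 'I_k -> R) : (forall r, 0 <= p r <= 1) ->
  ((\prod_r p r ^+ m r)%:E * int2 (levelfun (fun=> 1%R)) <= int2 (levelfun p))%E.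
Proof.
move=> p01; have p0 r : 0 <= p r by case/andP: (p01 r).
have a0 r : 0 <= a (lb r) by rewrite ltW// gm_rate_gt0.
have pp0 : 0 <= \prod_r p r ^+ m r by apply: prodr_ge0 => r _; exact: exprn_ge0.
have mlev := measurable_levelfun.
have m1 := mlev (fun=> 1); have mp := mlev p.
have one0 u v : 0 <= levelfun (fun=> 1) u v by exact: levelfun_ge0.
rewrite -(int2Z m1 one0 pp0); apply: int2_le => //; first exact: measurable_funM.
move=> u v; rewrite mulr_ge0//= /levelfun mulrCA ler_wpM2l ?weightfun_ge0//.
rewrite -big_split/=; apply: ler_prod => r _.
by rewrite mulr1 mulr_ge0 ?exprn_ge0 ?mompoly_ge0//= mompoly_lower.
Qed.

Lemma int2_leadfun (p : 'I_k -> R) : (forall r, 0 <= p r) ->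
  (int2 (leadfun p) = (\prod_r p r)%:E * int2 (leadfun (fun=> 1%R)))%E.
Proof.
move=> p0; rewrite -int2Z.
- rewrite /int2; apply: eq_integral => u _; apply: eq_integral => v _; congr EFin.
  by rewrite /leadfun mulrCA -big_split/=; under [in RHS]eq_bigr do rewrite mul1r.
- exact: (measurable_leadfun (fun=> 1)).
- by move=> u v; exact: leadfun_ge0.
- exact: prodr_ge0.
Qed.

Lemma leadfun_levelfun : (int2 (leadfun (fun=> 1%R)) <= int2 (levelfun (fun=> 1%R)))%E.
Proof.
apply: int2_le => //; [exact: (measurable_leadfun (fun=> 1))|
  exact: (measurable_levelfun (fun=> 1))|move=> u v].
rewrite leadfun_ge0//= ler_wpM2l ?weightfun_ge0//; apply: ler_prod => r _.
have a0 : 0 <= a (lb r) by rewrite ltW// gm_rate_gt0.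
rewrite mul1r mulr1 mompoly_lead_le// andbT.
by rewrite !mulr_ge0 ?powR_ge0 ?momcoef_ge0.
Qed.

Variables (C : finType) (p : C -> R) (q : 'I_k -> C -> R).
Hypotheses (p0 : forall x, 0 <= p x) (p1 : \sum_x p x = 1).
Hypothesis qp : forall r x, 0 <= q r x <= p x.
Let S := \sum_x p x ^+ 2.
Let b r := \sum_x q r x.

(** [sum_injective_bounds] at a fixed point: [y] is the polynomial of a cell, [b r * L r] the sum of
    its linear parts over the cells, and [G] the polynomial at mass 1. *)
Lemma level_bounds u v :
  leadfun b u v <=
    \sum_(e : {ffun 'I_k -> C} | injectiveb e) levelfun (fun r => q r (e r)) u v +
    (k ^ 2)%:R * S * levelfun (fun=> 1) u v /\
  \sum_(e : {ffun 'I_k -> C} | injectiveb e) levelfun (fun r => q r (e r)) u v <=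
    leadfun b u v + 2 ^+ k * S * levelfun (fun=> 1) u v.
Proof.
pose y r x := mompoly sigma (m r) (a (lb r) * q r x) (lvar u v (lb r)).
pose G r := mompoly sigma (m r) (a (lb r) * 1) (lvar u v (lb r)).
pose L r := momcoef sigma (m r) 1 * a (lb r) * lvar u v (lb r) `^ (sigma - (m r)%:R).
have a0 r : 0 <= a (lb r) by rewrite ltW// gm_rate_gt0.
have px x : p x <= 1 by rewrite -p1 (bigD1 x)//= lerDl; apply: sumr_ge0.
have L0 r : 0 <= L r by rewrite !mulr_ge0 ?powR_ge0 ?momcoef_ge0.
have LG r : L r <= G r.
  by rewrite /G mulr1; exact: mompoly_lead_le.
have b01 r : 0 <= b r <= 1.
  rewrite /b sumr_ge0/=; last by move=> x _; case/andP: (qp r x).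
  by rewrite -p1; apply: ler_sum => x _; case/andP: (qp r x).
have H := @sum_injective_bounds R C p p0 p1 k y (fun r => b r * L r) G.
have [||| H1 H2] := H.
- move=> r; case/andP: (b01 r) => b0 b1; rewrite mulr_ge0//=.
  by apply: le_trans (LG r); rewrite ler_piMl.
- move=> r x; rewrite /y /G mulr1 mompoly_le// andbT mompoly_ge0//.
  by rewrite mulr_ge0//; case/andP: (qp r x).
- move=> r; rewrite /y /G mulr1 /b mulr_suml /S mulr_suml -big_split/=.
  apply/andP; split; apply: ler_sum => x _.
    by case/andP: (mompoly_lead (lvar u v (lb r)) sigma01 (m_gt0 r) (a0 r) (qp r x) (px x)).
  by case/andP: (mompoly_lead (lvar u v (lb r)) sigma01 (m_gt0 r) (a0 r) (qp r x) (px x)).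
have w0 := weightfun_ge0 u v.
rewrite /levelfun /leadfun -mulr_sumr !(mulrCA _ (weightfun _ _ _ _ _ _ _)) -!mulrDr.
by split; rewrite ler_wpM2l.
Qed.

Lemma level_bounds_int :
  (int2 (leadfun b) <=
    \sum_(e : {ffun 'I_k -> C} | injectiveb e) int2 (levelfun (fun r => q r (e r))) +
    ((k ^ 2)%:R * S)%:E * int2 (levelfun (fun=> 1%R)))%E /\
  (\sum_(e : {ffun 'I_k -> C} | injectiveb e) int2 (levelfun (fun r => q r (e r))) <=
    int2 (leadfun b) + (2 ^+ k * S)%:E * int2 (levelfun (fun=> 1%R)))%E.
Proof.
have q0 r x : 0 <= q r x by case/andP: (qp r x).
have b0 r : 0 <= b r by apply: sumr_ge0.
have S0 : 0 <= S by apply: sumr_ge0 => x _; rewrite exprn_ge0.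
have mlev := measurable_levelfun; have mlead := measurable_leadfun.
have lev0 : forall e : {ffun 'I_k -> C}, forall u v, 0 <= levelfun (fun r => q r (e r)) u v.
  by move=> e u v; exact: levelfun_ge0.
have one0 u v : 0 <= levelfun (fun=> 1) u v by exact: levelfun_ge0.
have lead0 u v : 0 <= leadfun b u v by exact: leadfun_ge0.
have msum : measurable_fun setT (fun x : R * R =>
    \sum_(e : {ffun 'I_k -> C} | injectiveb e) levelfun (fun r => q r (e r)) x.1 x.2).
  under eq_fun do rewrite big_mkcond/=; apply: measurable_sum => e.
  by case: (injectiveb e).
have sum0 u v : 0 <= \sum_(e : {ffun 'I_k -> C} | injectiveb e) levelfun (fun r => q r (e r)) u v.
  exact: sumr_ge0.
rewrite -int2_sum//.
have k2S : 0 <= (k ^ 2)%:R * S by rewrite mulr_ge0.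
have kS : 0 <= 2 ^+ k * S by rewrite mulr_ge0// exprn_ge0.
have m1 := mlev (fun=> 1); have mb := mlead b.
rewrite -(int2DZ msum m1 sum0 one0 k2S) -(int2DZ mb m1 lead0 one0 kS).
split; apply: int2_le => //.
- by apply: measurable_funD => //; apply: measurable_funM => //; exact: mlev.
- by move=> u v; rewrite lead0; case: (level_bounds u v).
- by apply: measurable_funD => //; apply: measurable_funM => //; exact: mlev.
- by move=> u v; rewrite sum0; case: (level_bounds u v).
Qed.

End level_bounds.

Section nonatomic.
Context d (T : measurableType d) (R : realType) (P0 : probability T R).
Hypothesis P0_nonatomic : nonatomic P0.

Lemma nonatomic_point x : measurable [set x] -> P0 [set x] = 0%E.
Proof.
move=> mx; apply/eqP; rewrite eq_le measure_ge0 andbT leNgt; apply/negP => x0.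
have [B [mB Bx] /andP[B0 Bltx]] := P0_nonatomic mx x0.
have [Bx'|nBx] := pselect (B x).
  have e : B = [set x] by apply/seteqP; split => // y ->.
  by move: Bltx; rewrite e ltxx.
have e : B = set0.
  by apply/seteqP; split => // y By; have := Bx _ By => /= yx; apply: nBx; rewrite -yx.
by move: B0; rewrite e measure0 ltxx.
Qed.

(** A subset [A'] of strictly intermediate mass leaves a remainder of positive mass, kept as one
    piece, and the recursion continues inside [A']. *)
Lemma nonatomic_split k (A : set T) : measurable A -> (0 < P0 A)%E ->
  exists B : 'I_k -> set T, [/\ forall r, measurable (B r), forall r, B r `<=` A,
    forall r, (0 < P0 (B r))%E & trivIset setT B].
Proof.
elim: k A => [|k IH] A mA A0.
  by exists (fun=> set0); split => [[]|[]|[]|]//; apply/trivIsetP => -[].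
have [A' [mA' A'A] /andP[A'0 A'ltA]] := P0_nonatomic mA A0.
have [B [mB BA' B0 tB]] := IH A' mA' A'0.
exists (fun r => if unlift ord0 r is Some s then B s else A `\` A'); split.
- by move=> r; case: unliftP => [s _|_] //; exact: measurableD.
- move=> r; case: unliftP => [s _|_] => [y /BA' /A'A//|y []//].
- move=> r; case: unliftP => [s _|_] //.
  rewrite lt_neqAle measure_ge0 andbT eq_sym; apply/eqP => h.
  have e : P0 A = (P0 (A `\` A') + P0 (A `&` A'))%E by exact: measureDI.
  rewrite h add0e in e.
  by move: A'ltA; rewrite e (setIidr A'A) ltxx.
- apply/trivIsetP => r s _ _.
  case: unliftP => [r' ->|->]; case: unliftP => [s' ->|->] rs.
  + move/trivIsetP : tB; apply => //; apply: contra rs => /eqP ->//.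
  + by rewrite -subset0 => y [/BA' h []].
  + by rewrite -subset0 => y [[_ h] /BA'].
  + by rewrite eqxx in rs.
Qed.

End nonatomic.

(** * The probability of a pattern of ties *)

Section partition_prob.
Context d (Omega : measurableType d) (R : realType) (P : probability Omega R).
Context d' (Theta : measurableType d') (P0 : probability Theta R).
Hypothesis P0_nonatomic : nonatomic P0.
Variable U : nat -> set Theta.
Hypothesis mU : forall j, measurable (U j).
Hypothesis sepU : forall x y, (forall j, U j x <-> U j y) -> x = y.
Variables (sigma c z : R).
Hypotheses (sigma01 : 0 < sigma < 1) (c0 : 0 < c) (z01 : 0 < z < 1).
Variable N : 'I_3 -> R.-ker Omega ~> (R * Theta)%type.
Hypothesis gmN : gm_dependent P c z (rho_stable sigma) P0 N.
Variables n1 n2 : nat.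
Hypotheses (n1_gt0 : (0 < n1)%N) (n2_gt0 : (0 < n2)%N).
Local Notation I := (sample_index n1 n2).
Variables (zeta : I -> {RV P >-> 'I_3}) (theta : I -> {RV P >-> Theta}).
Let crm_events := \bigcup_(j in [set: 'I_3]) rm_events (crm (N j)).
Let label_events := \bigcup_(i in [set: I]) rv_events (zeta i).
Hypothesis zetaP : cond_independent_laws P <<s crm_events >> zeta (label_law (n2 := n2) N).
Hypothesis thetaP : cond_independent_laws P <<s crm_events `|` label_events >>
  theta (fun i w B => normalized_crm N (zeta i w) w B).
Variables (k : nat) (cl : I -> 'I_k) (rep : 'I_k -> I) (lb : 'I_k -> 'I_3).
Hypotheses (repK : cancel rep cl).
Hypothesis lbP : forall i, lb (cl i) = ord0 \/ lb (cl i) = own i.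
Local Notation m := (fun r : 'I_k => #|[pred i | cl i == r]|).
Local Notation levelfun := (levelfun sigma c z n1 n2 lb m).
Local Notation leadfun := (leadfun sigma c z n1 n2 lb m).
Local Notation GG := (Gamma n1%:R * Gamma n2%:R : R).

Definition pattern (B : 'I_k -> set Theta) : set Omega :=
  [set w | [/\ forall i, zeta i w = lb (cl i), forall i, B (cl i) (theta i w) &
     forall i j, theta i w = theta j w <-> cl i = cl j]].

Definition level_pattern (B : 'I_k -> set Theta) n : set Omega :=
  [set w | [/\ forall i, zeta i w = lb (cl i), forall i, B (cl i) (theta i w) &
     forall i j, cell_code U n (theta i w) = cell_code U n (theta j w) <-> cl i = cl j]].

Let m_gt0 r : (0 < m r)%N.
Proof. by apply/card_gt0P; exists (rep r); rewrite inE /= repK. Qed.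

Let GG_gt0 : 0 < GG.
Proof. by rewrite mulr_gt0// Gamma_gt0// ltr0n. Qed.

Let block (B : 'I_k -> set Theta) : set Omega :=
  [set w | forall i, zeta i w = lb (cl i)] `&`
      \bigcap_(i in [set: I]) (theta i @^-1` B (cl i)).

Let measurable_block (B : 'I_k -> set Theta) : (forall r, measurable (B r)) ->
  measurable (block B).
Proof.
move=> mB; apply: measurableI.
  have -> : [set w | forall i, zeta i w = lb (cl i)] =
      \bigcap_(i in [set: I]) (zeta i @^-1` [set lb (cl i)]).
    by apply/seteqP; split => [w h i _|w h i]; [exact: h|exact: (h i)].
  apply: fin_bigcap_measurable => [|i _]; first exact: finite_finset.
  by rewrite -[X in measurable X]setTI; exact: measurable_funP.
apply: fin_bigcap_measurable => [|i _]; first exact: finite_finset.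
by rewrite -[X in measurable X]setTI; exact: measurable_funP.
Qed.

(** The cells of the clusters form an assignment [e], and distinct clusters lie in distinct cells
    exactly when [e] is injective. The pieces fix the labels and ask only in which sets the values
    lie, so [cluster_prob] computes their probabilities. *)
Lemma level_pattern_bigcup B n : level_pattern B n =
  \bigcup_(e : {ffun 'I_k -> {ffun 'I_n -> bool}})
    (if injectiveb e then block (fun r => B r `&` cell U (e r)) else set0).
Proof.
apply/seteqP; split => [w [wz wB wc]|w [e _]].
  exists [ffun r => cell_code U n (theta (rep r) w)] => //; case: ifPn => [_|].
    split => // i _; split; first exact: wB.
    by rewrite /cell /= ffunE; apply/wc; rewrite repK.
  move=> /injectivePn[r [s /eqP rs]]; rewrite !ffunE => /wc; rewrite !repK.
  by move=> h; case: rs.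
case: ifPn => [/injectiveP inj|_ []]; move=> [wz wB]; split => //.
  by move=> i; case: (wB i Logic.I).
move=> i j; have [_] := wB i Logic.I; have [_] := wB j Logic.I; rewrite /cell /= => -> ->.
by split=> [/inj|->].
Qed.

Let trivIset_blocks B n : trivIset setT
  (fun e : {ffun 'I_k -> {ffun 'I_n -> bool}} =>
    if injectiveb e then block (fun r => B r `&` cell U (e r)) else set0).
Proof.
apply/trivIsetP => e e' _ _ /eqP ee'; rewrite -subset0 => w [].
case: ifP => // _ [_ h]; case: ifP => // _ [_ h'].
apply: ee'; apply/ffunP => r.
by have [_] := h (rep r) Logic.I; have [_] := h' (rep r) Logic.I; rewrite /cell /= repK => -> ->.
Qed.

Lemma measurable_level_pattern B n : (forall r, measurable (B r)) ->
  measurable (level_pattern B n).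
Proof.
move=> mB; rewrite level_pattern_bigcup.
apply: fin_bigcup_measurable => [|e _]; first exact: finite_finset.
case: ifP => // _; apply: measurable_block => r.
exact: measurableI (measurable_cell mU _).
Qed.

Lemma level_pattern_prob B n : (forall r, measurable (B r)) ->
  (GG%:E * P (level_pattern B n) =
   \sum_(e : {ffun 'I_k -> {ffun 'I_n -> bool}} | injectiveb e)
      int2 (levelfun (fun r => fine (P0 (B r `&` cell U (e r))))))%E.
Proof.
move=> mB; have mBc (e : {ffun 'I_k -> {ffun 'I_n -> bool}}) r :
    measurable (B r `&` cell U (e r)).
  exact: measurableI (measurable_cell mU _).
rewrite level_pattern_bigcup (measure_finbigcup P _ (@trivIset_blocks B n)); last first.
  by move=> e; case: ifP => // _; exact: measurable_block.
rewrite ge0_sume_distrr// [RHS]big_mkcond; apply: eq_bigr => e _.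
case: ifP => [/injectiveP inj|_]; last by rewrite measure0 mule0.
apply: (cluster_prob sigma01 c0 z01 gmN zetaP thetaP) => //.
apply/trivIsetP => r s _ _ rs; have ers : e r != e s.
  by apply: contra rs => /eqP /inj ->.
move/trivIsetP : (@trivIset_cell _ _ U n) => /(_ _ _ Logic.I Logic.I ers) h.
by rewrite setIACA h setI0.
Qed.

(** At a fixed [w] only finitely many pairs of values have to be separated, and each is from some
    level on. *)
Lemma near_level_pattern B w :
  \forall n \near \oo, level_pattern B n w <-> pattern B w.
Proof.
have h i j : \forall n \near \oo,
    (cell_code U n (theta i w) = cell_code U n (theta j w)) <-> theta i w = theta j w.
  have [->|ij] := pselect (theta i w = theta j w); first by near=> n.
  have [M hM] := cell_code_separates sepU ij.
  near=> n; split => // h; exfalso; apply: (hM n) => //.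
  by near: n; exact: nbhs_infty_ge.
have {}h : \forall n \near \oo, forall u : I * I,
    (cell_code U n (theta u.1 w) = cell_code U n (theta u.2 w)) <-> theta u.1 w = theta u.2 w.
  exact: filter_forall.
apply: filterS h => n h; split => -[wz wB wc]; split => // i j.
  by rewrite -(h (i, j)); exact: wc.
by rewrite (h (i, j)); exact: wc.
Unshelve. all: by end_near. Qed.

(** In [n] the events are not monotone, since refinement separates different clusters but may also
    split one; the limit is therefore written as a lower limit. *)
Lemma measurable_pattern B : (forall r, measurable (B r)) -> measurable (pattern B).
Proof.
move=> mB.
have -> : pattern B = \bigcup_M \bigcap_(n in [set n | (M <= n)%N]) level_pattern B n.
  apply/seteqP; split => [w Bw|w [M _ h]].
    have [M _ hM] := near_level_pattern B w.
    by exists M => // n /= Mn; apply/(hM n).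
  have [M' _ hM'] := near_level_pattern B w.
  by apply/(hM' (maxn M M')) => /=; [exact: leq_maxr|apply: h => /=; exact: leq_maxl].
apply: bigcupT_measurable => M; apply: bigcap_measurable => [|n _].
  by exists M => /=.
exact: measurable_level_pattern.
Qed.

Lemma cvg_level_pattern B : (forall r, measurable (B r)) ->
  fine (P (level_pattern B n)) @[n --> \oo] --> fine (P (pattern B)).
Proof.
move=> mB; have mE := measurable_pattern mB.
have mEn n := measurable_level_pattern n mB.
have h w : (\1_(level_pattern B n) w)%:E @[n --> \oo] --> ((\1_(pattern B) w)%:E : \bar R).
  apply: cvg_near_cst; apply: filterS (near_level_pattern B w) => n e.
  by congr (_%:R)%:E; congr nat_of_bool; apply/idP/idP => /set_mem/e/mem_set.
have mi n : measurable_fun setT (fun w => (\1_(level_pattern B n) w)%:E : \bar R).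
  by apply/measurable_EFinP; exact: measurable_indic.
have mi' : measurable_fun setT (fun w => (\1_(pattern B) w)%:E : \bar R).
  by apply/measurable_EFinP; exact: measurable_indic.
have i1 : P.-integrable setT (EFin \o cst (1 : R)) by exact: finite_measure_integrable_cst.
have [||_ _] := dominated_convergence measurableT mi mi' _ i1.
- by apply: aeW => w _; exact: h.
- apply: aeW => w n _ /=; rewrite indicE lee_fin ger0_norm// lern1.
  by case: (_ \in _).
rewrite integral_indic// setIT.
under eq_fun do rewrite integral_indic// setIT.
by move=> cv; apply: fine_cvg; rewrite fineK ?fin_num_measure.
Qed.

(** For disjoint [A r] of positive mass the integral of [levelfun p] is [GG] times the probability
    of a block, so at most [GG], and [levelfun_lower] compares it with the integral at mass 1. *)
Lemma levelfun_lty : (int2 (levelfun (fun=> 1%R)) < +oo)%E.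
Proof.
have P01 : (0 < P0 setT)%E by rewrite probability_setT.
have [A [mA _ A0 tA]] := nonatomic_split P0_nonatomic k measurableT P01.
pose p r := fine (P0 (A r)).
have p0 r : 0 < p r by rewrite fine_gt0// A0/= ltey_eq fin_num_measure.
have p1 r : p r <= 1 by rewrite -lee_fin fineK ?fin_num_measure// probability_le1.
have p01 r : 0 <= p r <= 1 by rewrite p1 ltW.
have pp : 0 < \prod_r p r ^+ m r by apply: prodr_gt0 => r _; rewrite exprn_gt0.
have h : (int2 (levelfun p) <= GG%:E)%E.
  rewrite /int2 -(cluster_prob sigma01 c0 z01 gmN zetaP thetaP)//.
  rewrite -[leRHS]mule1 lee_pmul2l// ?lte_fin//; apply: probability_le1.
  exact: measurable_block.
have := le_trans (levelfun_lower sigma01 c0 z01 n1 n2 lb _ p01) h.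
have one0 : (0 <= int2 (levelfun (fun=> 1%R)))%E.
  by do 2 apply: integral_ge0 => ? _; rewrite lee_fin levelfun_ge0.
case: (int2 (levelfun (fun=> 1%R))) one0 => [r _ _|_|//]; first exact: ltry.
by rewrite gt0_muley ?lte_fin.
Qed.

(** At every level the two sides differ by at most a constant times [concentration * M]. As [M] is
    finite, this tends to 0. *)
Lemma pattern_prob B : (forall r, measurable (B r)) ->
  (GG%:E * P (pattern B) = int2 (leadfun (fun r => fine (P0 (B r)))))%E.
Proof.
move=> mB; have P0x x : P0 [set x] = 0%E.
  exact/(nonatomic_point P0_nonatomic)/(measurable_point mU sepU).
have mE := measurable_pattern mB.
have mEn n := measurable_level_pattern n mB.
have L0 : (0 <= int2 (leadfun (fun r => fine (P0 (B r)))))%E.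
  by do 2 apply: integral_ge0 => ? _; rewrite lee_fin leadfun_ge0// => r; exact: fine_ge0.
have M0 : (0 <= int2 (levelfun (fun=> 1%R)))%E.
  by do 2 apply: integral_ge0 => ? _; rewrite lee_fin levelfun_ge0.
have Mfin : int2 (levelfun (fun=> 1%R)) \is a fin_num by rewrite ge0_fin_numE// levelfun_lty.
pose M := fine (int2 (levelfun (fun=> 1%R))).
have bounds n : (int2 (leadfun (fun r => fine (P0 (B r)))) <=
      GG%:E * P (level_pattern B n) + ((k ^ 2)%:R * concentration P0 U n * M)%:E)%E /\
    (GG%:E * P (level_pattern B n) <=
      int2 (leadfun (fun r => fine (P0 (B r)))) + (2 ^+ k * concentration P0 U n * M)%:E)%E.
  pose q r (x : {ffun 'I_n -> bool}) := fine (P0 (B r `&` cell U x)).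
  have mc x : measurable (@cell _ _ U n x) by exact: measurable_cell.
  have q01 r x : 0 <= q r x <= fine (P0 (cell U x)).
    rewrite fine_ge0//= fine_le ?fin_num_measure//; first exact: measurableI.
    by apply: le_measure; [exact/mem_set/measurableI|exact/mem_set|move=> y []].
  have p1 : \sum_x fine (P0 (@cell _ _ U n x)) = 1.
    have := sum_cell P0 mU n measurableT; rewrite probability_setT/= => <-.
    by apply: eq_bigr => x _; rewrite setTI.
  have cell0 x : 0 <= fine (P0 (@cell _ _ U n x)) by exact: fine_ge0.
  have := level_bounds_int sigma01 c0 z01 n1 n2 lb m_gt0 cell0 p1 q01.
  (* Summed over the cells, the masses restore that of [B r], so the main term of the bounds is the
     same at all levels. *)
  have -> : (fun r => \sum_x q r x) = (fun r => fine (P0 (B r))).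
    by apply/funext => r; exact: sum_cell.
  by rewrite -/(int2 _) level_pattern_prob// !EFinM fineK.
have Lfin : int2 (leadfun (fun r => fine (P0 (B r)))) \is a fin_num.
  rewrite (ge0_fin_numE L0); apply: le_lt_trans (bounds 0).1 _.
  by rewrite -(@fineK _ (P _)) ?fin_num_measure// -EFinM -EFinD ltry.
have cS : concentration P0 U n @[n --> \oo] --> (0 : R) by exact: cvg_concentration.
have cP := cvg_level_pattern mB.
have cG : GG * fine (P (level_pattern B n)) @[n --> \oo] --> GG * fine (P (pattern B)).
  exact: cvgM (cvg_cst _) cP.
have cC K : K * concentration P0 U n * M @[n --> \oo] --> (0 : R).
  rewrite -[X in _ --> X](mul0r M) -[X in X * M](mulr0 K).
  by apply: cvgM (cvg_cst _); apply: cvgM cS; exact: cvg_cst.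
rewrite -(@fineK _ (P (pattern B))) ?fin_num_measure//.
rewrite -(fineK Lfin) -EFinM; congr EFin; apply/eqP; rewrite eq_le; apply/andP; split.
- have := ler_cvg_to cG (cvgD (cvg_cst (fine (int2 (leadfun (fun r => fine (P0 (B r)))))))
    (cC (2 ^+ k))).
  rewrite addr0; apply; near=> n.
  rewrite -lee_fin EFinD (fineK Lfin) EFinM fineK ?fin_num_measure//.
  exact: (bounds n).2.
- have := ler_cvg_to (cvg_cst (fine (int2 (leadfun (fun r => fine (P0 (B r)))))))
    (cvgD cG (cC (k ^ 2)%:R)).
  rewrite addr0; apply; near=> n.
  rewrite -lee_fin EFinD (fineK Lfin) EFinM fineK ?fin_num_measure//.
  exact: (bounds n).1.
Unshelve. all: by end_near. Qed.

End partition_prob.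

(** * The integral over the angular variable *)

Section leadfun_integral.
Context {R : realType}.
Local Notation leb := (@lebesgue_measure R).
Variables (sigma c z : R).
Hypotheses (sigma01 : 0 < sigma < 1) (c0 : 0 < c) (z01 : 0 < z < 1).
Variables (k n1 n2 : nat) (lb : 'I_k -> 'I_3) (m : 'I_k -> nat).
Hypotheses (k_gt0 : (0 < k)%N) (m_gt0 : forall r, (0 < m r)%N).
Hypothesis sum_m : (\sum_r m r = n1 + n2)%N.
Let count j := #|[pred r | lb r == j]|.
Let size j := (\sum_(r | lb r == j) m r)%N.
Let expo j : R := \sum_(r | lb r == j) (sigma - (m r)%:R).

Lemma prod_powR (T : finType) (Q : pred T) (t : R) (x : T -> R) : 0 < t ->
  \prod_(r | Q r) t `^ x r = t `^ (\sum_(r | Q r) x r).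
Proof.
move=> t0; apply: (big_rec2 (fun p q => p = t `^ q)); first by rewrite powRr0.
by move=> r p q _ ->; rewrite powRD//; apply/implyP => _; rewrite gt_eqF.
Qed.

Let expoE j : expo j = (count j)%:R * sigma - (size j)%:R.
Proof.
by rewrite /expo sumrB sumr_const -[sigma *+ _]mulr_natl natr_sum.
Qed.

Let count3 : (count ord0 + count (inord 1) + count (inord 2) = k)%N.
Proof.
have e j : count j = (\sum_(r | lb r == j) 1)%N by rewrite sum1_card.
transitivity (\sum_(r < k) 1)%N; last by rewrite sum1_card card_ord.
rewrite (partition_big lb xpredT)//= !big_ord_recl big_ord0 addn0 !e addnA.
by congr (_ + _ + _)%N; apply: eq_bigl => r; congr (_ == _); apply/val_inj; rewrite /= inordK.
Qed.

Let size3 : (size ord0 + size (inord 1) + size (inord 2) = n1 + n2)%N.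
Proof.
rewrite -sum_m (partition_big lb xpredT)//= !big_ord_recl big_ord0 addn0 addnA.
by congr (_ + _ + _)%N; apply: eq_bigl => r; congr (_ == _); apply/val_inj; rewrite /= inordK.
Qed.

Lemma prod_gm_rate : \prod_r gm_rate c z (lb r) =
  c ^+ k * (z ^+ (count (inord 1) + count (inord 2)) *
    (1 - z) ^+ (k - count (inord 1) - count (inord 2))).
Proof.
rewrite (partition_big lb xpredT)//=.
under eq_bigr => j _.
  under eq_bigr => r /eqP -> do [].
  rewrite prodr_const -/(count j).
  over.
rewrite prod_ord3 gm_rate0 gm_rate1 gm_rate2.
have -> : (k - count (inord 1) - count (inord 2))%N = count ord0 by rewrite -count3 subnAC !addnK.
rewrite -[in c ^+ k]count3 !exprMn !exprD; ring.
Qed.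

Lemma prod_momcoef : \prod_r momcoef sigma (m r) 1 =
  sigma ^+ k * \prod_r rising (1 - sigma) (m r - 1).
Proof.
under eq_bigr => r _ do rewrite -{1}(prednK (m_gt0 r)) momcoefS1// -subn1.
by rewrite big_split/= prodr_const card_ord.
Qed.

Lemma prod_lvar u v : 0 < u -> 0 < v ->
  \prod_r lvar u v (lb r) `^ (sigma - (m r)%:R) =
  (u + v) `^ expo ord0 * u `^ expo (inord 1) * v `^ expo (inord 2).
Proof.
move=> u0 v0; rewrite (partition_big lb xpredT)//=.
have e j : \prod_(r | lb r == j) lvar u v (lb r) `^ (sigma - (m r)%:R) =
    lvar u v j `^ expo j.
  by rewrite -(prod_powR _ _ (lvar_gt0 j u0 v0)); apply: eq_bigr => r /eqP ->.
by rewrite (eq_bigr _ (fun j _ => e j)) prod_ord3 lvar0 lvar1 lvar2.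
Qed.

(** The cluster sizes add up to [n1 + n2], so the exponents satisfy the relation
    [a + b + e = k sigma] required by [integral_radial]. The [c ^+ k] of the rates cancels the power
    of [c] from the radial integral, and the division by [sigma] there turns [sigma ^+ k] into
    [sigma ^+ (k - 1)]. *)
Lemma int2_leadfun1 :
  (int2 (leadfun sigma c z n1 n2 lb m (fun=> 1%R)) =
   (z ^+ (count (inord 1) + count (inord 2)) *
     (1 - z) ^+ (k - count (inord 1) - count (inord 2)) *
     sigma ^+ (k - 1) * Gamma k%:R * \prod_r rising (1 - sigma) (m r - 1))%:E *
   \int[leb]_(w in `]0%R, 1%R[)
    (w `^ (n1%:R - (size (inord 1))%:R + (count (inord 1))%:R * sigma - 1) *
     (1 - w) `^ (n2%:R - (size (inord 2))%:R + (count (inord 2))%:R * sigma - 1) /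
     (1 - z + z * w `^ sigma + z * (1 - w) `^ sigma) ^+ k)%:E)%E.
Proof.
case/andP: (sigma01) => s0 s1; case/andP: (z01) => z0 z1.
pose a : R := n1%:R + expo (inord 1); pose b : R := n2%:R + expo (inord 2).
pose e := expo ord0; pose C0 := \prod_r (momcoef sigma (m r) 1 * gm_rate c z (lb r)).
have C00 : 0 <= C0.
  apply: prodr_ge0 => r _; rewrite mulr_ge0 ?momcoef_ge0//.
  by rewrite ltW// gm_rate_gt0.
have k0 : 0 < k%:R :> R by rewrite ltr0n.
have abe : a + b + e = k%:R * sigma.
  rewrite /a /b /e !expoE -count3.
  have /(congr1 (fun n => n%:R : R)) := size3; rewrite !natrD => h.
  by lra.
transitivity (int2 (fun u v => C0 * radial_fun c z sigma a b e u v)).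
  apply: eq_integral => u /set_mem; rewrite /= in_itv/= andbT => u0.
  apply: eq_integral => v /set_mem; rewrite /= in_itv/= andbT => v0; congr EFin.
  rewrite /leadfun /weightfun; under eq_bigr do rewrite mul1r.
  rewrite big_split/= -/C0 prod_lvar// /radial_fun /a /b /e.
  have -> : n1%:R + expo (inord 1) - 1 = (n1%:R - 1) + expo (inord 1) by ring.
  have -> : n2%:R + expo (inord 2) - 1 = (n2%:R - 1) + expo (inord 2) by ring.
  have un0 (x y : R) : (x + y == 0) ==> (u != 0) by rewrite (gt_eqF u0) implybT.
  have vn0 (x y : R) : (x + y == 0) ==> (v != 0) by rewrite (gt_eqF v0) implybT.
  by rewrite (powRD (un0 (n1%:R - 1) _)) (powRD (vn0 (n2%:R - 1) _)); ring.
rewrite int2Z//; last 2 first.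
- exact: measurable_radial_fun.
- by move=> u v; exact: radial_fun_ge0.
rewrite /int2 (integral_radial c0 z01 s0 k0 abe) muleA -EFinM.
have -> : C0 * (Gamma k%:R / sigma * c `^ (- k%:R)) =
    z ^+ (count (inord 1) + count (inord 2)) *
     (1 - z) ^+ (k - count (inord 1) - count (inord 2)) *
     sigma ^+ (k - 1) * Gamma k%:R * \prod_r rising (1 - sigma) (m r - 1).
  rewrite /C0 big_split/= prod_momcoef prod_gm_rate powRN powR_mulrn ?(ltW c0)//.
  have -> : sigma ^+ k = sigma ^+ (k - 1) * sigma by rewrite -exprSr subn1 prednK.
  by field; rewrite !gt_eqF ?exprn_gt0.
apply: (congr1 (mule _)); apply: eq_integral => w /set_mem; rewrite /= in_itv/= => /andP[w0 w1].
have w10 : 0 < 1 - w by rewrite subr_gt0.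
congr EFin; rewrite powRN powR_mulrn; last first.
  by rewrite ltW// psi12_gt0.
have -> : psi12 z sigma w (1 - w) = 1 - z + z * w `^ sigma + z * (1 - w) `^ sigma.
  by rewrite /psi12 (addrC w) subrK powR1; ring.
congr (_ * _ / _); congr (_ `^ _); rewrite /a /b expoE; ring.
Qed.

End leadfun_integral.

(** * Product laws and the joint density *)

Section boxes.
Context d (T : measurableType d) (R : realType).

Definition box n (A : 'I_n -> set T) : set (n.-tuple T) :=
  [set t | forall i, A i (tnth t i)].

Lemma measurable_box n (A : 'I_n -> set T) : (forall i, measurable (A i)) ->
  measurable (box A).
Proof.
move=> mA; have -> : box A = \bigcap_(i in [set: 'I_n]) (@tnth _ T ^~ i @^-1` A i).
  by apply/seteqP; split => [t At i _|t At i]; [exact: At|exact: (At i)].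
apply: fin_bigcap_measurable => [|i _]; first exact: finite_finset.
by rewrite -[X in measurable X]setTI; exact: measurable_tnth.
Qed.

Lemma boxI n (A B : 'I_n -> set T) : box A `&` box B = box (fun i => A i `&` B i).
Proof.
apply/seteqP; split => [t [At Bt] i|t h]; first by split; [exact: At|exact: Bt].
by split=> i; case: (h i).
Qed.

Lemma box_setT n : box (fun=> setT) = [set: n.-tuple T].
Proof. by apply/seteqP; split. Qed.

Lemma box_coord n (i : 'I_n) (B : set T) :
  box (fun j => if j == i then B else setT) = (@tnth _ T)^~ i @^-1` B.
Proof.
apply/seteqP; split => [t /(_ i)|t Bt j]; first by rewrite eqxx.
by case: eqP => [->|].
Qed.

(** Boxes are stable under intersection and contain the preimages of measurable sets by each
    coordinate, hence generate the sigma-algebra of tuples. *)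
Lemma tuple_measure_unique n (m1 m2 : {measure set (n.-tuple T) -> \bar R}) :
  (m1 setT < +oo)%E ->
  (forall A : 'I_n -> set T, (forall i, measurable (A i)) -> m1 (box A) = m2 (box A)) ->
  forall D, measurable D -> m1 D = m2 D.
Proof.
move=> m1oo m12.
pose G := [set D | exists2 A : 'I_n -> set T, forall i, measurable (A i) & D = box A].
have GT : G setT by exists (fun=> setT) => //; rewrite box_setT.
apply: (measure_unique G (fun=> setT)) => //.
- apply/seteqP; split => [D mD|]; last first.
    apply: smallest_sub; first exact: sigma_algebra_measurable.
    by move=> _ [A mA ->]; exact: measurable_box.
  have : measurable_fun (setT : set (g_sigma_algebraType G)) (id : _ -> n.-tuple T).
    apply/measurable_fun_tnthP => i _ B mB; rewrite setTI.
    apply: sub_sigma_algebra; exists (fun j => if j == i then B else setT).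
      by move=> j; case: ifP.
    by rewrite box_coord.
  by move=> /(_ measurableT _ mD); rewrite setTI.
- move=> _ _ [A mA ->] [B mB ->]; exists (fun i => A i `&` B i); last exact: boxI.
  by move=> i; exact: measurableI.
- by apply/seteqP; split => // x _; exists 0%N.
- by move=> _ [A mA ->]; exact: m12.
Qed.

Context d' (S : measurableType d').

(** Boxes for the two samples match the product form of the conditional laws. The third factor may
    be any measurable set, since the law of the distinct values is determined beforehand. *)
Lemma triple_measure_unique n1 n2 k
    (m1 m2 : {measure set (n1.-tuple T * n2.-tuple T * k.-tuple S) -> \bar R}) :
  (m1 setT < +oo)%E ->
  (forall (A : 'I_n1 -> set T) (B : 'I_n2 -> set T) (C : set (k.-tuple S)),
     (forall i, measurable (A i)) -> (forall i, measurable (B i)) -> measurable C ->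
     m1 (box A `*` box B `*` C) = m2 (box A `*` box B `*` C)) ->
  forall D, measurable D -> m1 D = m2 D.
Proof.
move=> m1oo m12.
pose G := [set D | exists A : 'I_n1 -> set T, exists B : 'I_n2 -> set T,
  exists C : set (k.-tuple S), [/\ forall i, measurable (A i),
    forall i, measurable (B i), measurable C & D = box A `*` box B `*` C]].
have GT : G setT.
  by exists (fun=> setT), (fun=> setT), setT; split => //; rewrite !box_setT !setXTT.
apply: (measure_unique G (fun=> setT)) => //.
- apply/seteqP; split => [D mD|]; last first.
    apply: smallest_sub; first exact: sigma_algebra_measurable.
    move=> _ [A [B [C [mA mB mC ->]]]].
    by do 2 apply: measurableX => //; exact: measurable_box.
  have : measurable_fun (setT : set (g_sigma_algebraType G))
      (id : _ -> (n1.-tuple T * n2.-tuple T * k.-tuple S)%type).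
    apply/measurable_fun_pairP; split; first apply/measurable_fun_pairP; first split.
    - apply/measurable_fun_tnthP => i _ B mB; rewrite setTI; apply: sub_sigma_algebra.
      exists (fun j => if j == i then B else setT), (fun=> setT), setT; split => //.
        by move=> j; case: ifP.
      by rewrite box_coord box_setT; apply/seteqP; split => [[[x y] t]|[[x y] t] [[]]].
    - apply/measurable_fun_tnthP => i _ B mB; rewrite setTI; apply: sub_sigma_algebra.
      exists (fun=> setT), (fun j => if j == i then B else setT), setT; split => //.
        by move=> j; case: ifP.
      by rewrite box_coord box_setT; apply/seteqP; split => [[[x y] t]|[[x y] t] [[]]].
    - move=> _ C mC; rewrite setTI; apply: sub_sigma_algebra.
      exists (fun=> setT), (fun=> setT), C; split => //.
      by rewrite !box_setT; apply/seteqP; split => [[[x y] t]|[[x y] t] [[]]].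
  by move=> /(_ measurableT _ mD); rewrite setTI.
- move=> _ _ [A [B [C [mA mB mC ->]]]] [A' [B' [C' [mA' mB' mC' ->]]]].
  exists (fun i => A i `&` A' i), (fun i => B i `&` B' i), (C `&` C'); split.
  + by move=> i; exact: measurableI.
  + by move=> i; exact: measurableI.
  + exact: measurableI.
  + by rewrite -!boxI !setXI.
- by apply/seteqP; split => // x _; exists 0%N.
- by move=> _ [A [B [C [mA mB mC ->]]]]; exact: m12.
Qed.

Local Open Scope ereal_scope.

Lemma integral_power_prod (mu : {sigma_finite_measure set T -> \bar R}) n
    (f : 'I_n -> T -> R) :
  (forall i, measurable_fun setT (f i)) -> (forall i x, (0 <= f i x)%R) ->
  \int[power_measure mu n]_t (\prod_i f i (tnth t i))%:E =
  \prod_i \int[mu]_x (f i x)%:E.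
Proof.
elim: n f => [|n IH] f mf f0.
  rewrite big_ord0 /=; under eq_integral do rewrite big_ord0.
  by rewrite integral_dirac// diracT mul1e.
have mp m (g : 'I_m -> T -> R) : (forall i, measurable_fun setT (g i)) ->
    measurable_fun setT (fun t : m.-tuple T => \prod_i g i (tnth t i))%R.
  move=> mg; apply: measurable_fin_prod => i.
  by apply: measurableT_comp => //; exact: measurable_tnth.
rewrite big_ord_recl -IH//.
transitivity (\int[mu \x power_measure mu n]_u
    (\prod_i f i (tnth (tuple_cons u) i))%:E).
  rewrite -(ge0_integral_pushforward (measurable_tuple_cons (n := n)) _ measurableT
    (f := fun t => (\prod_i f i (tnth t i))%:E)) ?preimage_setT//.
  - by apply/measurable_EFinP; exact: mp.
  - by move=> t _; rewrite lee_fin; apply: prodr_ge0 => i _.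
have e u : (\prod_i f i (tnth (tuple_cons u) i) =
    f ord0 u.1 * \prod_i f (lift ord0 i) (tnth u.2 i))%R.
  by rewrite big_ord_recl; congr (_ * _)%R; apply: eq_bigr => i _; rewrite tnthS.
have p0 (t : n.-tuple T) : (0 <= \prod_i f (lift ord0 i) (tnth t i))%R.
  by apply: prodr_ge0.
have mpl := mp n (fun i => f (lift ord0 i)) (fun i => mf _).
under eq_integral do rewrite e.
rewrite fubini_tonelli1/=; last 2 first.
- apply/measurable_EFinP; apply: measurable_funM; first exact: measurableT_comp.
  exact: (measurableT_comp mpl measurable_snd).
- by move=> u; rewrite lee_fin mulr_ge0.
rewrite -ge0_integralZr//.
- apply: eq_integral => x _; rewrite /fubini_F/=.
  under eq_integral do rewrite EFinM.
  rewrite ge0_integralZl//; first exact/measurable_EFinP.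
  + by move=> t _; rewrite lee_fin.
  + by rewrite lee_fin.
- exact/measurable_EFinP.
- by move=> x _; rewrite lee_fin.
- by apply: integral_ge0 => t _; rewrite lee_fin.
Qed.

End boxes.

Lemma indic_box d (T : measurableType d) (R : realType) n (A : 'I_n -> set T) t :
  \1_(box A) t = \prod_i \1_(A i) (tnth t i) :> R.
Proof.
rewrite indicE; have [/set_mem tA|tA] := boolP (t \in box A).
  by rewrite big1// => i _; rewrite indicE mem_set//; exact: tA.
suff [i ni] : exists i, ~ A i (tnth t i).
  by rewrite (bigD1 i)//= indicE memNset// mul0r.
by apply: contrapT => nex; move/negP: tA; apply; apply/mem_set => i;
   apply: contrapT => ni; apply: nex; exists i.
Qed.

Lemma integral_prod2 d1 d2 (T1 : measurableType d1) (T2 : measurableType d2)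
    (R : realType) (m1 : {sigma_finite_measure set T1 -> \bar R})
    (m2 : {sigma_finite_measure set T2 -> \bar R}) (f : T1 -> R) (g : T2 -> R) :
  measurable_fun setT f -> measurable_fun setT g ->
  (forall x, 0 <= f x) -> (forall y, 0 <= g y) ->
  (\int[m1 \x m2]_u (f u.1 * g u.2)%:E =
   \int[m1]_x (f x)%:E * \int[m2]_y (g y)%:E)%E.
Proof.
move=> mf mg f0 g0; rewrite fubini_tonelli1/=; last 2 first.
- by apply/measurable_EFinP; apply: measurable_funM; exact: measurableT_comp.
- by move=> u; rewrite lee_fin mulr_ge0.
rewrite -ge0_integralZr//.
- apply: eq_integral => x _; rewrite /fubini_F/=.
  under eq_integral do rewrite EFinM.
  rewrite ge0_integralZl//; first exact/measurable_EFinP.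
  + by move=> y _; rewrite lee_fin.
  + by rewrite lee_fin.
- exact/measurable_EFinP.
- by move=> x _; rewrite lee_fin.
- by apply: integral_ge0 => y _; rewrite lee_fin.
Qed.

Section fubini_triple.
Context d1 d2 d3 (T1 : measurableType d1) (T2 : measurableType d2)
  (T3 : measurableType d3) (R : realType).
Variables (m1 : {sigma_finite_measure set T1 -> \bar R})
  (m2 : {sigma_finite_measure set T2 -> \bar R})
  (m3 : {sigma_finite_measure set T3 -> \bar R}).

(** A name for the product of the first two measures, to which the sigma-finite structure demanded
    of the outer factors is attached. *)
Let m12 : set (T1 * T2) -> \bar R := (m1 \x m2)%E.

HB.instance Definition _ := Measure.copy m12 (m1 \x m2)%E.
HB.instance Definition _ :=
  Measure_isSigmaFinite.Build _ _ _ m12 (product_sigma_finite m1 m2).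

Lemma fubini_triple (f : T1 * T2 * T3 -> \bar R) :
  measurable_fun setT f -> (forall v, (0 <= f v)%E) ->
  (\int[m1 \x m2 \x m3]_v f v = \int[m3]_t \int[m1 \x m2]_u f (u, t))%E.
Proof. by move=> mf f0; exact: (@fubini_tonelli2 _ _ _ _ _ m12 m3 f mf f0). Qed.

End fubini_triple.

(** * The joint law of data, ties, values and labels *)

Section joint_law.
Context {R : realType} d1 (X : measurableType d1) d2 (Theta : measurableType d2).
Variable U : nat -> set Theta.
Hypothesis mU : forall j, measurable (U j).
Hypothesis sepU : forall x y, (forall j, U j x <-> U j y) -> x = y.
Variable H : {sigma_finite_measure set Theta -> \bar R}.
Variable P0 : probability Theta R.
Hypothesis P0_nonatomic : nonatomic P0.
Variable g0 : Theta -> R.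
Hypotheses (mg0 : measurable_fun setT g0) (g0_ge0 : forall t, 0 <= g0 t).
Hypothesis g0_density : forall B, measurable B -> P0 B = (\int[H]_(t in B) (g0 t)%:E)%E.
Variable lam : {sigma_finite_measure set X -> \bar R}.
Variable h : X -> Theta -> R.
Hypothesis mh : measurable_fun [set: (X * Theta)%type] (fun u => h u.1 u.2).
Hypothesis h_ge0 : forall x t, 0 <= h x t.
Hypothesis h_density : forall t, (\int[lam]_x (h x t)%:E = 1)%E.
Variables (sigma c z : R).
Hypotheses (sigma01 : 0 < sigma < 1) (c0 : 0 < c) (z01 : 0 < z < 1).
Variables n1 n2 : nat.
Hypotheses (n1_gt0 : (0 < n1)%N) (n2_gt0 : (0 < n2)%N).
Context d (Omega : measurableType d) (P : probability Omega R).
Variable N : 'I_3 -> R.-ker Omega ~> (R * Theta)%type.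
Hypothesis gmN : gm_dependent P c z (rho_stable sigma) P0 N.
Local Notation I := (sample_index n1 n2).
Variables (zeta : I -> {RV P >-> 'I_3}) (theta : I -> {RV P >-> Theta})
  (data : I -> {RV P >-> X}).
Hypothesis model : mixture_model N lam h zeta theta data.
Variable pi : {set {set I}}.
Hypothesis pi_partition : finset.partition pi [set: I]%SET.
Variable lab : {set I} -> 'I_3.
Hypothesis labP : label_config pi lab.

Local Notation k := #|pi|.
Local Notation cl := (cluster_index n1_gt0 pi_partition).
Local Notation rep := (cluster_rep (pi := pi) n1_gt0).
Local Notation lb := (fun r : 'I_k => lab (enum_val r)).
Local Notation pat := (pattern zeta theta cl lb).
Local Notation gmsi := (gm_stable_integral pi lab sigma z).
Local Notation m := (fun r : 'I_k => #|[pred i | cl i == r]|).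

Let repK : cancel rep cl. Proof. exact: cluster_repK. Qed.

Let m_gt0 r : (0 < m r)%N.
Proof. by apply/card_gt0P; exists (rep r); rewrite inE /= repK. Qed.

Let lbP i : lb (cl i) = ord0 \/ lb (cl i) = own i.
Proof. exact: lb_cases. Qed.

Definition mixture_const : R :=
  z ^+ (ktilde1 pi lab + ktilde2 pi lab) *
  (1 - z) ^+ (#|clusters1 pi| + #|clusters2 pi| + #|clusters0 pi| -
     ktilde1 pi lab - ktilde2 pi lab) * sigma ^+ (k - 1) * Gamma k%:R * xi pi sigma.

Local Notation GG := (Gamma n1%:R * Gamma n2%:R : R).

Let GG_gt0 : 0 < GG.
Proof. by rewrite mulr_gt0// Gamma_gt0// ltr0n. Qed.

Let int2_lead : (int2 (leadfun sigma c z n1 n2 lb m (fun=> 1%R)) =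
  mixture_const%:E * gmsi)%E.
Proof.
rewrite (int2_leadfun1 sigma01 c0 z01 lb (card_pi_gt0 n1_gt0 pi_partition) m_gt0
  (sum_card_cluster n1_gt0 pi_partition)).
rewrite (ktilde1E pi_partition labP) (ktilde2E pi_partition labP).
rewrite (nbar1E n1_gt0 pi_partition labP) (nbar2E n1_gt0 pi_partition labP).
by rewrite /mixture_const (card_clusters pi_partition) (xiE n1_gt0 pi_partition).
Qed.

Let mixture_const_gt0 : 0 < mixture_const.
Proof.
case/andP: sigma01 => s0 s1; case/andP: z01 => z0 z1.
rewrite /mixture_const (xiE n1_gt0 pi_partition).
rewrite !mulr_gt0 ?exprn_gt0 ?subr_gt0 ?Gamma_gt0 ?ltr0n//.
  exact: (card_pi_gt0 n1_gt0 pi_partition).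
apply: prodr_gt0 => r _.
by rewrite /rising divr_gt0// Gamma_gt0 ?subr_gt0// ltr_wpDr// subr_gt0.
Qed.

Let gmsi_ge0 : (0 <= gmsi)%E.
Proof.
case/andP: z01 => z0 z1; apply: integral_ge0 => w _; rewrite lee_fin.
rewrite divr_ge0 ?mulr_ge0 ?powR_ge0//; apply: exprn_ge0.
have zp x : 0 <= z * x `^ sigma by rewrite mulr_ge0 ?powR_ge0// ltW.
by apply: addr_ge0 (zp _); apply: addr_ge0 (zp _); rewrite subr_ge0 ltW.
Qed.

(** A positive multiple of the integral is the double integral of [leadfun], which is below that of
    [levelfun]; no estimate at the endpoints of []0, 1[] is involved. *)
Let gmsi_fin : gmsi \is a fin_num.
Proof.
rewrite ge0_fin_numE//.
have [zetaP thetaP _] := model.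
have := le_lt_trans (leadfun_levelfun sigma01 c0 z01 n1 n2 lb m_gt0)
  (levelfun_lty P0_nonatomic sigma01 c0 z01 gmN n1_gt0 n2_gt0 zetaP thetaP lbP).
rewrite int2_lead; move: gmsi gmsi_ge0 => [r _ _|_|//]; first exact: ltry.
by rewrite gt0_muley ?lte_fin.
Qed.

(** By [pattern_law] with all [B r] equal to the whole space, the probability of the given ties and
    labels. *)
Let K : R := mixture_const / GG * fine gmsi.

Let K_ge0 : 0 <= K.
Proof. by rewrite mulr_ge0 ?fine_ge0// divr_ge0// ltW. Qed.

Lemma pattern_law B : (forall r, measurable (B r)) ->
  P (pat B) = (K * \prod_r fine (P0 (B r)))%:E.
Proof.
move=> mB; have [zetaP thetaP _] := model.
have := pattern_prob P0_nonatomic mU sepU sigma01 c0 z01 gmN n1_gt0 n2_gt0 zetaP thetaP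
  repK lbP mB.
rewrite (int2_leadfun sigma01 c0 z01) ?int2_lead; last by move=> r; exact: fine_ge0.
rewrite -(fineK gmsi_fin) -(@fineK _ (P _)) ?fin_num_measure//; last first.
  exact: (measurable_pattern mU sepU).
rewrite -!EFinM => -[e]; congr EFin; apply: (mulfI (lt0r_neq0 GG_gt0)).
rewrite e /K; move: GG_gt0 mixture_const (fine gmsi) (\prod_r fine (P0 (B r))).
by move: GG => g gg0 a b p; field; exact: lt0r_neq0.
Qed.

Let E0 := pat (fun=> setT).

(** Read off the cluster representatives, so that it is a random variable on the whole space; it
    lists the common values only on [E0]. *)
Definition distinct_values (w : Omega) : k.-tuple Theta := [tuple theta (rep r) w | r < k].

Let mE0 : measurable E0.
Proof. exact: (measurable_pattern mU sepU). Qed.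

Let values w i : E0 w -> theta i w = tnth (distinct_values w) (cl i).
Proof. by move=> [_ _ wc]; rewrite tnth_mktuple; apply/wc; rewrite repK. Qed.

Lemma pattern_box (C : 'I_k -> set Theta) : pat C = E0 `&` distinct_values @^-1` box C.
Proof.
apply/seteqP; split => [w [wz wC wc]|w [Ew Cw]].
  split; first by split.
  by move=> r; rewrite tnth_mktuple -[r in C r]repK; exact: wC.
have [wz _ wc] := Ew; split => // i; rewrite (values i Ew); exact: Cw.
Qed.

Let mdistinct : measurable_fun setT distinct_values.
Proof.
apply/measurable_fun_tnthP => r.
have -> : (@tnth k Theta ^~ r) \o distinct_values = theta (rep r).
  by apply/funext => w; rewrite /= tnth_mktuple.
exact: measurable_funP.
Qed.

Let mind : measurable_fun setT (\1_E0 : Omega -> R). Proof. exact: measurable_indic. Qed.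
Let ind0 w : 0 <= (\1_E0 w : R). Proof. by []. Qed.

Let PE : {measure set Omega -> \bar R} := dens P mind ind0.

Let PE_E D : measurable D -> PE D = P (E0 `&` D).
Proof. by move=> mD; rewrite /PE /= /dens integral_indic. Qed.

Let value_density (t : k.-tuple Theta) : R := K * \prod_r g0 (tnth t r).

Let mvalue_density : measurable_fun setT value_density.
Proof.
apply: measurable_funM => //; apply: measurable_fin_prod => r.
by apply: measurableT_comp => //; exact: measurable_tnth.
Qed.

Let value_density_ge0 t : 0 <= value_density t.
Proof. by rewrite mulr_ge0//; apply: prodr_ge0. Qed.

(** On boxes [pattern_law] gives [K] times a product of [P0]-masses, which are integrals of [g0];
    boxes determine the law. *)
Lemma distinct_values_law (S : set (k.-tuple Theta)) : measurable S ->
  PE (distinct_values @^-1` S) = dens (power_measure H k) mvalue_density value_density_ge0 S.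
Proof.
apply: (tuple_measure_unique (m1 := pushforward_measure PE mdistinct)
   (m2 := dens (power_measure H k) mvalue_density value_density_ge0)).
  rewrite /= /pushforward preimage_setT PE_E// setIT.
  by apply: le_lt_trans (probability_le1 P mE0) (ltry _).
move=> C mC; rewrite /= /pushforward PE_E; last first.
  by rewrite -[X in measurable X]setTI; apply: mdistinct => //; exact: measurable_box.
rewrite -pattern_box pattern_law// /dens integral_indicM.
have e t : ((value_density t)%:E * (\1_(box C) t)%:E =
    K%:E * (\prod_r (g0 (tnth t r) * \1_(C r) (tnth t r)))%:E)%E.
  by rewrite -!EFinM indic_box /value_density -mulrA big_split.
under eq_integral do rewrite e.
rewrite ge0_integralZl//; last 2 first.
- apply/measurable_EFinP; apply: measurable_fin_prod => r.
  apply: (measurableT_comp (f := fun x => g0 x * \1_(C r) x)).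
    by apply: measurable_funM => //; exact: measurable_indic.
  exact: measurable_tnth.
- by move=> t _; rewrite lee_fin; apply: prodr_ge0 => r _; rewrite mulr_ge0.
rewrite (integral_power_prod H (f := fun r x => g0 x * \1_(C r) x)); last 2 first.
- by move=> r; apply: measurable_funM => //; exact: measurable_indic.
- by move=> r x; rewrite mulr_ge0.
rewrite EFinM -prodEFin; congr (_ * _)%E; apply: eq_bigr => r _.
by rewrite fineK ?fin_num_measure// g0_density// integral_indicM.
Qed.

Let crm_events := \bigcup_(j in [set: 'I_3]) rm_events (crm (N j)).
Let label_events := \bigcup_(i in [set: I]) rv_events (zeta i).
Let latent_events := \bigcup_(i in [set: I]) rv_events (theta i).
Local Notation G := (crm_events `|` label_events `|` latent_events).

Lemma measurable_diagonal : measurable [set u : Theta * Theta | u.1 = u.2].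
Proof.
have -> : [set u : Theta * Theta | u.1 = u.2] =
    \bigcap_j ((U j `*` U j) `|` (~` U j `*` ~` U j)).
  apply/seteqP; split => [[x y] /= -> j _|[x y] xy /=].
    by have [Ux|nUx] := pselect (U j y); [left|right].
  by apply: sepU => j; have [[/= Ux Uy]|[/= Ux Uy]] := xy j Logic.I.
by apply: bigcapT_measurable => j; apply: measurableU; apply: measurableX => //;
   exact: measurableC.
Qed.

Let mthetaG i : measurable_fun (setT : set (g_sigma_algebraType G)) (theta i).
Proof.
move=> _ B mB; rewrite setTI; apply: sub_sigma_algebra; right; exists i => //.
by exists B => //; rewrite setTI.
Qed.

(** The conditional law of the data is available on the events of this sigma-algebra. Ties belong to
    it because the diagonal is measurable for the product sigma-algebra. *)
Lemma latent_sigma S : measurable S -> <<s G >> (E0 `&` distinct_values @^-1` S).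
Proof.
move=> mS; pose Gt := g_sigma_algebraType G.
have mC : measurable ([set w | forall i, zeta i w = lb (cl i)] : set Gt).
  have -> : [set w | forall i, zeta i w = lb (cl i)] =
      \bigcap_(i in [set: I]) (zeta i @^-1` [set lb (cl i)]).
    by apply/seteqP; split => [w hw i _|w hw i]; [exact: hw|exact: (hw i)].
  apply: fin_bigcap_measurable => [|i _]; first exact: finite_finset.
  apply: sub_sigma_algebra; left; right; exists i => //.
  by exists [set lb (cl i)] => //; rewrite setTI.
have mD (u : I * I) : measurable ([set w | theta u.1 w = theta u.2 w] : set Gt).
  have mp := measurable_fun_pair (mthetaG u.1) (mthetaG u.2).
  have := mp measurableT _ measurable_diagonal.
  by rewrite setTI.
have -> : E0 = [set w | forall i, zeta i w = lb (cl i)] `&`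
    \bigcap_(u in [set: I * I]) (if cl u.1 == cl u.2 then
       [set w | theta u.1 w = theta u.2 w] else ~` [set w | theta u.1 w = theta u.2 w]).
  apply/seteqP; split => [w [wz _ wc]|w [wz wc]].
    split => // u _; case: eqP => [/wc//|nc] /= /wc; exact: nc.
  split => // i j; have := wc (i, j) Logic.I => /=; case: eqP => /= [e e'|ne e'] //.
apply: (@measurableI _ Gt); first apply: (@measurableI _ Gt) => //.
  apply: fin_bigcap_measurable => [|u _]; first exact: finite_finset.
  by case: ifP => _ //; exact: measurableC.
have mT : measurable_fun (setT : set Gt) distinct_values.
  apply/measurable_fun_tnthP => r.
  have -> : (@tnth k Theta ^~ r) \o distinct_values = theta (rep r).
    by apply/funext => w; rewrite /= tnth_mktuple.
  exact: mthetaG.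
by have := mT measurableT _ mS; rewrite setTI.
Qed.

Let block_set (A : 'I_n1 -> set X) (B : 'I_n2 -> set X) (i : I) : set X :=
  match i with inl a => A a | inr b => B b end.

Let phi (A : set X) (t : Theta) : R := fine (\int[lam]_x (h x t * \1_A x)%:E)%E.

Let phiE A t : measurable A -> (\int[lam]_(x in A) (h x t)%:E = (phi A t)%:E)%E.
Proof.
move=> mA; rewrite integral_indicM /phi fineK// ge0_fin_numE; last first.
  by apply: integral_ge0 => x _; rewrite lee_fin mulr_ge0.
apply: (@le_lt_trans _ _ (\int[lam]_x (h x t)%:E)%E); last by rewrite h_density ltry.
have mht : measurable_fun setT (h ^~ t).
  exact: (measurableT_comp mh (pair2_measurable t)).
apply: ge0_le_integral => //.
- by move=> x _; rewrite lee_fin mulr_ge0.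
- by apply/measurable_EFinP; apply: measurable_funM => //; exact: measurable_indic.
- exact/measurable_EFinP.
- by move=> x _; rewrite lee_fin ler_piMr// indicE; case: (_ \in _).
Qed.

Let phi_ge0 A t : 0 <= phi A t.
Proof. by apply: fine_ge0; apply: integral_ge0 => x _; rewrite lee_fin mulr_ge0. Qed.

Let mphi A : measurable A -> measurable_fun setT (phi A).
Proof.
move=> mA; apply: (measurableT_comp (@fine_measurable R _ measurableT)).
apply: (measurable_integral_snd lam (f := fun t x => (h x t * \1_A x)%:E)) => //.
  apply/measurable_EFinP; apply: measurable_funM.
    exact: (measurableT_comp mh (@measurable_swap _ _ Theta X)).
  by apply: measurableT_comp => //; exact: measurable_indic.
by move=> t x; rewrite lee_fin mulr_ge0.
Qed.

(** The conditional probability that the data lie in the box, given that the ties are those of [pi]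
    and that the distinct values are [t]. *)
Let F A B (t : k.-tuple Theta) : R := \prod_i phi (block_set A B i) (tnth t (cl i)).

Let F_ge0 A B t : 0 <= F A B t. Proof. exact: prodr_ge0. Qed.

Let mblock A B i : (forall i, measurable (A i)) -> (forall i, measurable (B i)) ->
  measurable (block_set A B i).
Proof. by case: i => i mA mB /=. Qed.

Let mF A B : (forall i, measurable (A i)) -> (forall i, measurable (B i)) ->
  measurable_fun setT (F A B).
Proof.
move=> mA mB; apply: measurable_fin_prod => i.
by apply: (measurableT_comp (mphi (mblock i mA mB))); exact: measurable_tnth.
Qed.

(** On [E0] the latent value of [i] is the coordinate [cl i] of [distinct_values], so the
    conditional probability is a function of that tuple and can be integrated against its law. *)
Lemma data_law A B S : (forall i, measurable (A i)) -> (forall i, measurable (B i)) ->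
  measurable S ->
  (P (E0 `&` distinct_values @^-1` S `&`
     \bigcap_(i in [set: I]) (data i @^-1` block_set A B i)) =
   \int[power_measure H k]_t (F A B t * \1_S t * value_density t)%:E)%E.
Proof.
move=> mA mB mS; have [_ _ dataP] := model.
have mFS : measurable_fun setT (fun t => (F A B t * \1_S t)%:E).
  by apply/measurable_EFinP; apply: measurable_funM; [exact: mF|exact: measurable_indic].
have FS0 t : (0 <= (F A B t * \1_S t)%:E)%E by rewrite lee_fin mulr_ge0.
rewrite dataP.2//; last 2 first.
- exact: latent_sigma.
- by move=> i; exact: mblock.
transitivity (\int[P]_w ((F A B (distinct_values w) * \1_S (distinct_values w))%:E *
    (\1_E0 w)%:E))%E.
  rewrite integral_indicM; apply: eq_integral => w _.
  have -> : \1_(E0 `&` distinct_values @^-1` S) w = \1_S (distinct_values w) * \1_E0 w :> R.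
    by rewrite indicI /= mulrC.
  have [Ew|nEw] := pselect (E0 w); last first.
    have -> : \1_E0 w = 0 :> R by rewrite indicE memNset.
    by rewrite mulr0 !mule0.
  have -> : \1_E0 w = 1 :> R by rewrite indicE mem_set.
  rewrite mulr1 mule1 EFinM; congr (_ * _)%E; rewrite /F -prodEFin.
  by apply: eq_bigr => i _; rewrite (values i Ew) phiE//; exact: mblock.
rewrite -(integral_dens P mind ind0 (g := fun w => (F A B (distinct_values w) *
   \1_S (distinct_values w))%:E))//; last exact: (measurableT_comp mFS mdistinct).
transitivity (\int[pushforward PE distinct_values]_t (F A B t * \1_S t)%:E)%E.
  by rewrite ge0_integral_pushforward// preimage_setT.
transitivity (\int[dens (power_measure H k) mvalue_density value_density_ge0]_t
    (F A B t * \1_S t)%:E)%E.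
  apply: (eq_measure_integral
    (dens (power_measure H k) mvalue_density value_density_ge0)) => D mD _.
  exact: distinct_values_law.
by rewrite integral_dens//.
Qed.

(** The claimed density with its constants gathered in [K]; being real-valued, it is accepted by
    [dens]. *)
Let joint_density (v : n1.-tuple X * n2.-tuple X * k.-tuple Theta) : R :=
  value_density v.2 * \prod_i h (obs v.1.1 v.1.2 i) (tnth v.2 (cl i)).

Let joint_density_ge0 v : 0 <= joint_density v.
Proof. by rewrite mulr_ge0//; apply: prodr_ge0. Qed.

Let mjoint_density : measurable_fun setT joint_density.
Proof.
apply: measurable_funM; first exact: measurableT_comp.
apply: measurable_fin_prod => i.
have mt : measurable_fun setT
    (fun v : n1.-tuple X * n2.-tuple X * k.-tuple Theta => tnth v.2 (cl i)).
  exact: (measurableT_comp (measurable_tnth _) measurable_snd).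
have mo : measurable_fun setT
    (fun v : n1.-tuple X * n2.-tuple X * k.-tuple Theta => obs v.1.1 v.1.2 i).
  case: i {mt} => i /=.
    apply: (measurableT_comp (measurable_tnth i)).
    exact: (measurableT_comp measurable_fst measurable_fst).
  apply: (measurableT_comp (measurable_tnth i)).
  exact: (measurableT_comp measurable_snd measurable_fst).
exact: (measurableT_comp mh (measurable_fun_pair mo mt)).
Qed.

Lemma joint_density_box A B S : (forall i, measurable (A i)) ->
  (forall i, measurable (B i)) -> measurable S ->
  (\int[power_measure lam n1 \x power_measure lam n2 \x power_measure H k]_(v in
      box A `*` box B `*` S) (joint_density v)%:E =
   \int[power_measure H k]_t (F A B t * \1_S t * value_density t)%:E)%E.
Proof.
move=> mA mB mS; rewrite integral_indicM.
have mbox : measurable (box A `*` box B `*` S).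
  by do 2 apply: measurableX => //; exact: measurable_box.
rewrite fubini_triple; last 2 first.
- apply: emeasurable_funM; first exact/measurable_EFinP.
  by apply/measurable_EFinP; exact: measurable_indic.
- by move=> v; rewrite mule_ge0// lee_fin.
apply: eq_integral => t _.
pose f1 (a : 'I_n1) x := h x (tnth t (cl (inl a))) * \1_(A a) x.
pose f2 (b : 'I_n2) x := h x (tnth t (cl (inr b))) * \1_(B b) x.
have mht s : measurable_fun setT (h ^~ s).
  exact: (measurableT_comp mh (pair2_measurable s)).
have mf1 a : measurable_fun setT (f1 a).
  by apply: measurable_funM => //; exact: measurable_indic.
have mf2 b : measurable_fun setT (f2 b).
  by apply: measurable_funM => //; exact: measurable_indic.
have f10 a x : 0 <= f1 a x by rewrite mulr_ge0.
have f20 b x : 0 <= f2 b x by rewrite mulr_ge0.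
have mp n (f : 'I_n -> X -> R) : (forall i, measurable_fun setT (f i)) ->
    measurable_fun setT (fun x : n.-tuple X => \prod_i f i (tnth x i)).
  move=> mf; apply: measurable_fin_prod => i.
  by apply: measurableT_comp => //; exact: measurable_tnth.
have e u : ((joint_density (u, t))%:E * (\1_(box A `*` box B `*` S) (u, t))%:E =
    (\1_S t * value_density t)%:E *
    ((\prod_a f1 a (tnth u.1 a)) * (\prod_b f2 b (tnth u.2 b)))%:E)%E.
  rewrite -!EFinM; congr EFin.
  have -> : \1_(box A `*` box B `*` S) (u, t) = \1_(box A) u.1 * \1_(box B) u.2 * \1_S t :> R.
    by rewrite !indicE !in_setX /= -!mulnb !natrM.
  rewrite !indic_box /joint_density big_sumType/= /f1 /f2 !big_split/=; ring.
under eq_integral do rewrite e.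
rewrite ge0_integralZl//; last 3 first.
- apply/measurable_EFinP; apply: measurable_funM.
    exact: (measurableT_comp (mp _ _ mf1) measurable_fst).
  exact: (measurableT_comp (mp _ _ mf2) measurable_snd).
- by move=> u _; rewrite lee_fin mulr_ge0//; apply: prodr_ge0.
- by rewrite lee_fin mulr_ge0.
rewrite (integral_prod2 _ _ (mp _ _ mf1) (mp _ _ mf2)); last 2 first.
- by move=> x; apply: prodr_ge0.
- by move=> x; apply: prodr_ge0.
rewrite !integral_power_prod//.
have e1 a : (\int[lam]_x (f1 a x)%:E)%E = (phi (A a) (tnth t (cl (inl a))))%:E.
  by rewrite -(phiE _ (mA a)) [RHS]integral_indicM.
have e2 b : (\int[lam]_x (f2 b x)%:E)%E = (phi (B b) (tnth t (cl (inr b))))%:E.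
  by rewrite -(phiE _ (mB b)) [RHS]integral_indicM.
rewrite (eq_bigr _ (fun a _ => e1 a)) (eq_bigr _ (fun b _ => e2 b)) !prodEFin -!EFinM.
by congr EFin; rewrite /F big_sumType/=; ring.
Qed.

Let sample (w : Omega) : n1.-tuple X * n2.-tuple X * k.-tuple Theta :=
  ([tuple data (inl i) w | i < n1], [tuple data (inr j) w | j < n2], distinct_values w).

Let msample : measurable_fun setT sample.
Proof.
apply: measurable_fun_pair => //; apply: measurable_fun_pair; apply/measurable_fun_tnthP => i.
  have -> : (@tnth n1 X ^~ i) \o (fun w => [tuple data (inl i) w | i < n1]) = data (inl i).
    by apply/funext => w; rewrite /= tnth_mktuple.
  exact: measurable_funP.
have -> : (@tnth n2 X ^~ i) \o (fun w => [tuple data (inr i) w | i < n2]) = data (inr i).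
  by apply/funext => w; rewrite /= tnth_mktuple.
exact: measurable_funP.
Qed.

Lemma sample_law D : measurable D ->
  (P (E0 `&` sample @^-1` D) =
   \int[power_measure lam n1 \x power_measure lam n2 \x power_measure H k]_(v in D)
     (joint_density v)%:E)%E.
Proof.
move=> mD; have mpre D' : measurable D' -> measurable (sample @^-1` D').
  by move=> mD'; rewrite -[X in measurable X]setTI; exact: msample.
rewrite -PE_E; last exact: mpre.
apply: (triple_measure_unique (m1 := pushforward_measure PE msample)
  (m2 := dens (power_measure lam n1 \x power_measure lam n2 \x power_measure H k)%E
     mjoint_density joint_density_ge0)) mD.
  rewrite /= /pushforward preimage_setT PE_E// setIT.
  by apply: le_lt_trans (probability_le1 P mE0) (ltry _).
move=> A B S mA mB mS; have e := joint_density_box mA mB mS.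
rewrite -data_law// in e; apply: (etrans _ (esym e)).
rewrite /= /pushforward PE_E; last first.
  by apply: mpre; do 2 apply: measurableX => //; exact: measurable_box.
congr (P _); apply/seteqP; split => [w [Ew [[/= Aw Bw] Sw]]|w [[Ew Sw] ABw]].
  split; first by split.
  move=> [] i _ /=; [have := Aw i|have := Bw i]; by rewrite tnth_mktuple.
split => //; split => //; split => i /=; rewrite tnth_mktuple.
  exact: (ABw (inl i)).
exact: (ABw (inr i)).
Qed.

Lemma joint_law_pattern D : joint_law zeta theta data lab D = P (E0 `&` sample @^-1` D).
Proof.
rewrite /joint_law; congr (P _); apply/seteqP.
have cle i j : (cl i = cl j) <-> j \in finset.pblock pi i.
  case/and3P: (pi_partition) => /eqP cpi tpi _.
  rewrite -eq_pblock ?cpi ?finset.in_setT//.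
  rewrite -!(enum_val_cluster n1_gt0 pi_partition) (inj_eq enum_val_inj).
  by split=> /eqP.
have inc r i : i \in (enum_val r : {set I}) <-> cl i = r.
  by rewrite -(cluster_indexP n1_gt0 pi_partition); split => /eqP.
split => [w [wpi wz [t tw Dw]]|w [[wz _ wc] Dw]].
- have wc i j : theta i w = theta j w <-> cl i = cl j.
    rewrite cle -wpi pblock_equivalence_partition ?finset.in_setT//; first by split=> /eqP.
    by split => // /eqP ->.
  (* Each cluster contains its representative, so the tuple in [joint_law] is forced. *)
  have tE : t = distinct_values w.
    by apply: eq_from_tnth => r; rewrite tnth_mktuple (tw r)//; apply/inc; exact: repK.
  split; last by rewrite /sample /= -tE.
  by split => // i; rewrite wz (enum_val_cluster n1_gt0 pi_partition).
- split.
  + rewrite -[RHS](equivalence_partition_pblock pi_partition).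
    rewrite /preim_partition; apply: (congr1 (fun r => equivalence_partition r _)).
    apply/funext => i; apply/funext => j.
    by apply/eqP/idP => [/wc/cle|/cle/wc].
  + by move=> i; rewrite wz (enum_val_cluster n1_gt0 pi_partition).
  + exists (distinct_values w) => // r i /inc <-; apply: values; split => //.
Qed.

Theorem joint_law_density D : measurable D ->
  (joint_law zeta theta data lab D =
   \int[power_measure lam n1 \x power_measure lam n2 \x power_measure H k]_(v in D)
     gm_stable_density lab sigma z h g0 v)%E.
Proof.
move=> mD; rewrite joint_law_pattern sample_law//; apply: eq_integral => v _.
rewrite /gm_stable_density -(fineK gmsi_fin) -EFinM; congr EFin.
rewrite (likelihoodE n1_gt0 pi_partition) /joint_density /value_density /K /mixture_const.
move: (fine _) (\prod_r _) (\prod_i _) (xi _ _) (Gamma k%:R) (sigma ^+ _) => x1 x2 x3 x4 x5 x6.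
move: (z ^+ (ktilde1 pi lab + ktilde2 pi lab)) => x7.
set x8 := (1 - z) ^+ _; move: x8 ((Gamma n1%:R * Gamma n2%:R)^-1) => x8 x9.
by ring.
Qed.

End joint_law.

(** * A countable separating family from separability *)

Section separating_family.
Context {R : realType} (T : completeMetricType R).

Lemma separable_separating : separable T ->
  exists U : nat -> set (borel T), (forall j, measurable (U j)) /\
    (forall x y, (forall j, U j x <-> U j y) -> x = y).
Proof.
move=> [D cD dD].
have [f finj] : exists f : T -> nat, {in D &, injective f}.
  exact/countable_injP.
pose r n : R := n.+1%:R^-1; have r0 n : 0 < r n by rewrite invr_gt0.
(* Indices are a code of a center and a radius. By injectivity of [f] on [D] the union has at most
   one member; it spares choosing the center. The doubled radius puts in the interior every point
   within [r u.2] of the center. *)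
pose V (u : nat * nat) : set T :=
  \bigcup_(q in D `&` [set q | f q = u.1]) interior (ball q (r u.2 + r u.2)).
exists (fun j => oapp V set0 (choice.unpickle j)); split.
  move=> j; case: (choice.unpickle j) => [u|]//=; apply: sub_sigma_algebra.
  by apply: bigcup_open => q _; exact: open_interior.
move=> x y hxy; apply: contrapT => /eqP xy.
(* A third: [q] is within [r n] of [x], and if [y] were in the same set it would be within [2 r n]
   of [q], so the distance would be below [3 r n]. *)
have e0 : 0 < mdist x y / 3 by rewrite divr_gt0// mdist_gt0.
have [n _ /(_ n (leqnn n)) rn] := near_infty_natSinv_lt (PosNum e0).
have [q [xq Dq]] : interior (ball x (r n)) `&` D !=set0.
  apply: dD; last exact: open_interior.
  by exists x; exact: nbhsx_ballx.
have {}xq : ball x (r n) q by exact: interior_subset xq.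
have /(_ (choice.pickle (f q, n))) := hxy; rewrite choice.pickleK => -[+ _].
case; first exists q => //.
  apply/nbhs_ballP; exists (r n) => //= t xt.
  by apply: ball_triangle xt; exact: ball_sym.
move=> q' [Dq' /= fq'] /interior_subset.
have -> : q' = q by apply: finj => //; exact/mem_set.
move=> qy; have := ball_triangle xq qy; rewrite ballEmdist /= => h.
by move: rn h; rewrite -/(r n) /=; lra.
Qed.

End separating_family.

Theorem corollary3 (R : realType)
  (Theta X : completeMetricType R) (sepTheta : separable Theta)
  (sepX : separable X)
  (H : {sigma_finite_measure set (borel Theta) -> \bar R})
  (P0 : probability (borel Theta) R) (P0_nonatomic : nonatomic P0)
  (g0 : borel Theta -> R)
  (mg0 : measurable_fun [set: borel Theta] g0)
  (g0_ge0 : forall t, 0 <= g0 t)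
  (g0_density : forall B : set (borel Theta), measurable B ->
     P0 B = (\int[H]_(t in B) (g0 t)%:E)%E)
  (lam : {sigma_finite_measure set (borel X) -> \bar R})
  (h : borel X -> borel Theta -> R)
  (mh : measurable_fun [set: (borel X * borel Theta)%type] (fun u => h u.1 u.2))
  (h_ge0 : forall x t, 0 <= h x t)
  (h_density : forall t, (\int[lam]_(x in [set: borel X]) (h x t)%:E)%E = 1%E)
  (sigma : R) (sigma01 : 0 < sigma < 1)
  (c : R) (c_gt0 : 0 < c) (z : R) (z01 : 0 < z < 1)
  (n1 n2 : nat) (n1_gt0 : (0 < n1)%N) (n2_gt0 : (0 < n2)%N)
  (d : measure_display) (Omega : measurableType d) (P : probability Omega R)
  (N : 'I_3 -> R.-ker Omega ~> (R * borel Theta)%type)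
  (gmN : gm_dependent P c z (rho_stable sigma) P0 N)
  (zeta : sample_index n1 n2 -> {RV P >-> 'I_3})
  (theta : sample_index n1 n2 -> {RV P >-> borel Theta})
  (data : sample_index n1 n2 -> {RV P >-> borel X})
  (model : mixture_model N lam h zeta theta data)
  (pi : {set {set sample_index n1 n2}})
  (pi_partition : finset.partition pi [set: sample_index n1 n2]%SET)
  (lab : {set sample_index n1 n2} -> 'I_3) (lab_config : label_config pi lab) :
  forall D : set (n1.-tuple (borel X) * n2.-tuple (borel X) *
                  #|pi|.-tuple (borel Theta)),
    measurable D ->
    joint_law zeta theta data lab D =
    (\int[power_measure lam n1 \x power_measure lam n2 \x
          power_measure H #|pi|]_(v in D)
       gm_stable_density lab sigma z h g0 v)%E.
Proof.
move=> D mD; have [U [mU sepU]] := separable_separating sepTheta.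
exact: (joint_law_density mU sepU P0_nonatomic mg0 g0_ge0 g0_density mh h_ge0
  h_density sigma01 c_gt0 z01 n1_gt0 n2_gt0 gmN model pi_partition lab_config mD).
Qed.
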